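(* Let $d\ge2$. (i) For every $q$ with $d<q<+\infty$ there is a constant $C_{d,q}>0$, depending only on $d$ and $q$, such that $\lambda_q^{1/q}(\Omega)\ge C_{d,q}\,\rho(\Omega)^{-1}$ for every nonempty bounded open set $\Omega\subset\mathbb{R}^d$, and such that for every $p$ with $q<p\le+\infty$ $$M_d(p,q)<\frac{\lambda_p^{1/p}(B_1)}{C_{d,q}}.$$ (ii) If $1\le q<p\le+\infty$ and $q\le d$, then $M_d(p,q)=+\infty$.
   Context: For an open set $\Omega\subset\mathbb{R}^d$ with $0<|\Omega|<+\infty$ ($|\cdot|$ is Lebesgue measure) and $1<p<+\infty$, let $$\lambda_p(\Omega)=\inf\left\{\frac{\int_\Omega|\nabla u|^p\,dx}{\int_\Omega|u|^p\,dx}\ :\ u\in C^1_c(\Omega),\ u\not\equiv0\right\}.$$ For the extreme exponents, $\lambda_1^{1/1}(\Omega)=\lambda_1(\Omega):=h(\Omega)$, where $h(\Omega)=\inf\{P(E)/|E| : \overline E\subset\Omega \text{ compact},\ |E|>0\}$ is the Cheeger constant ($P$ is the De Giorgi perimeter), equivalently $h(\Omega)=\inf\{\int_\Omega|\nabla u|\,dx/\int_\Omega|u|\,dx : u\in C^1_c(\Omega),\ u\not\equiv0\}$; and $\lambda_p^{1/p}(\Omega):=\rho(\Omega)^{-1}$ when $p=+\infty$, where $\rho(\Omega)$ is the inradius, i.e. the supremum of the radii of balls contained in $\Omega$. Set $\mathcal{F}_{p,q}(\Omega)=\lambda_p^{1/p}(\Omega)/\lambda_q^{1/q}(\Omega)$,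 let $\mathcal{A}^d_{all}$ be the class of open sets $\Omega\subset\mathbb{R}^d$ with $0<|\Omega|<+\infty$, and $$M_d(p,q)=\sup_{\Omega\in\mathcal{A}^d_{all}}\mathcal{F}_{p,q}(\Omega).$$ $B_1$ is the unit ball of $\mathbb{R}^d$ centered at the origin. *)

(* Defs.v *)
From HB Require Import structures.
From mathcomp Require Import all_boot all_order all_algebra.
From mathcomp Require Import all_classical all_reals all_analysis.

Set Implicit Arguments.
Unset Strict Implicit.
Unset Printing Implicit Defensive.
Import Order.TTheory GRing.Theory Num.Theory.
Import numFieldNormedType.Exports.
Local Open Scope classical_set_scope.
Local Open Scope ring_scope.

(* The sigma-algebra of 'rV[R]_n is the product one, as for n.-tuple T in the
   library; it is the Borel one by rV_measurableE below. *)
Definition rV_display : measure_display -> measure_display.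
Proof. exact. Qed.

Section measurable_rV.
Context {R : realType}.
Variable n : nat.

Let coors : 'I_n -> 'rV[R]_n -> R := fun i x => x ord0 i.

Let rV_set0 : g_sigma_preimage coors set0.
Proof. exact: sigma_algebra0. Qed.

Let rV_setC A : g_sigma_preimage coors A -> g_sigma_preimage coors (~` A).
Proof. exact: sigma_algebraC. Qed.

Let rV_bigcup (F : _^nat) : (forall i, g_sigma_preimage coors (F i)) ->
  g_sigma_preimage coors (\bigcup_i (F i)).
Proof. exact: sigma_algebra_bigcup. Qed.

HB.instance Definition _ := @isMeasurable.Build
  (rV_display default_measure_display) 'rV[R]_n (g_sigma_preimage coors)
  rV_set0 rV_setC rV_bigcup.

End measurable_rV.

Definition rV_cons (R : realType) n (xy : measurableTypeR R * 'rV[R]_n) :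
  'rV[R]_n.+1 := row_mx (const_mx xy.1 : 'rV[R]_1) xy.2.

Lemma rV_cons0 (R : realType) n (xy : measurableTypeR R * 'rV[R]_n) :
  rV_cons xy ord0 ord0 = xy.1.
Proof.
rewrite (_ : rV_cons xy ord0 _ = rV_cons xy ord0 (lshift n (ord0 : 'I_1))).
  by rewrite [LHS](@row_mxEl _ 1 1 n) mxE.
by congr (rV_cons xy _ _); exact: val_inj.
Qed.

Lemma rV_consS (R : realType) n (xy : measurableTypeR R * 'rV[R]_n) i :
  rV_cons xy ord0 (lift ord0 i) = xy.2 ord0 i.
Proof.
rewrite (_ : lift ord0 i = rshift 1 i); last exact: val_inj.
exact: (@row_mxEr _ 1 1 n).
Qed.

Section measurability.
Context {R : realType}.

Lemma measurable_coord n (i : 'I_n) :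
  measurable_fun [set: 'rV[R]_n] (fun x => x ord0 i).
Proof.
move=> _ Y mY; rewrite setTI; apply: sub_sigma_algebra => /=.
rewrite -bigcup_seq/=; exists i => /=; first by rewrite mem_index_enum.
by exists Y => //; rewrite setTI.
Qed.

Lemma measurable_fun_coordP d (T : measurableType d) n (f : T -> 'rV[R]_n) :
  (forall i, measurable_fun [set: T] (fun x => f x ord0 i)) ->
  measurable_fun [set: T] f.
Proof.
move=> mf _ A mA; rewrite setTI.
move: A mA.
apply: (@smallest_sub _ _ _ [set A : set 'rV[R]_n | measurable (f @^-1` A)]).
  split => /=.
  - by rewrite preimage_set0.
  - by move=> A /= mA; rewrite setTD -preimage_setC; exact: measurableC.
  - by move=> F mF /=; rewrite preimage_bigcup; exact: bigcupT_measurable.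
rewrite -bigcup_seq/= => A [i _ [Y mY <-]] /=.
by rewrite setTI; have := mf i measurableT _ mY; rewrite setTI.
Qed.

Lemma measurable_rV_cons n :
  measurable_fun [set: measurableTypeR R * 'rV[R]_n] (@rV_cons R n).
Proof.
apply: measurable_fun_coordP => i.
case: (unliftP ord0 i) => [j ->|->]; last first.
  by under eq_fun do rewrite rV_cons0; exact: measurable_fst.
under eq_fun do rewrite rV_consS.
exact: (measurableT_comp (measurable_coord j)).
Qed.


Lemma measurable_box n (A : 'I_n -> set R) : (forall i, measurable (A i)) ->
  measurable [set x : 'rV[R]_n | forall i, A i (x ord0 i)].
Proof.
move=> mA; have -> : [set x : 'rV[R]_n | forall i, A i (x ord0 i)] =
    \bigcap_(i in [set: 'I_n]) (fun x : 'rV[R]_n => x ord0 i) @^-1` A i.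
  by apply/seteqP; split=> x /= bx i => [_|]; exact: bx.
apply: fin_bigcap_measurable => [|i _]; first exact: finite_finset.
by rewrite -[X in measurable X]setTI; exact: (measurable_coord i measurableT).
Qed.

Lemma open_rV_measurable n (U : set 'rV[R]_n) : open U -> measurable U.
Proof.
move=> oU.
pose box (c : 'rV[rat]_n * rat) := [set x : 'rV[R]_n |
  forall i, (ball (ratr (c.1 ord0 i) : R) (ratr c.2)) (x ord0 i)].
have mbox c : measurable (box c).
  apply: (@measurable_box _ (fun i => ball (ratr (c.1 ord0 i) : R) (ratr c.2))) => i.
  by apply: measurable_realfun.open_measurable; exact: ball_open.
have -> : U = \bigcup_(c in [set: 'rV[rat]_n * rat])
    (if `[< box c `<=` U >] then box c else set0).
  apply/seteqP; split=> [x Ux|x [c _]]; last first.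
    by case: asboolP => /= [bU bx|//]; exact: bU.
  have /nbhs_ballP[e /= e0 eU] : nbhs x U by exact: open_nbhs_nbhs.
  have [r /itvP re] : exists r : rat, ratr r \in `]0, (e / 2)[%R.
    by apply: rat_in_itvoo; rewrite divr_gt0.
  have r0 : 0 < ratr r :> R by rewrite re.
  have /choice[c cP] : forall i, exists q : rat, ball (x ord0 i) (ratr r) (ratr q : R).
    move=> i; have [q /itvP qP] : exists q : rat, ratr q \in `](x ord0 i), (x ord0 i + ratr r)[%R.
      by apply: rat_in_itvoo; rewrite ltrDl.
    by exists q; rewrite /ball /= ler0_norm ?subr_le0 ?qP// opprB ltrBlDl qP.
  exists (\row_i c i, r) => //.
  case: asboolP => [_ i /=|]; first by rewrite mxE; exact: ball_sym.
  case=> y by_; apply: eU; split => // i j; rewrite ord1.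
  apply: (@le_ball _ _ _ (ratr r + ratr r)).
    by rewrite [leRHS]splitr lerD// ltW// re.
  apply: (ball_triangle (cP j)).
  by have := by_ j; rewrite /= mxE.
apply: countable_bigcupT_measurable => // c.
by case: asboolP.
Qed.

Lemma rV_measurableE n : (@measurable _ 'rV[R]_n) = <<s open >>.
Proof.
apply/seteqP; split; last first.
  apply: smallest_sub; first exact: sigma_algebra_measurable.
  exact: open_rV_measurable.
apply: smallest_sub; first exact: smallest_sigma_algebra.
rewrite -bigcup_seq/= => A [i _ [Y mY <-]] /=; rewrite setTI.
pose T := g_sigma_algebraType (@open 'rV[R]_n).
have mx : measurable_fun [set: T] (fun x : T => (x : 'rV[R]_n) ord0 i).
  apply: (measurability _ (measurable_realfun.RGenOpens.measurableE R)).
  move=> _ [_ [a [b ->] <-]]; apply: sub_sigma_algebra; rewrite setTI.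
  apply: open_comp => [x _|]; [exact: coord_continuous|exact: interval_open].
by have := mx measurableT _ mY; rewrite setTI.
Qed.
End measurability.

Section lebesgue_rV_step.
Context {R : realType}.
Variables (n : nat) (mu : {sigma_finite_measure set 'rV[R]_n -> \bar R}).
Local Open Scope ereal_scope.

Definition lebesgue_rV_step : set 'rV[R]_n.+1 -> \bar R :=
  pushforward (@lebesgue_measure R \x mu) (@rV_cons R n).

Let step0 : lebesgue_rV_step set0 = 0.
Proof. by rewrite /lebesgue_rV_step /pushforward preimage_set0 measure0. Qed.

Let step_ge0 A : 0 <= lebesgue_rV_step A.
Proof. by rewrite /lebesgue_rV_step /pushforward measure_ge0. Qed.

Let mpre (A : set 'rV[R]_n.+1) : measurable A -> measurable (@rV_cons R n @^-1` A).
Proof. by move=> mA; rewrite -[X in measurable X]setTI; exact: measurable_rV_cons. Qed.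

Let step_sigma_additive : semi_sigma_additive lebesgue_rV_step.
Proof.
move=> F mF tF mUF; rewrite /lebesgue_rV_step /pushforward preimage_bigcup.
apply: measure_semi_sigma_additive.
- by move=> k; exact: mpre.
- apply/trivIsetP => /= i j _ _ ij; rewrite -preimage_setI.
  by move/trivIsetP : tF => /(_ _ _ _ _ ij) ->//; rewrite preimage_set0.
- by rewrite -preimage_bigcup; exact: mpre.
Qed.

HB.instance Definition _ := isMeasure.Build _ _ _ lebesgue_rV_step
  step0 step_ge0 step_sigma_additive.

Let step_sigma_finite : sigma_finite setT lebesgue_rV_step.
Proof.
have /sigma_finiteP[F [FT ndF Foo]] := sigma_finiteT (@lebesgue_measure R).
have /sigma_finiteP[G [GT ndG Goo]] := sigma_finiteT mu.
pose uncons (x : 'rV[R]_n.+1) : measurableTypeR R * 'rV[R]_n :=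
  (x ord0 ord0, \row_j x ord0 (lift ord0 j)).
have muncons : measurable_fun setT uncons.
  apply: measurable_fun_pair; first exact: measurable_coord.
  apply: measurable_fun_coordP => i; under eq_fun do rewrite mxE.
  exact: measurable_coord.
have consK xy : uncons (rV_cons xy) = xy.
  rewrite [RHS]surjective_pairing; congr pair; first exact: rV_cons0.
  by apply/rowP => j; rewrite mxE rV_consS.
exists (fun i => uncons @^-1` (F i `*` G i)).
  apply/seteqP; split=> // x _.
  have [i _ Fi] : (\bigcup_i F i) (uncons x).1 by rewrite -FT.
  have [j _ Gj] : (\bigcup_i G i) (uncons x).2 by rewrite -GT.
  exists (maxn i j) => //; split.
    by move: Fi; exact/subsetPset/ndF/leq_maxl.
  by move: Gj; exact/subsetPset/ndG/leq_maxr.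
move=> i; have [mF Fi] := Foo i; have [mG Gi] := Goo i; split.
  by rewrite -[X in measurable X]setTI; apply: muncons => //; exact: measurableX.
rewrite /lebesgue_rV_step /pushforward -comp_preimage.
rewrite (_ : _ @^-1` _ = F i `*` G i).
  by rewrite product_measure1E// lte_mul_pinfty// ge0_fin_numE.
by apply/funext => xy; rewrite -[in RHS](consK xy).
Qed.

HB.instance Definition _ := Measure_isSigmaFinite.Build _ _ _ lebesgue_rV_step
  step_sigma_finite.

End lebesgue_rV_step.

(* Lebesgue measure on R^n, as an iterated product measure; lebesgue_rV_box
   gives its value on products of Borel sets. *)
Fixpoint lebesgue_rV (R : realType) (n : nat) :
    {sigma_finite_measure set 'rV[R]_n -> \bar R} :=
  match n with
  | 0 => dirac (0 : 'rV[R]_0)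
  | m.+1 => lebesgue_rV_step (@lebesgue_rV R m)
  end.

Lemma lebesgue_rV_box (R : realType) n (A : 'I_n -> set (measurableTypeR R)) :
  (forall i, measurable (A i)) ->
  lebesgue_rV R n [set x | forall i, A i (x ord0 i)] =
  (\prod_(i < n) lebesgue_measure (A i))%E.
Proof.
elim: n A => [|n IH] A mA.
  by rewrite big_ord0 /= diracE mem_set// => -[].
rewrite big_ord_recl -IH//= /lebesgue_rV_step /pushforward.
have mB := @measurable_box R n (fun i => A (lift ord0 i)) (fun i => mA _).
rewrite -product_measure1E//.
congr (_ _); apply/seteqP; split=> [[x y] /= h|[x y] /= [h1 h2] i].
  split=> [|i]; first by have := h ord0; rewrite rV_cons0.
  by have := h (lift ord0 i); rewrite rV_consS.
by case: (unliftP ord0 i) => [j|] ->; rewrite ?rV_cons0 ?rV_consS.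
Qed.

Section shape_functionals.
Context {R : realType} {d : nat}.
Implicit Types (W E : set 'rV[R]_d) (u : 'rV[R]_d -> R).
Local Notation mu := (lebesgue_rV R d).

(* The norm `|x| of the library on 'rV[R]_d is the sup norm. *)
Definition enorm (x : 'rV[R]_d) : R := Num.sqrt (\sum_(i < d) x ord0 i ^+ 2).

Definition eball (c : 'rV[R]_d) (r : R) : set 'rV[R]_d :=
  [set x | enorm (x - c) < r].

Definition partial (i : 'I_d) u (x : 'rV[R]_d) : R := 'D_(delta_mx ord0 i) u x.

Definition grad u (x : 'rV[R]_d) : 'rV[R]_d := \row_i partial i u x.

Definition divergence (phi : 'rV[R]_d -> 'rV[R]_d) (x : 'rV[R]_d) : R :=
  \sum_(i < d) partial i (fun y => phi y ord0 i) x.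

Definition C1 u : Prop :=
  (forall x, differentiable u x) /\ (forall i, continuous (partial i u)).

(* Elements of C^1_c(W) are represented by their extension by 0 to R^d. *)
Definition C1c W u : Prop :=
  [/\ C1 u, compact (closure [set x | u x != 0])
    & closure [set x | u x != 0] `<=` W].

Local Open Scope ereal_scope.

Definition rayleigh (p : R) W u : \bar R :=
  (\int[mu]_(x in W) ((enorm (grad u x)) `^ p)%:E) /
  (\int[mu]_(x in W) (`|u x| `^ p)%:E).

Definition lambda (p : R) W : \bar R :=
  ereal_inf [set rayleigh p W u | u in
    [set u | C1c W u /\ exists x, u x != 0%R]].

(* De Giorgi perimeter *)
Definition perimeter E : \bar R :=
  ereal_sup [set \int[mu]_(x in E) (divergence phi x)%:E | phi in
    [set phi : 'rV[R]_d -> 'rV[R]_d |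
      (forall i, C1c setT (fun x => phi x ord0 i)) /\
      (forall x, (enorm (phi x) <= 1)%R)]].

Definition cheeger W : \bar R :=
  ereal_inf [set perimeter E / mu E | E in
    [set E : set 'rV[R]_d | [/\ measurable E,
        compact (closure E), closure E `<=` W
        & 0 < mu E]]].

Definition inradius W : \bar R :=
  ereal_sup [set r%:E | r in
    [set r : R | (0 < r)%R /\ exists c, eball c r `<=` W]].

(* lambda_p^{1/p} for 1 <= p <= +oo; the value at -oo is junk. *)
Definition lambda_root (p : \bar R) W : \bar R :=
  match p with
  | r%:E => if r == 1%R then cheeger W else (lambda r W) `^ (r^-1)
  | +oo => (inradius W)^-1
  | -oo => 0
  end.

Definition F_pq (p q : \bar R) W : \bar R := lambda_root p W / lambda_root q W.

Definition A_all : set (set 'rV[R]_d) :=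
  [set W | [/\ open W, 0 < mu W & mu W < +oo]].

End shape_functionals.

Definition M_pq (R : realType) (d : nat) (p q : \bar R) : \bar R :=
  ereal_sup [set F_pq p q W | W in @A_all R d].

(* Main.v *)
Require Import Defs.
From mathcomp Require Import all_boot all_order all_algebra.
From mathcomp Require Import all_classical all_reals all_analysis.
From mathcomp Require Import measurable_realfun.
From mathcomp Require Import ring lra.

(* Both parts rest on one inequality.  If u is C^1, u(y) = 0 and Q is
   star-shaped about y, integrating u along the path s |-> y + s^(m+1) (z - y),
   applying Jensen on [0, 1] and changing variables bounds the integral of
   |u|^p over Q by a constant times that of |grad u|^p, as soon as
   (s^m)^p <= L (s^(m+1))^d wherever grad u does not vanish on the path.
   When p > d, a large m makes this hold with L = 1.  In (i), cubes of side four
   times the inradius each contain a point outside W, and summing over a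
   tiling gives lambda_q^{1/q} >= C / inradius; the scaling bound
   lambda_p^{1/p}(W) <= lambda_p^{1/p}(B_1) / r for balls of radius r in W
   then bounds M_d(p, q).
   In (ii), W is a cube of side 6N minus balls of radius delta around the integer
   points.  If u vanishes near the centers one may take L to be a
   negative power of delta, so lambda_p^{1/p} >= K delta^beta with
   beta < d/q - 1 (beta = 0 if q = d), while cut-offs averaged over n + 1 dyadic
   scales give lambda_q <= C (N^{-q} + (n + 1)^{1-q} r^{d-q}).  For q < d
   let r go to 0 with N large; for q = d let n go to infinity. *)

Set Implicit Arguments.
Unset Strict Implicit.
Unset Printing Implicit Defensive.
Import Order.TTheory GRing.Theory Num.Theory.
Import numFieldNormedType.Exports.
Local Open Scope classical_set_scope.
Local Open Scope ring_scope.

(** * Lebesgue measure on row vectors *)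
Section measure_rV.
Context {R : realType}.
Local Notation mu n := (lebesgue_rV R n).
Local Open Scope ereal_scope.

(** After the integrals are exchanged, contracting [Q] towards [y] by a ratio t costs a Jacobian
    t^(-d), which blows up at the start of the path. The speed of the path compensates for it only
    if m p >= (m + 1) d, which large m achieve exactly when p > d. Otherwise the holes intervene:
    the gradient vanishes on them, so ratios below the hole size never count. The resulting exponent
    is about max(0, d/p - 1), whereas the capacity of a hole gives d/q - 1 on the other side; q < p
    separates the two. At q = d both exponents vanish and a single scale gains nothing: the decay
    has to come from the logarithmic capacity of a ball, hence the dyadic averaging. Admissible sets
    have finite measure, so the holes cannot fill the whole space; the outer cut-off at scale N is
    what costs N^(-q). At q = 1 the functional is defined through sets, so the cut-off is replaced
    by a set on which it equals 1, with a perimeter estimated through translates. *)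

Lemma measurable_rV_consr n (t : R) :
  measurable_fun [set: 'rV[R]_n] (fun w => rV_cons (t, w)).
Proof.
apply: (measurableT_comp (@measurable_rV_cons R n)).
exact: measurable_fun_pair.
Qed.

Lemma integral_rV_cons n (f : 'rV[R]_n.+1 -> \bar R) :
  measurable_fun [set: 'rV[R]_n.+1] f -> (forall x, 0 <= f x) ->
  \int[mu n.+1]_x f x =
  \int[@lebesgue_measure R]_t \int[mu n]_w f (rV_cons (t, w)).
Proof.
move=> mf f0 /=.
have := @ge0_integral_pushforward _ _ _ _ R _ (@measurable_rV_cons R n)
  (@lebesgue_measure R \x mu n) setT f measurableT mf.
rewrite preimage_setT => -> //.
rewrite fubini_tonelli1//=.
exact: (measurableT_comp mf (@measurable_rV_cons R n)).
Qed.

(** The image of Lebesgue measure under the affine map, multiplied by [t], agrees with Lebesgue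
    measure on half-open intervals, hence everywhere by uniqueness. *)
Lemma integral_affine1 (f : R -> \bar R) (a t : R) : (0 < t)%R ->
  measurable_fun [set: R] f -> (forall x, 0 <= f x) ->
  \int[@lebesgue_measure R]_x f (a + t * x)%R =
  (t^-1)%:E * \int[@lebesgue_measure R]_x f x.
Proof.
move=> t0 mf f0; have tn : t != 0%R by rewrite gt_eqF.
pose phi : measurableTypeR R -> measurableTypeR R := fun x => (a + t * x)%R.
have mphi : measurable_fun setT phi.
  by apply: measurable_funD => //; exact: measurable_funM.
have [nu nuE] : exists nu : {measure set (measurableTypeR R) -> \bar R},
    nu = pushforward (@lebesgue_measure R) phi :> (set _ -> \bar R).
  by unshelve eexists; [exact: (pushforward (@lebesgue_measure R) phi)|].
have eq A : measurable A -> lebesgue_measure A = mscale (NngNum (ltW t0)) nu A.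
  apply: lebesgue_measure_unique.
  move=> _ [[u v]] _ <- /=; rewrite /mscale /= nuE /pushforward.
  rewrite (_ : phi @^-1` _ = `]((u - a) / t)%R, ((v - a) / t)%R]%classic); last first.
    apply/seteqP; split=> x /=; rewrite !in_itv/= /phi ltr_pdivrMr// ler_pdivlMr// ltrBlDl lerBrDl;
      by rewrite (mulrC x).
  rewrite !lebesgue_measure_itv/= !lte_fin ltr_pM2r ?invr_gt0// ltrD2r.
  case: ifPn => _; last by rewrite mule0.
  by rewrite -!EFinB -EFinM; congr EFin; field.
have := @ge0_integral_pushforward _ _ _ _ R _ mphi (@lebesgue_measure R) setT f measurableT mf.
rewrite preimage_setT => <- //.
rewrite [in RHS](eq_measure_integral (mscale (NngNum (ltW t0)) nu)); last first.
  by move=> A mA _; exact: eq.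
by rewrite ge0_integral_mscale//= muleA -EFinM mulVf// mul1e nuE.
Qed.

(** Splitting off the first coordinate reduces the change of variables to dimension one; each
    coordinate contributes a factor [t^-1]. *)
Lemma integral_affine n (f : 'rV[R]_n -> \bar R) (a : 'rV[R]_n) (t : R) :
  (0 < t)%R -> measurable_fun [set: 'rV[R]_n] f -> (forall x, 0 <= f x) ->
  \int[mu n]_x f (a + t *: x)%R = (t ^- n)%:E * \int[mu n]_x f x.
Proof.
elim: n f a => [|n IH] f a t0 mf f0.
  rewrite expr0 invr1 mul1e; apply: eq_integral => x _; congr f.
  by apply/rowP => -[].
rewrite !integral_rV_cons//; last first.
  apply: (measurableT_comp mf); apply: measurable_fun_coordP => i.
  under eq_fun do rewrite !mxE.
  apply: measurable_funD => //; apply: measurable_funM => //.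
  exact: measurable_coord.
pose F s := \int[mu n]_w f (rV_cons (s, w)).
have F0 s : 0 <= F s by apply: integral_ge0.
have mF : measurable_fun [set: R] F.
  apply: (@measurable_fun_fubini_tonelli_F _ _ _ _ _ (mu n) (f \o @rV_cons R n)) => //=.
  exact: (measurableT_comp mf (@measurable_rV_cons R n)).
have mFa : measurable_fun [set: R] (fun s : R => F (a ord0 ord0 + t * s)%R).
  have mg : measurable_fun [set: R] (fun s : R => a ord0 ord0 + t * s)%R.
    by apply: measurable_funD => //; exact: measurable_funM.
  exact: (measurableT_comp mF mg).
transitivity (\int[@lebesgue_measure R]_s
   ((t ^- n)%:E * F (a ord0 ord0 + t * s)%R)).
  apply: eq_integral => s _.
  have mfs := measurableT_comp mf
    (@measurable_rV_consr n (a ord0 ord0 + t * s)%R).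
  rewrite /F -(IH _ (\row_j a ord0 (lift ord0 j)) t0 mfs); last by move=> x; exact: f0.
  apply: eq_integral => w _ /=; congr f.
  have affE m (b z : 'rV[R]_m) i : ((b + t *: z) ord0 i = b ord0 i + t * z ord0 i)%R.
    by rewrite !mxE.
  by apply/rowP => i; case: (unliftP ord0 i) => [j|] ->;
    rewrite affE ?rV_consS ?rV_cons0 ?affE ?mxE.
have tn0 : 0%R <= (t ^- n)%:E by rewrite lee_fin invr_ge0 exprn_ge0// ltW.
have H := ge0_integralZl (@lebesgue_measure R) measurableT mFa (fun _ _ => F0 _) tn0.
have H2 := integral_affine1 (a ord0 ord0) t0 mF F0.
refine (etrans H (etrans (congr1 (mule (t ^- n)%:E) H2) _)).
by rewrite muleA -EFinM -invfM mulrC -exprS.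
Qed.

Lemma continuous_measurable_rV n (f : 'rV[R]_n -> R) :
  continuous f -> measurable_fun [set: 'rV[R]_n] f.
Proof.
move=> cf; apply: (measurability _ (RGenOpens.measurableE R)).
move=> _ [_ [a [b ->] <-]]; rewrite setTI.
by apply: open_rV_measurable; apply: open_comp => [x _|]; [exact: cf|exact: interval_open].
Qed.

(** The booleans select the kind of endpoints, so that one statement serves open, closed and
    half-open boxes. *)
Lemma lebesgue_rV_itv n (a b : 'I_n -> R) (bl br : bool) : (forall i, (a i <= b i)%R) ->
  mu n [set x | forall i, x ord0 i \in Interval (BSide bl (a i)) (BSide br (b i))] =
  (\prod_(i < n) (b i - a i))%R%:E.
Proof.
move=> ab.
rewrite (@lebesgue_rV_box R n (fun i => [set` Interval (BSide bl (a i)) (BSide br (b i))]))//.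
rewrite -prodEFin; apply: eq_bigr => i _.
rewrite lebesgue_measure_itv/= lte_fin.
case: ltP => // ba; have -> : a i = b i by apply/eqP; rewrite eq_le ab.
by rewrite subrr.
Qed.

Lemma open_measure_gt0 n (W : set 'rV[R]_n) : open W -> W !=set0 -> 0 < mu n W.
Proof.
move=> oW [c Wc].
have /nbhs_ballP[e /= e0 eW] : nbhs c W by exact: open_nbhs_nbhs.
have h : [set x : 'rV[R]_n | forall i, x ord0 i \in `](c ord0 i - e / 2)%R, (c ord0 i + e / 2)%R[ ] `<=` W.
  move=> x hx; apply: eW; split=> // i j; rewrite ord1.
  have := hx j; rewrite in_itv/= => /andP[h1 h2].
  rewrite /ball/= ltr_norml; apply/andP; split; lra.
have := @lebesgue_rV_itv n (fun i => c ord0 i - e / 2)%R (fun i => c ord0 i + e / 2)%R false true.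
have {}/[swap]/[apply] E : forall i, (c ord0 i - e / 2 <= c ord0 i + e / 2)%R by move=> i; lra.
apply: (@lt_le_trans _ _ (\prod_(i < n) ((c ord0 i + e / 2) - (c ord0 i - e / 2)))%R%:E).
  by rewrite lte_fin prodr_gt0// => i _; lra.
rewrite -E.
apply: le_measure => //; rewrite inE.
  by apply: (@measurable_box R n (fun i => [set` `](c ord0 i - e / 2)%R, (c ord0 i + e / 2)%R[])).
exact: open_rV_measurable.
Qed.

Lemma bounded_measure_lty n (W : set 'rV[R]_n) : measurable W ->
  (exists M : R, forall x, W x -> forall i, (`|x ord0 i| <= M)%R) -> mu n W < +oo.
Proof.
move=> mW [M hM].
have h : W `<=` [set x : 'rV[R]_n | forall i, x ord0 i \in `[(- `|M|)%R, `|M|%R] ].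
  move=> x Wx i; rewrite in_itv/= -ler_norml; apply: (le_trans (hM _ Wx i)).
  exact: ler_norm.
have := @lebesgue_rV_itv n (fun=> - `|M|)%R (fun=> `|M|%R) true false.
have {}/[swap]/[apply] E : forall i : 'I_n, (- `|M| <= `|M|)%R.
  by move=> i; rewrite (@le_trans _ _ 0%R) ?oppr_le0.
apply: (@le_lt_trans _ _ (\prod_(i < n) (`|M| - - `|M|))%R%:E); last by rewrite ltry.
rewrite -E; apply: le_measure => //; rewrite inE//.
exact: (@measurable_box R n (fun i => [set` `[(- `|M|)%R, `|M|%R]])).
Qed.

End measure_rV.

(** * Differentiation along rays *)
Lemma continuous_sum_ord {R : realType} {T : topologicalType} n
    (f : 'I_n -> T -> R) :
  (forall i, continuous (f i)) -> continuous (fun x => \sum_(i < n) f i x).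
Proof.
move=> cf; apply: (@continuous_big R _ +%R 0 xpredT _ T) => [|i _]; last exact: cf.
exact: add_continuous.
Qed.

Section calculus.
Context {R : realType} {d : nat}.
Implicit Types (u : 'rV[R]_d -> R) (v x y z : 'rV[R]_d).

Lemma abs_coord_le_enorm x i : `|x ord0 i| <= enorm x.
Proof.
rewrite -sqrtr_sqr ler_wsqrtr// (bigD1 i)//= lerDl.
by apply: sumr_ge0 => j _; exact: sqr_ge0.
Qed.

Lemma enorm_ge0 x : 0 <= enorm x.
Proof. exact: sqrtr_ge0. Qed.

Lemma enorm_le_sum x : enorm x <= \sum_(i < d) `|x ord0 i|.
Proof.
rewrite -[leRHS]ger0_norm ?sumr_ge0// -sqrtr_sqr ler_wsqrtr//.
have -> : \sum_(i < d) x ord0 i ^+ 2 = \sum_(i < d) `|x ord0 i| * `|x ord0 i|.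
  by apply: eq_bigr => i _; rewrite -expr2 real_normK// num_real.
rewrite expr2 mulr_suml; apply: ler_sum => i _.
by rewrite ler_wpM2l// (bigD1 i)//= lerDl sumr_ge0.
Qed.

Lemma continuous_enorm : continuous (@enorm R d).
Proof.
move=> x; apply: continuous_comp; last exact: sqrt_continuous.
have c (i : 'I_d) : continuous (fun x : 'rV[R]_d => x ord0 i ^+ 2).
  move=> z; apply: (@continuous_comp _ _ _ (fun x : 'rV[R]_d => x ord0 i) (fun t : R => t ^+ 2)).
    exact: coord_continuous.
  exact: exprn_continuous.
exact: (continuous_sum_ord c).
Qed.

Lemma diff_partialE u x v : differentiable u x ->
  'd u x v = \sum_(i < d) v ord0 i * partial i u x.
Proof.
move=> du; rewrite [v in LHS]row_sum_delta linear_sum; apply: eq_bigr => i _.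
by rewrite linearZ /partial deriveE.
Qed.

(** The factor [d] counts coordinates: the sum is bounded term by term, each partial derivative by
    the whole gradient. *)
Lemma norm_diff_le u x v (D : R) : differentiable u x -> 0 <= D ->
  (forall i, `|v ord0 i| <= D) -> `|'d u x v| <= d%:R * D * enorm (grad u x).
Proof.
move=> du D0 vD; rewrite diff_partialE//.
apply: (le_trans (ler_norm_sum _ _ _)).
have -> : d%:R * D * enorm (grad u x) = \sum_(i < d) D * enorm (grad u x).
  by rewrite sumr_const card_ord -mulrA mulr_natl.
apply: ler_sum => i _; rewrite normrM ler_pM//.
by apply: le_trans (abs_coord_le_enorm _ i); rewrite mxE.
Qed.

Lemma C1_continuous u : C1 u -> continuous u.
Proof. by move=> [du _] x; exact: differentiable_continuous. Qed.

Lemma continuous_enorm_grad u : C1 u -> continuous (fun x => enorm (grad u x)).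
Proof.
move=> [_ pu] x.
have -> : (fun x => enorm (grad u x)) =
    (fun x => Num.sqrt (\sum_(i < d) partial i u x ^+ 2)).
  by apply/funext => z; congr Num.sqrt; apply: eq_bigr => i _; rewrite mxE.
apply: (@continuous_comp _ _ _ (fun x => \sum_(i < d) partial i u x ^+ 2) Num.sqrt); last exact: sqrt_continuous.
apply: (@continuous_sum_ord R 'rV[R]_d d (fun i x => partial i u x ^+ 2)) => i {}x.
apply: (@continuous_comp _ _ _ (partial i u) (fun t : R => t ^+ 2)).
  exact: pu.
exact: exprn_continuous.
Qed.

Definition ray (m : nat) y z (s : R) : 'rV[R]_d := y + s ^+ m *: (z - y).

Lemma continuous_ray m y z : continuous (ray m y z).
Proof.
move=> s; apply: cvgD; first exact: cvg_cst.
by apply: cvgZr_tmp; exact: exprn_continuous.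
Qed.

Lemma is_diff_ray m y z (s : R) : is_diff s (ray m.+1 y z)
  (fun h => (m.+1%:R * s ^+ m * h) *: (z - y)).
Proof.
rewrite (_ : ray m.+1 y z = cst y + (( *:%R ^~ (z - y)) \o (@id R ^+ m.+1))); last first.
  by apply/funext => t; rewrite /ray /= exprfctE.
have h := is_diff_comp (is_diffX m (is_diff_id s)) (is_diff_scalel ((@id R ^+ m.+1) s) (z - y)).
have {}h := is_diffD (is_diff_cst y s) h.
by apply: (is_diff_eq h); apply/funext => k /=; rewrite /cst add0r.
Qed.

Lemma derive_along_ray u m y z s : C1 u ->
  derivable (u \o ray m.+1 y z) s 1 /\
  derive1 (u \o ray m.+1 y z) s =
  m.+1%:R * s ^+ m * 'd u (ray m.+1 y z s) (z - y).
Proof.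
move=> [du _].
have dr := @is_diff_ray m y z s.
have dc := is_diff_comp dr (differentiableP (du (ray m.+1 y z s))).
have dF : differentiable (u \o ray m.+1 y z) s by case: dc.
split; first exact/derivable1_diffP.
rewrite derive1E'//; case: dc => _ ->.
by rewrite /= mulr1 linearZ.
Qed.

Lemma continuous_diff_ray u m y z : C1 u ->
  continuous (fun s : R => m.+1%:R * s ^+ m * 'd u (ray m.+1 y z s) (z - y)).
Proof.
move=> [du pu] s.
apply: cvgM; first by apply: cvgM; [exact: cvg_cst|exact: exprn_continuous].
suff : continuous (fun s : R => 'd u (ray m.+1 y z s) (z - y)) by exact.
have -> : (fun s : R => 'd u (ray m.+1 y z s) (z - y)) =
    (fun s => \sum_(i < d) (z - y) ord0 i * partial i u (ray m.+1 y z s)).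
  by apply/funext => t; rewrite diff_partialE.
apply: (@continuous_sum_ord R R^o d) => i {}s.
apply: cvgM; first exact: cvg_cst.
apply: (@continuous_comp _ _ _ (ray m.+1 y z) (partial i u)).
  exact: continuous_ray.
exact: pu.
Qed.

Lemma integral_along_ray u m y z : C1 u ->
  (\int[lebesgue_measure]_(s in `[0%R, 1%R])
     (m.+1%:R * s ^+ m * 'd u (ray m.+1 y z s) (z - y))%:E)%E =
  (u z - u y)%:E.
Proof.
move=> C1u; have [du pu] := C1u.
pose F := u \o ray m.+1 y z.
have cF : continuous F.
  move=> s; apply: continuous_comp; first exact: continuous_ray.
  exact: C1_continuous.
have -> : (u z - u y)%:E = ((F 1)%:E - (F 0)%:E)%E.
  by rewrite -EFinB /F /= /ray expr1n expr0n scale1r scale0r addr0 [y + _]addrC subrK.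
apply: continuous_FTC2 => //.
- by apply: continuous_subspaceT; exact: continuous_diff_ray.
- split.
  + by move=> s _; exact: (derive_along_ray m y z s C1u).1.
  + by apply: cvg_at_right_filter; exact: cF.
  + by apply: cvg_at_left_filter; exact: cF.
- by move=> s _; exact: (derive_along_ray m y z s C1u).2.
Qed.

End calculus.

(** * A Poincare inequality on star-shaped sets *)
Lemma fubini_tonelli_in d1 d2 (T1 : measurableType d1) (T2 : measurableType d2)
    (R : realType) (m1 : {sigma_finite_measure set T1 -> \bar R})
    (m2 : {sigma_finite_measure set T2 -> \bar R}) (A : set T1) (B : set T2)
    (f : T1 * T2 -> \bar R) :
  measurable A -> measurable B -> measurable_fun setT f ->
  (forall x, (0 <= f x)%E) ->
  (\int[m1]_(x in A) \int[m2]_(y in B) f (x, y) =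
   \int[m2]_(y in B) \int[m1]_(x in A) f (x, y))%E.
Proof.
move=> mA mB mf f0.
pose g := f \_ (A `*` B).
have mg : measurable_fun setT g.
  by apply/(measurable_restrictT f); [exact: measurableX|exact: measurable_funTS].
have g0 x : (0 <= g x)%E by rewrite /g patchE; case: ifP.
have E := fubini_tonelli (m1 := m1) (m2 := m2) g mg g0.
rewrite integral_mkcond [in RHS]integral_mkcond.
transitivity (\int[m1]_x \int[m2]_y g (x, y))%E.
  apply/esym/eq_integral => x _; rewrite patchE; case: ifPn => xA.
    rewrite [RHS]integral_mkcond; apply: eq_integral => y _.
    by rewrite /g !patchE in_setX/= xA.
  by apply: integral0_eq => y _; rewrite /g patchE in_setX/= (negbTE xA).
rewrite E; apply: eq_integral => y _; rewrite patchE; case: ifPn => yB.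
  rewrite [RHS]integral_mkcond; apply: eq_integral => x _.
  by rewrite /g !patchE in_setX/= yB andbT.
by apply: integral0_eq => x _; rewrite /g patchE in_setX/= (negbTE yB) andbF.
Qed.

Lemma measurable_integral_in d1 d2 (T1 : measurableType d1) (T2 : measurableType d2)
    (R : realType) (m2 : {sigma_finite_measure set T2 -> \bar R}) (B : set T2)
    (f : T1 * T2 -> \bar R) :
  measurable B -> measurable_fun setT f -> (forall x, (0 <= f x)%E) ->
  measurable_fun setT (fun x => (\int[m2]_(y in B) f (x, y))%E).
Proof.
move=> mB mf f0.
pose g := f \_ (setT `*` B).
have mg : measurable_fun setT g.
  by apply/(measurable_restrictT f); [exact: measurableX|exact: measurable_funTS].
have g0 x : (0 <= g x)%E by rewrite /g patchE; case: ifP.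
rewrite (_ : (fun x => _) = (fun x => \int[m2]_y g (x, y))%E).
  exact: (measurable_fun_fubini_tonelli_F g mg g0).
apply/funext => x; rewrite integral_mkcond; apply: eq_integral => y _.
by rewrite /g !patchE in_setX/= in_setT.
Qed.

Section poincare.
Context {R : realType}.

(* The tangent of t |-> t^p at b lies below its graph. *)
Lemma young_tangent (p a b : R) : 1 < p -> 0 <= a -> 0 <= b ->
  p * (a * b `^ (p - 1)) <= a `^ p + (p - 1) * b `^ p.
Proof.
move=> p1 a0 b0; have p0 : 0 < p by rewrite (lt_trans _ p1).
have pn : p != 0 by rewrite gt_eqF.
have p10 : 0 < p - 1 by rewrite subr_gt0.
have p1n : p - 1 != 0 by rewrite gt_eqF.
have := @conjugate_powR R a (b `^ (p - 1)) p (p / (p - 1)) a0 (powR_ge0 _ _) p0.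
have q0 : 0 < p / (p - 1) by rewrite divr_gt0.
have e : p^-1 + (p / (p - 1))^-1 = 1 by field; rewrite pn p1n.
move=> /(_ q0 e); rewrite -powRrM.
have -> : (p - 1) * (p / (p - 1)) = p by field.
rewrite -(ler_pM2l p0) => /le_trans; apply.
rewrite le_eqVlt; apply/orP; left; apply/eqP; field.
by rewrite pn p1n.
Qed.

(** Integrate over the unit interval the tangent inequality at [b], the absolute value of the mean:
    the integral of [|f|] is at least [b], so p b^p is at most the right-hand integral plus (p - 1)
    b^p. That integral may be infinite. *)
Lemma jensen_powR (f : R -> R) (a p : R) : 1 < p ->
  measurable_fun [set: R] f ->
  (\int[lebesgue_measure]_(s in `[0%R, 1%R]) (f s)%:E = a%:E)%E ->
  ((`|a| `^ p)%:E <=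
   \int[lebesgue_measure]_(s in `[0%R, 1%R]) (`|f s| `^ p)%:E)%E.
Proof.
move=> p1 mf fa; set b := `|a|.
have bge0 : 0 <= b by rewrite normr_ge0.
have p0 : 0 < p by rewrite (lt_trans _ p1).
have mabs : measurable_fun [set: R] (fun s => `|f s|) by exact: measurableT_comp.
have mabsp : measurable_fun [set: R] (fun s => `|f s| `^ p).
  by apply: (measurableT_comp (measurable_powR p)).
have bf : (b%:E <= \int[lebesgue_measure]_(s in `[0%R, 1%R]) (`|f s|)%:E)%E.
  rewrite /b -[(`|a|)%:E]/(`|a%:E|)%E -fa.
  apply: (le_trans (le_abse_integral _ _ _)) => //.
  by apply/measurable_EFinP; apply: measurable_funTS.
set I := (X in (_ <= X)%E).
have I0 : (0 <= I)%E by apply: integral_ge0 => s _; rewrite lee_fin powR_ge0.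
have [b0|bN0] := eqVneq b 0.
  by rewrite b0 powR0 ?gt_eqF.
have bp : 0 < b `^ (p - 1) by rewrite powR_gt0// lt_neqAle eq_sym bN0 normr_ge0.
have key : ((p * b `^ (p - 1))%:E * b%:E <= I + ((p - 1) * b `^ p)%:E)%E.
  have c0 : 0 <= p * b `^ (p - 1) by rewrite mulr_ge0// ltW.
  apply: (@le_trans _ _ ((p * b `^ (p - 1))%:E *
     \int[lebesgue_measure]_(s in `[0%R, 1%R]) (`|f s|)%:E)%E).
    by apply: lee_wpmul2l => //; rewrite lee_fin.
  rewrite -ge0_integralZl//; try by [rewrite lee_fin | apply/measurable_EFinP; apply: measurable_funTS].
  have -> : ((p - 1) * b `^ p)%:E =
    (\int[lebesgue_measure]_(s in `[0%R, 1%R]) ((p - 1) * b `^ p)%:E)%E.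
    rewrite integral_cst//= lebesgue_measure_itv/= lte_fin ltr01.
    by rewrite -EFinB subr0 mule1.
  have q0 : 0 <= (p - 1) * b `^ p by rewrite mulr_ge0 ?powR_ge0 ?subr_ge0 ?ltW.
  rewrite -ge0_integralD//; try by [rewrite lee_fin | apply/measurable_EFinP; apply: measurable_funTS].
  apply: ge0_le_integral => //.
  - by move=> s _; rewrite lee_fin mulr_ge0.
  - by apply/measurable_EFinP; apply: measurable_funM => //; exact: measurable_funTS.
  - by apply/measurable_EFinP; apply: measurable_funD => //; exact: measurable_funTS.
  - move=> s _; rewrite lee_fin -mulrA (mulrC (b `^ _)).
    by apply: young_tangent; rewrite ?normr_ge0.
move: I0 key; case: I => [r| |]//= r0; last by move=> _; rewrite leey.
rewrite !lee_fin -mulrA (mulrC _ b) mulr_powRB1// => h.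
lra.
Qed.


Context {d : nat}.
Local Notation mu := (lebesgue_rV R d).
Implicit Types (u : 'rV[R]_d -> R) (y z : 'rV[R]_d).

(** Writing [|s|] keeps the base of the power nonnegative for every real [s], so that the integrand
    can be compared and measured without reference to the interval. *)
Lemma pointwise_ray_bound u m (p D : R) y z : C1 u -> 1 < p -> 0 <= D ->
  (forall i, `|z ord0 i - y ord0 i| <= D) ->
  ((`|u z - u y| `^ p)%:E <= \int[lebesgue_measure]_(s in `[0%R, 1%R])
    ((m.+1%:R * (d%:R * D) * (`|s| ^+ m * enorm (grad u (ray m.+1 y z s)))) `^ p)%:E)%E.
Proof.
move=> C1u p1 D0 zy; have [du pu] := C1u.
have cf : continuous (fun s : R => m.+1%:R * s ^+ m * 'd u (ray m.+1 y z s) (z - y)).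
  exact: continuous_diff_ray.
have mf := continuous_measurable_fun cf.
apply: le_trans (jensen_powR p1 mf (integral_along_ray m y z C1u)) _.
have mg : measurable_fun [set: R] (fun s =>
    (m.+1%:R * (d%:R * D) * (`|s| ^+ m * enorm (grad u (ray m.+1 y z s)))) `^ p).
  apply: (measurableT_comp (measurable_powR p)).
  apply: measurable_funM => //; apply: measurable_funM.
    by apply: measurable_funX; exact: normr_measurable.
  apply: continuous_measurable_fun => s.
  apply: (@continuous_comp _ _ _ (ray m.+1 y z) (fun x => enorm (grad u x))).
    exact: continuous_ray.
  exact: continuous_enorm_grad.
apply: ge0_le_integral => //.
- apply/measurable_EFinP; apply: measurable_funTS.
  apply: (measurableT_comp (measurable_powR p)); exact: measurableT_comp.
- by apply/measurable_EFinP; apply: measurable_funTS.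
- move=> s _; rewrite lee_fin ge0_ler_powR ?nnegrE ?mulr_ge0 ?enorm_ge0 ?exprn_ge0//.
    by rewrite (le_trans _ (ltW p1)).
  rewrite !normrM normrX ger0_norm// [leRHS]mulrACA ler_wpM2l ?mulr_ge0 ?exprn_ge0//.
  by apply: norm_diff_le => // i; rewrite !mxE.
Qed.

(* The weight condition compares the speed m.+1 s^m of the path with the
   Jacobian (s^m.+1)^d of the contraction z |-> ray m.+1 y z s; using the power
   s^m.+1 rather than s keeps all integrands bounded when p > d. *)
Lemma star_poincare u (Q : set 'rV[R]_d) m (p D L : R) y :
  C1 u -> 1 < p -> 0 <= D -> 0 <= L -> (0 < m)%N -> measurable Q ->
  (forall z i, Q z -> `|z ord0 i - y ord0 i| <= D) ->
  (forall z s, Q z -> 0 < s <= 1 -> Q (ray m.+1 y z s)) ->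
  u y = 0 ->
  (forall z s, Q z -> 0 < s <= 1 -> enorm (grad u (ray m.+1 y z s)) != 0 ->
     (s ^+ m) `^ p <= L * (s ^+ m.+1) ^+ d) ->
  (\int[mu]_(x in Q) (`|u x| `^ p)%:E <=
   ((m.+1%:R * (d%:R * D)) `^ p * L)%:E *
   \int[mu]_(x in Q) (enorm (grad u x) `^ p)%:E)%E.
Proof.
move=> C1u p1 D0 L0 m0 mQ QD Qray uy QL.
have p0 : 0 < p by rewrite (lt_trans _ p1).
set C := m.+1%:R * (d%:R * D).
have C0 : 0 <= C by rewrite !mulr_ge0.
pose G x := enorm (grad u x) `^ p.
have mE : measurable_fun setT (fun x : 'rV[R]_d => enorm (grad u x)).
  by apply: continuous_measurable_rV; exact: continuous_enorm_grad.
have mG : measurable_fun setT G by exact: (measurableT_comp (measurable_powR p) mE).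
pose f (zs : 'rV[R]_d * measurableTypeR R) : \bar R := ((C * (`|zs.2| ^+ m *
   enorm (grad u (ray m.+1 y zs.1 zs.2)))) `^ p)%:E.
have mray : measurable_fun setT (fun zs : 'rV[R]_d * measurableTypeR R => ray m.+1 y zs.1 zs.2).
  apply: measurable_fun_coordP => i.
  under eq_fun do rewrite !mxE.
  apply: measurable_funD => //; apply: measurable_funM.
    by apply: measurable_funX; exact: measurable_snd.
  apply: measurable_funB => //.
  exact: (measurableT_comp (measurable_coord i) measurable_fst).
have mf : measurable_fun setT f.
  apply/measurable_EFinP; apply: (measurableT_comp (measurable_powR p)).
  apply: measurable_funM => //; apply: measurable_funM.
    apply: measurable_funX; apply: measurableT_comp => //; exact: measurable_snd.
  exact: (measurableT_comp mE mray).
have f0 zs : (0 <= f zs)%E by rewrite lee_fin powR_ge0.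
apply: (@le_trans _ _ (\int[mu]_(z in Q)
   \int[lebesgue_measure]_(s in `[0%R, 1%R]) f (z, s)))%E.
  apply: ge0_le_integral => //.
  - apply/measurable_EFinP; apply: measurable_funTS.
    apply: (measurableT_comp (measurable_powR p)); apply: measurableT_comp => //.
    by apply: continuous_measurable_rV; exact: C1_continuous.
  - apply: measurable_funTS.
    exact: (measurable_integral_in (@lebesgue_measure R) _ mf f0).
  - move=> z Qz; have := pointwise_ray_bound m C1u p1 D0 (fun i => QD z i Qz).
    rewrite uy subr0 -/C => /le_trans; apply.
    by rewrite le_eqVlt; apply/orP; left; apply/eqP; apply: eq_integral.
rewrite (fubini_tonelli_in _ (lebesgue_measure) mQ _ mf f0)//.
set K := (_ * _)%E.
have K0 : (0 <= K)%E.
  rewrite mule_ge0 ?lee_fin ?mulr_ge0 ?powR_ge0//.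
  by apply: integral_ge0 => x _; rewrite lee_fin powR_ge0.
(* The interval has length one, so it is enough to bound the inner integral by [K] for each fixed
   [s]. *)
apply: (@le_trans _ _ (\int[lebesgue_measure]_(s in `[0%R, 1%R]) cst K s)%E); last first.
  rewrite integral_cst//= lebesgue_measure_itv/= lte_fin ltr01.
  by rewrite -EFinB subr0 mule1.
have mF : measurable_fun [set: measurableTypeR R] (fun s => (\int[mu]_(z in Q) f (z, s))%E).
  have msw : measurable_fun setT (fun sz : measurableTypeR R * 'rV[R]_d => (sz.2, sz.1)).
    by apply: measurable_fun_pair; [exact: measurable_snd|exact: measurable_fst].
  have mfs := measurableT_comp mf msw.
  exact: (measurable_integral_in mu mQ mfs (fun=> f0 _)).
apply: ge0_le_integral => //.
- by move=> s _; apply: integral_ge0.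
- exact: measurable_funTS.
move=> s /=; rewrite in_itv/= => /andP[s0 s1].
(* At [s = 0] the contraction degenerates to a point, but the integrand vanishes because [m] is
   positive. *)
have [->|sN0] := eqVneq s 0.
  rewrite integral0_eq// => z _.
  by rewrite /f/= normr0 expr0n gtn_eqF// mul0r mulr0 powR0// gt_eqF.
have {}s0 : 0 < s by rewrite lt_neqAle eq_sym sN0.
pose t := s ^+ m.+1.
have t0 : 0 < t by rewrite exprn_gt0.
pose h := (EFin \o G) \_ Q.
have mh : measurable_fun setT h.
  by apply/(measurable_restrictT _ mQ); apply: measurable_funTS; exact/measurable_EFinP.
have h0 x : (0 <= h x)%E by rewrite /h patchE; case: ifP => // _; rewrite lee_fin powR_ge0.
have rayE z : ray m.+1 y z s = (y - t *: y) + t *: z.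
  by rewrite /ray -/t scalerBr addrCA addrC.
have mfs : measurable_fun setT (fun z => f (z, s)).
  have mp : measurable_fun setT (fun z : 'rV[R]_d => (z, s : measurableTypeR R)).
    exact: measurable_fun_pair.
  exact: (measurableT_comp mf mp).
have mhr : measurable_fun setT (fun z => h (y - t *: y + t *: z)).
  apply: (measurableT_comp mh); apply: measurable_fun_coordP => i.
  under eq_fun do rewrite !mxE.
  apply: measurable_funD => //; apply: measurable_funM => //.
  exact: measurable_coord.
have k0 : (0 <= (C `^ p * L * t ^+ d)%:E)%E.
  by rewrite lee_fin !mulr_ge0 ?powR_ge0 ?exprn_ge0// ltW.
rewrite integral_mkcond.
(* The weight hypothesis produces [t ^+ d], exactly what the change of variables below cancels;
   star-shapedness keeps the image of [Q] in [Q], where [h] is not cut off. *)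
apply: (@le_trans _ _ (\int[mu]_z ((C `^ p * L * t ^+ d)%:E * h (y - t *: y + t *: z)%R))%E).
  apply: ge0_le_integral => //.
  - by move=> z _; rewrite patchE; case: ifP.
  - by apply/(measurable_restrictT _ mQ); apply: measurable_funTS.
  - exact: measurable_funeM.
  - move=> z _; rewrite patchE; case: ifPn => [|_]; last exact: mule_ge0.
    rewrite inE => Qz; rewrite -rayE /h patchE mem_set; last by apply: Qray; rewrite ?s0.
    rewrite /f /G /= -EFinM lee_fin (gtr0_norm s0).
    set E := enorm _; have E0 : 0 <= E by exact: enorm_ge0.
    (* Points with zero gradient contribute nothing, which is why the weight condition is asked only
       where the gradient is nonzero. *)
    have [->|EN0] := eqVneq E 0; first by rewrite !mulr0 powR0 ?mulr0// gt_eqF.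
    have sm0 : 0 <= s ^+ m by rewrite exprn_ge0// ltW.
    rewrite (powRM _ C0 (mulr_ge0 sm0 E0)) (powRM _ sm0 E0).
    rewrite mulrA ler_wpM2r ?powR_ge0// -mulrA ler_wpM2l ?powR_ge0//.
    by apply: (QL z); rewrite ?s0.
rewrite (ge0_integralZl mu measurableT mhr (fun z _ => h0 _) k0).
rewrite (integral_affine (y - t *: y) t0 mh h0) muleA -EFinM mulfK ?gt_eqF ?exprn_gt0//.
by rewrite -integral_mkcond.
Qed.

End poincare.

(** * Tilings by cubes and compactly supported functions *)
Section fibers.
Context d (T : measurableType d) {R : realType}.
Variable mu : {measure set T -> \bar R}.
Local Open Scope ereal_scope.

(** Countable additivity over the fibers, numbered by [pickle]; integers that code no index give
    empty sets. *)
Lemma le_integral_fibers (I : countType) (phi : T -> I) (f g : T -> \bar R) (K : R) :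
  (forall k, measurable (phi @^-1` [set k])) ->
  measurable_fun setT f -> measurable_fun setT g ->
  (forall x, 0 <= f x) -> (forall x, 0 <= g x) ->
  (forall k, \int[mu]_(x in phi @^-1` [set k]) f x <=
     K%:E * \int[mu]_(x in phi @^-1` [set k]) g x) ->
  \int[mu]_x f x <= K%:E * \int[mu]_x g x.
Proof.
move=> mphi mf mg f0 g0 fg.
pose F n := (pickle \o phi) @^-1` [set n].
have FE n : (exists k, F n = phi @^-1` [set k]) \/ F n = set0.
  have [[k <-]|h] := pselect (exists k : I, pickle k = n).
    left; exists k; apply/seteqP; rewrite /F; split=> x /=; last by move=> ->.
    by move/(pcan_inj pickleK).
  by right; apply/seteqP; split=> x //= hx; apply: h; exists (phi x).
have mF n : measurable (F n) by have [[k ->]|->] := FE n.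
have UF : \bigcup_n F n = setT.
  by apply/seteqP; split=> // x _; exists (pickle (phi x)).
have tF : trivIset setT F by exact: trivIset_preimage1.
rewrite -UF ge0_integral_bigcup//; last by rewrite UF.
rewrite ge0_integral_bigcup//; last by rewrite UF.
rewrite -nneseriesZl; last by move=> n _; exact: integral_ge0.
apply: lee_nneseries => [n _ _|n _]; first exact: integral_ge0.
have [[k ->]|->] := FE n; first exact: fg.
by rewrite !integral_set0 mule0.
Qed.

Lemma integral_gt0_of_lower_bound (f : T -> \bar R) (U : set T) (c : R) :
  (0 < c)%R -> measurable U -> 0 < mu U -> measurable_fun setT f ->
  (forall x, 0 <= f x) -> (forall x, U x -> c%:E <= f x) ->
  0 < \int[mu]_x f x.
Proof.
move=> c0 mU U0 mf f0 cf.
apply: (@lt_le_trans _ _ (c%:E * mu U)); first by rewrite mule_gt0.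
apply: (@le_trans _ _ (\int[mu]_(x in U) f x)).
  rewrite -integral_cst//; apply: ge0_le_integral => //.
  - by move=> x _; rewrite lee_fin ltW.
  - exact: measurable_funTS.
by apply: ge0_subset_integral => //; exact: measurable_funTS.
Qed.

Lemma integral_bounded_lty (f : T -> R) (S : set T) (B : R) :
  measurable S -> mu S < +oo -> measurable_fun setT f ->
  (forall x, 0 <= f x <= B)%R -> (forall x, ~ S x -> f x = 0%R) ->
  \int[mu]_x (f x)%:E < +oo.
Proof.
move=> mS Soo mf fB fS.
have -> : \int[mu]_x (f x)%:E = \int[mu]_(x in S) (f x)%:E.
  rewrite [RHS]integral_mkcond; apply: eq_integral => x _.
  rewrite patchE; case: ifPn => // /negP; rewrite inE => /fS ->//.
have f0 x : (0 <= f x)%R by have /andP[] := fB x.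
apply: (@le_lt_trans _ _ (`|B|%:E * mu S)).
  rewrite -integral_cst//; apply: ge0_le_integral => //.
  - by move=> x _; rewrite lee_fin.
  - by apply/measurable_EFinP; exact: measurable_funTS.
  - by move=> x _; rewrite lee_fin (le_trans _ (ler_norm B))//; have /andP[] := fB x.
by rewrite lte_mul_pinfty// lee_fin.
Qed.
End fibers.

(** * Tiling of the space by cubes *)

Section cubes.
Context {R : realType} {d : nat}.
Local Notation mu := (lebesgue_rV R d).

(** Half-open sides make the cubes the fibers of a rounding map; centering them at lattice points
    places each hole of a perforated cube in the middle of its own tile. *)
Definition cube (l : R) (k : 'rV[int]_d) : set 'rV[R]_d :=
  [set x | forall i, x ord0 i \in
     `[l * ((k ord0 i)%:~R - 2^-1), l * ((k ord0 i)%:~R + 2^-1)[ ].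

Lemma measurable_cube l k : measurable (cube l k).
Proof.
exact: (@measurable_box R d (fun i => [set`
  `[l * ((k ord0 i)%:~R - 2^-1), l * ((k ord0 i)%:~R + 2^-1)[ ])).
Qed.

Definition cube_index (l : R) (x : 'rV[R]_d) : 'rV[int]_d :=
  \row_i Num.floor (x ord0 i / l + 2^-1).

Lemma cube_indexE l k : 0 < l -> cube_index l @^-1` [set k] = cube l k.
Proof.
move=> l0.
have e (x : 'rV[R]_d) i :
    (x ord0 i \in `[l * ((k ord0 i)%:~R - 2^-1), l * ((k ord0 i)%:~R + 2^-1)[) =
    (Num.floor (x ord0 i / l + 2^-1) == k ord0 i).
  rewrite floor_eq in_itv/= intrD; congr (_ && _).
    by rewrite -lerBlDr ler_pdivlMr// mulrC.
  rewrite -ltrBrDr ltr_pdivrMr// mulrC; congr (_ < _ * _); lra.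
apply/seteqP; split=> x /=.
  move=> h i; have : Num.floor (x ord0 i / l + 2^-1) == k ord0 i by rewrite -h mxE.
  by rewrite -e.
by move=> h; apply/rowP => i; have := h i; rewrite e mxE => /eqP.
Qed.

Lemma le_integral_cubes (l K : R) (f g : 'rV[R]_d -> \bar R) : 0 < l ->
  measurable_fun setT f -> measurable_fun setT g ->
  (forall x, 0 <= f x)%E -> (forall x, 0 <= g x)%E ->
  (forall k, \int[mu]_(x in cube l k) f x <=
     K%:E * \int[mu]_(x in cube l k) g x)%E ->
  (\int[mu]_x f x <= K%:E * \int[mu]_x g x)%E.
Proof.
move=> l0 mf mg f0 g0 fg.
apply: (@le_integral_fibers _ _ R mu _ (cube_index l)) => // k.
  by rewrite cube_indexE//; exact: measurable_cube.
by rewrite cube_indexE.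
Qed.

End cubes.

(** * Integrals of compactly supported functions of class C^1 *)

Section C1c_facts.
Context {R : realType} {d : nat}.
Local Notation mu := (lebesgue_rV R d).
Implicit Types (u : 'rV[R]_d -> R) (W : set 'rV[R]_d).

Lemma grad_eq0 u x : ~ closure [set x | u x != 0] x -> grad u x = 0.
Proof.
move=> nx; apply/rowP => i; rewrite !mxE /partial.
have o : open (~` closure [set x | u x != 0]) by apply: closed_openC; exact: closed_closure.
have : \near x, u x = cst 0 x.
  have := open_nbhs_nbhs (conj o nx); apply: filterS => y ny.
  by apply/eqP; apply/negP => /negP uy; apply: ny; exact: subset_closure.
by move/(near_eq_derive (delta_mx ord0 i)) => ->; rewrite derive_cst.
Qed.

Lemma C1c_outside W u x : C1c W u -> ~ W x -> u x = 0 /\ grad u x = 0.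
Proof.
move=> [_ _ sW] nW.
have ns : ~ closure [set x | u x != 0] x by move/sW.
split; last exact: grad_eq0.
by apply/eqP; apply/negP => /negP uy; apply: ns; exact: subset_closure.
Qed.

(** Integrals over the whole space can be cut along a tiling or rescaled without regard to [W]. *)
Lemma integral_C1cT W u p : 0 < p -> measurable W -> C1c W u ->
  (\int[mu]_(x in W) (`|u x| `^ p)%:E = \int[mu]_x (`|u x| `^ p)%:E)%E.
Proof.
move=> p0 mW cu; rewrite integral_mkcond; apply: eq_integral => x _.
rewrite patchE; case: ifPn => // /negP; rewrite inE => /(C1c_outside cu)[-> _].
by rewrite normr0 powR0// gt_eqF.
Qed.

Lemma enorm0 : enorm (0 : 'rV[R]_d) = 0.
Proof.
by rewrite /enorm big1 ?sqrtr0// => i _; rewrite mxE expr0n.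
Qed.

Lemma integral_grad_C1cT W u p : 0 < p -> measurable W -> C1c W u ->
  (\int[mu]_(x in W) (enorm (grad u x) `^ p)%:E =
   \int[mu]_x (enorm (grad u x) `^ p)%:E)%E.
Proof.
move=> p0 mW cu; rewrite integral_mkcond; apply: eq_integral => x _.
rewrite patchE; case: ifPn => // /negP; rewrite inE => /(C1c_outside cu)[_ ->].
by rewrite enorm0 powR0// gt_eqF.
Qed.

Lemma measurable_powR_norm u p : continuous u ->
  measurable_fun setT (fun x => `|u x| `^ p).
Proof.
move=> cu; have m1 := measurableT_comp (@normr_measurable R setT) (continuous_measurable_rV cu).
exact: (measurableT_comp (measurable_powR p) m1).
Qed.

Lemma measurable_powR_grad u p : C1 u ->
  measurable_fun setT (fun x => enorm (grad u x) `^ p).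
Proof.
move=> cu; have m1 := continuous_measurable_rV (continuous_enorm_grad cu).
exact: (measurableT_comp (measurable_powR p) m1).
Qed.

Lemma abs_coord_le_norm (x : 'rV[R]_d) i : `|x ord0 i| <= `|x|.
Proof.
rewrite [leRHS]/Num.norm /= mx_normrE; apply/bigmax_geP; right => /=.
by exists (ord0, i).
Qed.

Lemma bounded_set_coord (S : set 'rV[R]_d) : bounded_set S ->
  exists M : R, forall x, S x -> forall i, `|x ord0 i| <= M.
Proof.
move=> [M [Mr hM]]; exists (M + 1) => x Sx i.
apply: le_trans (abs_coord_le_norm x i) _.
by apply: (hM (M + 1)); rewrite ?ltrDl.
Qed.

Lemma compact_measure_lty (S : set 'rV[R]_d) : compact S ->
  measurable S /\ (mu S < +oo)%E.
Proof.
move=> cS; have mS : measurable S.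
  rewrite -[S]setCK; apply: measurableC; apply: open_rV_measurable.
  by apply: closed_openC; apply: compact_closed => //; exact: norm_hausdorff.
split=> //; apply: bounded_measure_lty => //; exact/bounded_set_coord/compact_bounded.
Qed.

Lemma integral_compact_support_lty (f : 'rV[R]_d -> R) (S : set 'rV[R]_d) p :
  0 < p -> continuous f -> compact S -> (forall x, 0 <= f x) ->
  (forall x, ~ S x -> f x = 0) -> (\int[mu]_x (f x `^ p)%:E < +oo)%E.
Proof.
move=> p0 cf cS f0 fS; have [mS Soo] := compact_measure_lty cS.
have : compact (f @` S).
  by apply: continuous_compact => //; exact: continuous_subspaceT.
move=> /compact_bounded[M [Mr hM]].
apply: (@integral_bounded_lty _ _ R mu _ S ((`|M| + 1) `^ p)) => //.
- exact: (measurableT_comp (measurable_powR p) (continuous_measurable_rV cf)).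
- move=> x; rewrite powR_ge0/= ge0_ler_powR ?nnegrE ?(ltW p0) ?addr_ge0//.
  have [Sx|/fS ->] := pselect (S x); last by rewrite addr_ge0.
  have h : M < `|M| + 1 by rewrite (le_lt_trans (ler_norm M))// ltrDl.
  have := hM _ h (f x) (imageP f Sx).
  by rewrite /= (ger0_norm (f0 x)).
- by move=> x /fS ->; rewrite powR0// gt_eqF.
Qed.

Lemma integral_C1c_lty W u p : 0 < p -> C1c W u ->
  (\int[mu]_x (`|u x| `^ p)%:E < +oo)%E.
Proof.
move=> p0 [cu cS _].
apply: (integral_compact_support_lty (f := fun x => `|u x|) p0 _ cS) => // [x|x ns].
  apply: continuous_comp; [exact: C1_continuous|exact: norm_continuous].
apply/eqP; rewrite normr_eq0; apply/negP => /negP ux; apply: ns; exact: subset_closure.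
Qed.

Lemma integral_grad_C1c_lty W u p : 0 < p -> C1c W u ->
  (\int[mu]_x (enorm (grad u x) `^ p)%:E < +oo)%E.
Proof.
move=> p0 [cu cS _].
apply: (integral_compact_support_lty (f := fun x => enorm (grad u x)) p0 _ cS).
- exact: continuous_enorm_grad.
- by move=> x; exact: enorm_ge0.
- by move=> x /grad_eq0 ->; rewrite enorm0.
Qed.

Lemma integral_C1c_gt0 u p : 0 < p -> continuous u -> (exists x, u x != 0) ->
  (0 < \int[mu]_x (`|u x| `^ p)%:E)%E.
Proof.
move=> p0 cu [x ux].
have c0 : 0 < `|u x| / 2 by rewrite divr_gt0// normr_gt0.
have cn : continuous (fun x => `|u x|).
  by move=> y; apply: continuous_comp; [exact: cu|exact: norm_continuous].
have oU : open [set y | `|u x| / 2 < `|u y|].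
  by apply: (open_comp (f := fun x => `|u x|)) (@open_gt R _) => y _; exact: cn.
apply: (@integral_gt0_of_lower_bound _ _ R mu _ [set y | `|u x| / 2 < `|u y|] ((`|u x| / 2) `^ p)).
- by rewrite powR_gt0.
- exact: open_rV_measurable.
- apply: open_measure_gt0 => //; exists x => /=.
  by rewrite ltr_pdivrMr// ltr_pMr ?normr_gt0// ltrDl.
- by apply/measurable_EFinP; exact: measurable_powR_norm.
- by move=> y; rewrite lee_fin powR_ge0.
- move=> y /= /ltW h; rewrite lee_fin ge0_ler_powR ?nnegrE ?(ltW p0) ?(ltW c0)//.
Qed.

(** Compact support makes both integrals finite and continuity makes the second one positive, so the
    quotient of extended reals is an honest quotient of reals. *)
Lemma rayleighE W u p : 0 < p -> measurable W -> C1c W u ->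
  (exists x, u x != 0) ->
  exists2 ab : R * R, (0 <= ab.1) && (0 < ab.2) &
  [/\ (\int[mu]_x (enorm (grad u x) `^ p)%:E = ab.1%:E)%E,
     (\int[mu]_x (`|u x| `^ p)%:E = ab.2%:E)%E &
     rayleigh p W u = (ab.1 / ab.2)%:E].
Proof.
move=> p0 mW cu u0; rewrite /rayleigh integral_grad_C1cT// integral_C1cT//.
have := integral_C1c_lty p0 cu; have := integral_grad_C1c_lty p0 cu.
have cc : continuous u by case: cu => + _ _; exact: C1_continuous.
have := integral_C1c_gt0 p0 cc u0.
have : (0 <= \int[mu]_x (enorm (grad u x) `^ p)%:E)%E.
  by apply: integral_ge0 => x _; rewrite lee_fin powR_ge0.
case: (integral _ _ (fun x => (enorm _ `^ p)%:E)) => [a| |]// a0.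
case: (integral _ _ _) => [b| |]// b0 _ _.
exists (a, b); first by rewrite -lee_fin -lte_fin a0 b0.
split=> //=; rewrite inver gt_eqF//.
Qed.

End C1c_facts.

(** * Lower bounds for lambda *)
Section lambda_lower.
Context {R : realType} {d : nat}.
Local Notation mu := (lebesgue_rV R d).
Implicit Types (u : 'rV[R]_d -> R) (W : set 'rV[R]_d).

Lemma lambda_ge W p (K : R) : 0 < p -> 0 < K -> measurable W ->
  (forall u, C1c W u -> (\int[mu]_x (`|u x| `^ p)%:E <=
     K%:E * \int[mu]_x (enorm (grad u x) `^ p)%:E)%E) ->
  ((K^-1)%:E <= lambda p W)%E.
Proof.
move=> p0 K0 mW h; apply: le_ereal_inf_tmp => _ [u [cu u0] <-].
have [[a b] /= /andP[a0 b0] [ga ub ->]] := rayleighE p0 mW cu u0.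
have := h _ cu; rewrite ga ub -EFinM !lee_fin => baK.
by rewrite ler_pdivlMr// mulrC ler_pdivrMr// mulrC.
Qed.

(** This is the weight condition of [star_poincare] with L = eta^(-p beta). Put t = s^(m+1): the
    hypothesis on [beta] says m p >= (m + 1)(d - p beta), so s^(m p) <= t^(-p beta) t^d, and t >=
    eta bounds the first factor. For [beta = 0] that factor is 1 and [t] needs no lower bound. *)
Lemma ray_weight_bound (m : nat) (p beta eta s : R) : 1 < p -> 0 <= beta ->
  0 < eta -> 0 < s <= 1 -> d%:R / p - 1 + m.+1%:R^-1 <= beta ->
  beta = 0 \/ eta <= s ^+ m.+1 ->
  (s ^+ m) `^ p <= eta `^ (- (p * beta)) * (s ^+ m.+1) ^+ d.
Proof.
move=> p1 b0 eta0 /andP[s0 s1] dp H.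
have p0 : 0 < p by rewrite (lt_trans _ p1).
have t0 : 0 < s ^+ m.+1 by rewrite exprn_gt0.
apply: (@le_trans _ _ ((s ^+ m.+1) `^ (- (p * beta)) * (s ^+ m.+1) ^+ d)); last first.
  rewrite ler_pM2r ?exprn_gt0//.
  case: H => [->|et]; first by rewrite mulr0 oppr0 !powRr0.
  rewrite !powRN lef_pV2 ?posrE ?powR_gt0//.
  by rewrite ge0_ler_powR ?nnegrE ?mulr_ge0 ?(ltW p0) ?(ltW eta0) ?(ltW t0).
rewrite -!powR_mulrn ?powR_ge0 ?(ltW s0)// -!powRrM.
rewrite -powRD; last by rewrite (gt_eqF s0) implybT.
apply: ger_powR; first by rewrite s0.
have m0 : 0 < m.+1%:R :> R by rewrite ltr0n.
have e1 : d%:R <= p * (beta + 1 - m.+1%:R^-1).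
  rewrite mulrC -ler_pdivrMr//; move: dp.
  by set z := m.+1%:R^-1; set w := d%:R / p; lra.
have e2 : m.+1%:R * (d%:R - p * beta) <= m.+1%:R * (p * (1 - m.+1%:R^-1)).
  by rewrite ler_pM2l//; move: e1; set z := m.+1%:R^-1; lra.
have e3 : m.+1%:R * (p * (1 - m.+1%:R^-1)) = p * m%:R.
  have -> : m%:R = m.+1%:R - 1 :> R by rewrite -natr1 addrK.
  by field; rewrite gt_eqF.
rewrite e3 in e2; lra.
Qed.

(* eta is the relative size of a hole around y; with beta = 0 the single
   point y outside W is enough. *)
Lemma lambda_root_ge W (p l beta eta : R) (m : nat) :
  (0 < d)%N -> 1 < p -> measurable W -> 0 < l -> (0 < m)%N -> 0 <= beta -> 0 < eta ->
  d%:R / p - 1 + m.+1%:R^-1 <= beta ->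
  (forall k : 'rV[int]_d, exists y, [/\ cube l k y, ~ W y &
     beta = 0 \/ forall x : 'rV[R]_d, (forall i, `|x ord0 i - y ord0 i| < eta * l) -> ~ W x]) ->
  ((eta `^ beta / (m.+1%:R * (d%:R * l)))%:E <= (lambda p W) `^ (p^-1))%E.
Proof.
move=> d0 p1 mW l0 m0 b0 eta0 dp H.
have p0 : 0 < p by rewrite (lt_trans _ p1).
set C := m.+1%:R * (d%:R * l).
have C0 : 0 < C by rewrite !mulr_gt0 ?ltr0n.
set L := eta `^ (- (p * beta)).
have L0 : 0 < L by rewrite powR_gt0.
have : (((C `^ p * L)^-1)%:E <= lambda p W)%E.
  apply: lambda_ge => //; first by rewrite mulr_gt0 ?powR_gt0.
  move=> u cu; have [C1u _ _] := cu.
  apply: (le_integral_cubes (f := fun x => (`|u x| `^ p)%:E)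
    (g := fun x => (enorm (grad u x) `^ p)%:E) l0).
  - by apply/measurable_EFinP; apply: measurable_powR_norm; exact: C1_continuous.
  - by apply/measurable_EFinP; exact: measurable_powR_grad.
  - by move=> x; rewrite lee_fin powR_ge0.
  - by move=> x; rewrite lee_fin powR_ge0.
  move=> k; have [y [Qy nWy hole]] := H k.
  have zy z i : cube l k z -> `|z ord0 i - y ord0 i| <= l.
    move=> /(_ i); have := Qy i; rewrite !in_itv/= => /andP[y1 y2] /andP[z1 z2].
    rewrite ler_norml; apply/andP; split; lra.
  apply: (star_poincare C1u p1 (ltW l0) (ltW L0) m0 (measurable_cube l k) (y := y)) => //.
  - move=> z s Qz /andP[s0 s1] i; have := Qz i; have := Qy i.
    rewrite !in_itv/= !mxE => /andP[y1 y2] /andP[z1 z2].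
    have t0 : 0 < s ^+ m.+1 by rewrite exprn_gt0.
    have t1 : s ^+ m.+1 <= 1 by rewrite exprn_ile1// ltW.
    move: (s ^+ m.+1) t0 t1 => t t0 t1; apply/andP; split; nra.
  - by have [] := C1c_outside cu nWy.
  - move=> z s Qz s01 Gn0; apply: (ray_weight_bound p1 b0 eta0 s01 dp).
    case: hole => [->|hole]; first by left.
    (* If the contraction ratio were below [eta], the point of the ray would lie in the hole around
       [y], since the cube has side [l]; there the gradient of [u] vanishes. *)
    right; rewrite leNgt; apply/negP => st.
    have /(C1c_outside cu)[_ g0] : ~ W (ray m.+1 y z s); last first.
      by move: Gn0; rewrite g0 enorm0 eqxx.
    apply: hole => i; rewrite !mxE [y _ _ + _]addrC addrK normrM.
    case/andP: s01 => s0 s1.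
    have t0 : 0 < s ^+ m.+1 by rewrite exprn_gt0.
    rewrite (gtr0_norm t0) (@le_lt_trans _ _ (s ^+ m.+1 * l))//.
      by rewrite ler_pM2l// zy.
    by rewrite ltr_pM2r.
(* With this choice of [L] the constant is a p-th power, ready for the p-th root. *)
have -> : (C `^ p * L)^-1 = (eta `^ beta / C) `^ p.
  have Ci : C^-1 `^ p = (C `^ p)^-1.
    by rewrite -[in LHS]powR_inv1 ?(ltW C0)// -powRrM mulN1r powRN.
  rewrite powRM ?powR_ge0 ?invr_ge0 ?(ltW C0)// Ci -powRrM.
  by rewrite /L powRN invfM invrK [LHS]mulrC [beta * p]mulrC.
have e0 : 0 <= eta `^ beta / C by rewrite divr_ge0 ?powR_ge0// ltW.
move=> h.
have := gt0_ler_poweR (r := p^-1) _ _ _ h; rewrite invr_ge0 (ltW p0) => /(_ isT).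
rewrite poweR_EFin -powRrM divff ?gt_eqF// powRr1//; apply.
  by rewrite in_itv/= leey lee_fin powR_ge0.
rewrite in_itv/= leey andbT (le_trans _ h)// lee_fin powR_ge0//.
Qed.

End lambda_lower.

(** * Scaling *)
Section scaling.
Context {R : realType} {d : nat}.
Local Notation mu := (lebesgue_rV R d).
Implicit Types (u : 'rV[R]_d -> R) (W : set 'rV[R]_d).

Definition affine (a : 'rV[R]_d) (t : R) (x : 'rV[R]_d) : 'rV[R]_d := a + t *: x.

Lemma is_diff_affine a t x : is_diff x (affine a t) ( *:%R t).
Proof.
have h := is_diffD (is_diff_cst a x) (is_diffZ t (is_diff_id x)).
by apply: (is_diff_eq h); apply/funext => y /=; rewrite /cst add0r.
Qed.

Lemma continuous_affine a t : continuous (affine a t).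
Proof.
move=> x; have h := is_diff_affine a t x.
by apply: differentiable_continuous; case: h.
Qed.

Lemma diff_comp_affine u a t x : C1 u ->
  differentiable (u \o affine a t) x /\
  forall i, partial i (u \o affine a t) x = t * partial i u (affine a t x).
Proof.
move=> [du _].
have dc := is_diff_comp (is_diff_affine a t x) (differentiableP (du (affine a t x))).
have dF : differentiable (u \o affine a t) x by case: dc.
split=> // i; rewrite /partial deriveE//; case: dc => _ ->.
by rewrite /= linearZ deriveE.
Qed.

Lemma C1_comp_affine u a t : C1 u -> C1 (u \o affine a t).
Proof.
move=> C1u; split=> [x|i x]; first by have [] := diff_comp_affine a t x C1u.
have -> : partial i (u \o affine a t) = (fun x => t * partial i u (affine a t x)).
  by apply/funext => y; have [_ ->] := diff_comp_affine a t y C1u.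
apply: (@continuous_comp _ _ _ (partial i u \o affine a t) ( *%R t)).
  apply: continuous_comp; first exact: continuous_affine.
  by case: C1u => _; exact.
exact: mulrl_continuous.
Qed.

Lemma grad_comp_affine u a t x : C1 u ->
  grad (u \o affine a t) x = t *: grad u (affine a t x).
Proof.
move=> C1u; apply/rowP => i; rewrite !mxE.
by have [_ ->] := diff_comp_affine a t x C1u.
Qed.

Lemma enormZ t (x : 'rV[R]_d) : enorm (t *: x) = `|t| * enorm x.
Proof.
rewrite /enorm -(sqrtr_sqr t) -sqrtrM ?sqr_ge0// mulr_sumr; congr Num.sqrt.
by apply: eq_bigr => i _; rewrite mxE exprMn.
Qed.

Lemma C1c_comp_affine u W W' a t : t != 0 -> C1c W u ->
  (forall x, W (affine a t x) -> W' x) -> C1c W' (u \o affine a t).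
Proof.
move=> t0 [cu cS SW] WW'.
pose A := [set x | u x != 0].
have clo : closure [set x | (u \o affine a t) x != 0] `<=`
    affine a t @^-1` closure A.
  have cl : closed (affine a t @^-1` closure A).
    apply: preimage_closed; last exact: closed_closure.
    by move=> x _; exact: continuous_affine.
  rewrite closureE => x; apply; split=> // y /= uy.
  exact: subset_closure.
split; first exact: C1_comp_affine.
  apply: (subclosed_compact _ _ clo); first exact: closed_closure.
  have -> : affine a t @^-1` closure A = affine (- (t^-1 *: a)) t^-1 @` closure A.
    apply/seteqP; split=> [x /= h|_ /= [y hy <-]].
      exists (affine a t x) => //; rewrite /affine scalerDr scalerA mulVf// scale1r.
      by rewrite addrA addNr add0r.
    by rewrite /affine scalerDr scalerA scalerN scalerA divff// !scale1r addrA subrr add0r.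
  apply: continuous_compact => //; apply: continuous_subspaceT.
  exact: continuous_affine.
by move=> x /clo /SW; exact: WW'.
Qed.

(** Both integrals scale by t^(-d), which cancels, and the gradient adds t^p. Asking only that the
    preimage of [W] lie in [W'] combines scaling with extension by zero. *)
Lemma rayleigh_comp_affine u W W' a t p : 0 < p -> 0 < t ->
  measurable W -> measurable W' -> C1c W u -> (exists x, u x != 0) ->
  (forall x, W (affine a t x) -> W' x) ->
  rayleigh p W' (u \o affine a t) = ((t `^ p)%:E * rayleigh p W u)%E.
Proof.
move=> p0 t0 mW mW' cu u0 WW'; have [C1u _ _] := cu.
have tn0 : t != 0 by rewrite gt_eqF.
have cv := C1c_comp_affine tn0 cu WW'.
have v0 : exists x, (u \o affine a t) x != 0.
  have [y uy] := u0; exists (affine (- (t^-1 *: a)) t^-1 y).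
  by rewrite /= /affine scalerDr scalerA scalerN scalerA divff// !scale1r addrA subrr add0r.
have [[j b] /= /andP[j0 b0] [gj ub ->]] := rayleighE p0 mW cu u0.
have [[j' b'] /= /andP[j'0 b'0] [gj' ub' ->]] := rayleighE p0 mW' cv v0.
have hb : b' = t ^- d * b.
  apply: EFin_inj; rewrite -ub' EFinM -ub.
  apply: (integral_affine a t0) => [|x]; last by rewrite lee_fin powR_ge0.
  by apply/measurable_EFinP; apply: measurable_powR_norm; exact: C1_continuous.
have hj : j' = t `^ p * (t ^- d * j).
  apply: EFin_inj; rewrite -gj' !EFinM -gj.
  have mg : measurable_fun setT (fun x => (enorm (grad u x) `^ p)%:E).
    by apply/measurable_EFinP; exact: measurable_powR_grad.
  have g0 x : (0 <= (enorm (grad u x) `^ p)%:E)%E by rewrite lee_fin powR_ge0.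
  have H1 := integral_affine a t0 mg g0.
  have mga : measurable_fun setT (fun x : 'rV[R]_d => (enorm (grad u (a + t *: x)) `^ p)%:E).
    have h := measurable_powR_grad p (C1_comp_affine a t C1u).
    apply/measurable_EFinP.
    have -> : (fun x : 'rV[R]_d => enorm (grad u (a + t *: x)) `^ p) =
       (fun x => (t `^ p)^-1 * enorm (grad (u \o affine a t) x) `^ p).
      apply/funext => x; rewrite grad_comp_affine// enormZ powRM ?enorm_ge0//.
      by rewrite gtr0_norm// mulrA mulVf ?mul1r// gt_eqF// powR_gt0.
    exact: measurable_funM.
  have tp0 : (0 <= (t `^ p)%:E)%E by rewrite lee_fin powR_ge0.
  have H2 := ge0_integralZl mu measurableT mga (fun x _ => g0 _) tp0.
  rewrite -H1 -H2; apply: eq_integral => x _; rewrite grad_comp_affine// enormZ -EFinM.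
  by rewrite powRM ?enorm_ge0// gtr0_norm.
rewrite -EFinM hb hj; congr EFin; field.
by rewrite gt_eqF//= expf_neq0.
Qed.

Lemma open_eball (c : 'rV[R]_d) r : open (eball c r).
Proof.
have cf : continuous (fun x : 'rV[R]_d => enorm (x - c)).
  have -> : (fun x => enorm (x - c)) = @enorm R d \o affine (- c) 1.
    by apply/funext => x /=; rewrite /affine scale1r addrC.
  move=> x; apply: continuous_comp; last exact: continuous_enorm.
  exact: continuous_affine.
by have := open_comp (fun x _ => cf x) (@open_lt R r).
Qed.

Lemma lambda_root_le_eball W c r p : 1 < p -> measurable W -> 0 < r ->
  eball c r `<=` W ->
  ((lambda p W) `^ p^-1 <= (r^-1)%:E * (lambda p (eball (0%R : 'rV[R]_d) 1)) `^ p^-1)%E.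
Proof.
move=> p1 mW r0 cW.
have p0 : 0 < p by rewrite (lt_trans _ p1).
have ri0 : 0 < r^-1 by rewrite invr_gt0.
have lge0 V : (0 <= lambda p V)%E.
  apply: le_ereal_inf_tmp => _ [u _ <-]; rewrite /rayleigh mule_ge0//.
    by apply: integral_ge0 => x _; rewrite lee_fin powR_ge0.
  by rewrite inve_ge0; apply: integral_ge0 => x _; rewrite lee_fin powR_ge0.
have mB : measurable (eball (0 : 'rV[R]_d) 1).
  by apply: open_rV_measurable; exact: open_eball.
have h : (lambda p W <= (r^-1 `^ p)%:E * lambda p (eball (0%R : 'rV[R]_d) 1))%E.
  rewrite /lambda -ereal_inf_pZl ?powR_gt0//.
  apply: le_ereal_inf_tmp => _ [_ [u [cu u0] <-] <-].
  (* The affine map x |-> (x - c) / r carries the ball in [W] onto the unit ball. *)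
  have hW x : eball 0 1 (affine (- (r^-1 *: c)) r^-1 x) -> W x.
    rewrite /eball /affine /= subr0 addrC -scalerBr enormZ gtr0_norm// => hx.
    by apply: cW; rewrite /eball /= -[r]mulr1 -ltr_pdivrMl.
  rewrite -(rayleigh_comp_affine p0 ri0 mB mW cu u0 hW).
  apply: ereal_inf_lbound; exists (u \o affine (- (r^-1 *: c)) r^-1) => //.
  split; first by apply: C1c_comp_affine cu hW; rewrite gt_eqF.
  have [y uy] := u0; exists (affine c r y).
  rewrite /= /affine scalerDr scalerA (mulVf (lt0r_neq0 r0)) scale1r.
  by rewrite addrA addNr add0r.
have := gt0_ler_poweR (r := p^-1) _ _ _ h; rewrite invr_ge0 (ltW p0) => /(_ isT).
rewrite poweRM ?lee_fin ?powR_ge0 ?lge0// poweR_EFin -powRrM divff ?gt_eqF// powRr1 ?(ltW ri0)//.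
apply.
  by rewrite in_itv/= leey lge0.
by rewrite in_itv/= leey mule_ge0// lee_fin powR_ge0.
Qed.

End scaling.

(** * A C^1 cut-off profile and the algebra of C^1 functions *)
Section step.
Context {R : realType}.

(** A quadratic remainder can be checked by polynomial arithmetic case by case, which also settles
    the junction points of piecewise formulas such as [pos2]. *)
Lemma is_derive_quadratic (f : R -> R) (t L C : R) : 0 < C ->
  (forall h, `|h| <= 1 -> `|f (t + h) - f t - L * h| <= C * h ^+ 2) ->
  is_derive t (1 : R) f L.
Proof.
move=> C0 H.
suff cvgL : h^-1 *: (f (h *: 1 + t) - f t) @[h --> (0 : R)^'] --> L.
  by apply: DeriveDef; [apply/cvg_ex; exists L|apply/cvg_lim].
apply/cvgrPdist_le => e e0; near=> h.
have hn0 : h != 0 by near: h; exact: nbhs_dnbhs_neq.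
have h1 : `|h| <= 1.
  by apply/ltW; near: h; exact: dnbhs0_lt.
have h2 : `|h| <= e / C.
  by apply/ltW; near: h; apply: dnbhs0_lt; rewrite divr_gt0.
have -> : L - h^-1 *: (f (h *: 1 + t) - f t) = - (h^-1 * (f (t + h) - f t - L * h)).
  rewrite [h *: 1]mulr1 [h + t]addrC mulrBr [h^-1 * (L * h)]mulrCA mulVf// mulr1.
  by rewrite opprB.
rewrite normrN normrM normfV.
have h0 : 0 < `|h| by rewrite normr_gt0.
rewrite -(ler_pM2l h0) mulrA divff ?gt_eqF// mul1r.
apply: le_trans (H _ h1) _.
by rewrite -[h ^+ 2]real_normK ?num_real// expr2 mulrCA ler_pM2l// -ler_pdivlMl// mulrC.
Unshelve. all: by end_near. Qed.

Definition pos2 (t : R) : R := Num.max t 0 ^+ 2.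

Lemma is_derive_pos2 (t : R) : is_derive t (1 : R) pos2 (2 * Num.max t 0).
Proof.
apply: (@is_derive_quadratic _ _ _ 1) => // h _; rewrite /pos2.
rewrite ler_norml; case: (leP t 0) => t0; case: (leP (t + h) 0) => th0;
  apply/andP; split; nra.
Qed.

(** On [0, 1] this is (1 - t^2)^2, continued by 1 on the left and 0 on the right; composing the C^1
    function [pos2] makes the gluing C^1. *)
Definition step (t : R) : R := pos2 (1 - pos2 t).
Definition dstep (t : R) : R :=
  2 * Num.max (1 - pos2 t) 0 * - (2 * Num.max t 0).

Lemma is_derive_step (t : R) : is_derive t (1 : R) step (dstep t).
Proof.
have h1 : is_derive t (1 : R) (fun t => 1 - pos2 t) (0 - 2 * Num.max t 0).
  by apply: is_deriveB; exact: is_derive_pos2.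
have := @is_derive1_comp _ pos2 (fun t => 1 - pos2 t) _ _ _ (is_derive_pos2 (1 - pos2 t)) h1.
by rewrite sub0r /dstep.
Qed.

Lemma continuous_dstep : continuous dstep.
Proof.
have cmax : continuous (fun t : R => Num.max t 0).
  by move=> t; apply: continuous_max; [exact: cvg_id|exact: cvg_cst].
have cp : continuous pos2.
  move=> t; apply: (@continuous_comp _ _ _ (fun t : R => Num.max t 0) (fun t => t ^+ 2)).
    exact: cmax.
  exact: exprn_continuous.
move=> t; apply: cvgM.
  apply: cvgM; first exact: cvg_cst.
  apply: (@continuous_comp _ _ _ (fun t => 1 - pos2 t) (fun t => Num.max t 0)); last exact: cmax.
  by apply: cvgB; [exact: cvg_cst|exact: cp].
by apply: cvgN; apply: cvgM; [exact: cvg_cst|exact: cmax].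
Qed.

Lemma step_itv t : 0 <= step t <= 1.
Proof.
rewrite /step [pos2 (1 - _)]/pos2 sqr_ge0/=.
have : 0 <= pos2 t by exact: sqr_ge0.
move: (pos2 t) => a a0; case: (leP (1 - a) 0) => h; first by rewrite expr0n ler01.
by rewrite expr_le1 ?(ltW h)//; lra.
Qed.

Lemma step_le0 t : t <= 0 -> step t = 1.
Proof. by move=> t0; rewrite /step /pos2 (max_r t0) expr0n/= subr0 max_l// expr1n. Qed.

Lemma step_ge1 t : 1 <= t -> step t = 0.
Proof.
move=> t1; have t0 : 0 <= t by rewrite (le_trans _ t1).
rewrite /step /pos2 (max_l t0) max_r ?expr0n//.
by rewrite subr_le0 exprn_ege1.
Qed.

Lemma dstep_le0 t : t <= 0 -> dstep t = 0.
Proof. by move=> t0; rewrite /dstep (max_r t0) mulr0 oppr0 mulr0. Qed.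

Lemma dstep_ge1 t : 1 <= t -> dstep t = 0.
Proof.
move=> t1; have t0 : 0 <= t by rewrite (le_trans _ t1).
rewrite /dstep /pos2 (max_l t0) (max_r (x := 1 - _)) ?mulr0 ?mul0r//.
by rewrite subr_le0 exprn_ege1.
Qed.

Lemma norm_dstep_le t : `|dstep t| <= 4.
Proof.
have [t1|t1] := leP 1 t; first by rewrite dstep_ge1// normr0.
have [t0|t0] := leP t 0; first by rewrite dstep_le0// normr0.
rewrite /dstep /pos2 (max_l (ltW t0)) max_l; last by rewrite subr_ge0 expr_le1// ltW.
rewrite ler_norml; apply/andP; split; nra.
Qed.

End step.

(** * Sums, products and compositions of C^1 functions *)

Section C1_algebra.
Context {R : realType} {d : nat}.
Implicit Types (u v : 'rV[R]_d -> R).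

Lemma C1_cst (a : R) : C1 (fun _ : 'rV[R]_d => a).
Proof.
split=> [x|i x]; first exact: differentiable_cst.
have -> : partial i (fun _ : 'rV[R]_d => a) = cst 0.
  by apply/funext => y; rewrite /partial derive_cst.
exact: cst_continuous.
Qed.

Lemma partial_coord i j (x : 'rV[R]_d) :
  partial j (fun x : 'rV[R]_d => x ord0 i) x = (i == j)%:R.
Proof.
have di : derivable (@id 'rV[R]_d) x (delta_mx ord0 j) by exact: derivable_id.
have h := derive_mx di.
have := congr1 (fun M : 'rV[R]_d => M ord0 i) h.
by rewrite derive_id !mxE /partial => <-.
Qed.

Lemma C1_coord i : C1 (fun x : 'rV[R]_d => x ord0 i).
Proof.
split=> [x|j x]; first exact: differentiable_coord.
have -> : partial j (fun x : 'rV[R]_d => x ord0 i) = cst (i == j)%:R.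
  by apply/funext => y; rewrite partial_coord.
exact: cst_continuous.
Qed.

Lemma partial_comp (f f' : R -> R) u x : C1 u ->
  (forall t, is_derive t (1 : R) f (f' t)) ->
  differentiable (f \o u) x /\
  forall i, partial i (f \o u) x = f' (u x) * partial i u x.
Proof.
move=> [du _] df.
have dfu : differentiable f (u x) by apply/derivable1_diffP; case: (df (u x)).
have dc : differentiable (f \o u) x by exact: differentiable_comp.
split=> // i; rewrite /partial deriveE// diff_comp//= deriv1E; last first.
  by case: (df (u x)).
by rewrite derive1E; case: (df (u x)) => _ ->; rewrite deriveE// mulrC.
Qed.

Lemma C1_comp (f f' : R -> R) u : C1 u ->
  (forall t, is_derive t (1 : R) f (f' t)) -> continuous f' -> C1 (f \o u).
Proof.
move=> C1u df cf'; split=> [x|i].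
  exact: (partial_comp x C1u df).1.
have -> : partial i (f \o u) = (fun x => f' (u x) * partial i u x).
  by apply/funext => x; have [_ ->] := partial_comp x C1u df.
move=> x; apply: (@continuousM _ _ (f' \o u) (partial i u)).
  by apply: continuous_comp; [exact: C1_continuous|exact: cf'].
by case: C1u => _; exact.
Qed.

Lemma partialM u v i x : C1 u -> C1 v ->
  partial i (fun x => u x * v x) x = u x * partial i v x + v x * partial i u x.
Proof.
move=> [du _] [dv _]; rewrite /partial.
by rewrite (deriveM (f := u) (g := v))//; exact: diff_derivable.
Qed.

Lemma C1M u v : C1 u -> C1 v -> C1 (fun x => u x * v x).
Proof.
move=> cu cv; have [du pu] := cu; have [dv pv] := cv; split=> [x|i].
  exact: (differentiableM (f := u) (g := v)).
have -> : partial i (fun x => u x * v x) =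
    (fun x => u x * partial i v x + v x * partial i u x).
  by apply/funext => x; rewrite partialM.
move=> x; apply: (@continuousD _ _ _ (u \* partial i v) (v \* partial i u)).
  by apply: (@continuousM _ _ u); [exact: C1_continuous|exact: pv].
by apply: (@continuousM _ _ v); [exact: C1_continuous|exact: pu].
Qed.

Lemma partial_sum n (u : 'I_n -> 'rV[R]_d -> R) i x : (forall k, C1 (u k)) ->
  partial i (fun x => \sum_(k < n) u k x) x = \sum_(k < n) partial i (u k) x.
Proof.
move=> cu; have -> : (fun x => \sum_(k < n) u k x) = \sum_(k < n) u k.
  by apply/funext => y; rewrite fct_sumE.
by rewrite /partial derive_sum// => k; apply: diff_derivable; case: (cu k).
Qed.

Lemma C1_sum n (u : 'I_n -> 'rV[R]_d -> R) : (forall k, C1 (u k)) ->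
  C1 (fun x => \sum_(k < n) u k x).
Proof.
move=> cu; split=> [x|i].
  have -> : (fun x => \sum_(k < n) u k x) = \sum_(k < n) u k.
    by apply/funext => y; rewrite fct_sumE.
  by apply: differentiable_sum => k; case: (cu k).
have -> : partial i (fun x => \sum_(k < n) u k x) =
   (fun x => \sum_(k < n) partial i (u k) x).
  by apply/funext => x; rewrite partial_sum.
by apply: continuous_sum_ord => k; case: (cu k).
Qed.

End C1_algebra.

(** * Radial bump functions *)
Section bump.
Context {R : realType} {d : nat}.
Local Notation mu := (lebesgue_rV R d).
Implicit Types (c x : 'rV[R]_d) (r : R).

(** Squaring removes the singularity of the Euclidean norm at the center. *)
Definition sqdist c x : R := \sum_(i < d) (x ord0 i - c ord0 i) ^+ 2.

Lemma sqdistE c x : sqdist c x = enorm (x - c) ^+ 2.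
Proof.
rewrite /enorm sqr_sqrtr ?sumr_ge0// => [|i _]; last exact: sqr_ge0.
by apply: eq_bigr => i _; rewrite !mxE.
Qed.

Let is_derive_sqr (a t : R) :
  is_derive t (1 : R) (fun t => (t - a) ^+ 2) (2 * (t - a)).
Proof.
apply: (@is_derive_quadratic _ _ _ _ 1) => // h _.
have -> : (t + h - a) ^+ 2 - (t - a) ^+ 2 - 2 * (t - a) * h = h ^+ 2 by ring.
by rewrite mul1r ger0_norm ?sqr_ge0.
Qed.

Lemma C1_sqdist c : C1 (sqdist c).
Proof.
apply: C1_sum => i.
apply: (@C1_comp R d (fun t => (t - c ord0 i) ^+ 2) (fun t => 2 * (t - c ord0 i))
   (fun x => x ord0 i)); first exact: C1_coord.
  by move=> t; exact: is_derive_sqr.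
move=> t; apply: cvgM; first exact: cvg_cst.
by apply: cvgB; [exact: cvg_id|exact: cvg_cst].
Qed.

Lemma partial_sqdist c x i : partial i (sqdist c) x = 2 * (x ord0 i - c ord0 i).
Proof.
have df (k : 'I_d) (t : R) : is_derive t (1 : R) (fun t => (t - c ord0 k) ^+ 2) (2 * (t - c ord0 k)).
  exact: is_derive_sqr.
have cf (k : 'I_d) : C1 (fun x : 'rV[R]_d => (x ord0 k - c ord0 k) ^+ 2).
  apply: (@C1_comp R d (fun t => (t - c ord0 k) ^+ 2) (fun t => 2 * (t - c ord0 k))
   (fun x => x ord0 k)) => //; first exact: C1_coord.
  move=> t; apply: cvgM; first exact: cvg_cst.
  by apply: cvgB; [exact: cvg_id|exact: cvg_cst].
rewrite /sqdist partial_sum// (bigD1 i)//= big1 => [|k ki].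
  have [_ /(_ i)] := partial_comp x (C1_coord i) (df i).
  by rewrite addr0 partial_coord eqxx mulr1.
have [_ /(_ i)] := partial_comp x (C1_coord k) (df k).
by rewrite partial_coord (negbTE ki) mulr0.
Qed.

(** Equal to 1 up to distance r and to 0 from distance sqrt(2) r on; the estimates below use the
    larger radius 2 r, which fits dyadic scales. *)
Definition ball_bump c r x : R := step (sqdist c x / r ^+ 2 - 1).

Let is_derive_outer r (t : R) :
  is_derive t (1 : R) (fun t => step (t / r ^+ 2 - 1)) (dstep (t / r ^+ 2 - 1) * r ^- 2).
Proof.
have h : is_derive t (1 : R) (fun t => t / r ^+ 2 - 1) (r ^- 2).
  apply: (@is_derive_quadratic _ _ _ _ 1) => // k _.
  have -> : (t + k) / r ^+ 2 - 1 - (t / r ^+ 2 - 1) - r ^- 2 * k = 0 by ring.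
  by rewrite normr0 mul1r sqr_ge0.
exact: (@is_derive1_comp _ step (fun t => t / r ^+ 2 - 1) _ _ _ (is_derive_step _) h).
Qed.

Lemma C1_bump c r : C1 (ball_bump c r).
Proof.
have c0 : continuous (fun t : R => t / r ^+ 2 - 1).
  move=> t; apply: cvgB; last exact: cvg_cst.
  by apply: cvgM; [exact: cvg_id|exact: cvg_cst].
have c1 : continuous (fun t : R => dstep (t / r ^+ 2 - 1)).
  move=> t; apply: (continuous_comp (c0 t)); exact: continuous_dstep.
apply: (C1_comp (C1_sqdist c) (is_derive_outer r)) => t.
by apply: cvgM; [exact: c1|exact: cvg_cst].
Qed.

Lemma partial_bump c r x i : partial i (ball_bump c r) x =
  dstep (sqdist c x / r ^+ 2 - 1) * r ^- 2 * (2 * (x ord0 i - c ord0 i)).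
Proof.
have [_ /(_ i)] := partial_comp x (C1_sqdist c) (is_derive_outer r).
by rewrite partial_sqdist.
Qed.

Lemma bump_itv c r x : 0 <= ball_bump c r x <= 1.
Proof. exact: step_itv. Qed.

Lemma bump_in c r x : 0 < r -> enorm (x - c) <= r ->
  ball_bump c r x = 1 /\ forall i, partial i (ball_bump c r) x = 0.
Proof.
move=> r0 xr; have h : sqdist c x / r ^+ 2 - 1 <= 0.
  rewrite sqdistE subr_le0 ler_pdivrMr ?exprn_gt0// mul1r.
  by rewrite ler_sqr ?nnegrE ?enorm_ge0 ?(ltW r0).
split; first by rewrite /ball_bump step_le0.
by move=> i; rewrite partial_bump dstep_le0// !mul0r.
Qed.

Lemma bump_out c r x : 0 < r -> 2 * r <= enorm (x - c) ->
  ball_bump c r x = 0 /\ forall i, partial i (ball_bump c r) x = 0.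
Proof.
move=> r0 xr; have h : 1 <= sqdist c x / r ^+ 2 - 1.
  rewrite sqdistE lerBrDr ler_pdivlMr ?exprn_gt0//.
  have : (2 * r) ^+ 2 <= enorm (x - c) ^+ 2.
    by rewrite ler_sqr ?nnegrE ?enorm_ge0// mulr_ge0// ltW.
  nra.
split; first by rewrite /ball_bump step_ge1.
by move=> i; rewrite partial_bump dstep_ge1// !mul0r.
Qed.

(** The constant 16 is 4 from [dstep], 2 from differentiating the square and 2 from the radius of
    the support. *)
Lemma norm_partial_bump_le c r x i : 0 < r ->
  `|partial i (ball_bump c r) x| <= 16 / r * (enorm (x - c) < 2 * r)%R%:R.
Proof.
move=> r0; case: (ltP (enorm (x - c)) (2 * r)) => h; last first.
  by have [_ ->] := bump_out r0 h; rewrite normr0 mulr0.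
rewrite mulr1 partial_bump.
move: (dstep _) (norm_dstep_le (sqdist c x / r ^+ 2 - 1)) => D hD.
rewrite !normrM.
have h1 : `|x ord0 i - c ord0 i| <= 2 * r.
  by apply: le_trans (ltW h); have := abs_coord_le_enorm (x - c) i; rewrite !mxE.
have r2 : 0 < r ^- 2 by rewrite invr_gt0 exprn_gt0.
rewrite (gtr0_norm r2) (@ger0_norm _ 2)//.
apply: (@le_trans _ _ (4 * r ^- 2 * (2 * (2 * r)))).
  have h2 : `|D| * r ^- 2 <= 4 * r ^- 2.
    by rewrite ler_pM2r.
  have h3 : 2 * `|x ord0 i - c ord0 i| <= 2 * (2 * r) by rewrite ler_pM2l.
  by apply: ler_pM => //; rewrite mulr_ge0// ltW.
by rewrite le_eqVlt; apply/orP; left; apply/eqP; field; rewrite gt_eqF.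
Qed.

Lemma continuous_enorm_sub c : continuous (fun x : 'rV[R]_d => enorm (x - c)).
Proof.
have -> : (fun x => enorm (x - c)) = @enorm R d \o affine (- c) 1.
  by apply/funext => x /=; rewrite /affine scale1r addrC.
move=> x; apply: continuous_comp; last exact: continuous_enorm.
exact: continuous_affine.
Qed.

Lemma closed_enorm_le c r : closed [set x | enorm (x - c) <= r].
Proof.
by have := preimage_closed (fun x _ => @continuous_enorm_sub c x) (@closed_le R r).
Qed.

Lemma closed_enorm_ge c r : closed [set x | r <= enorm (x - c)].
Proof.
by have := preimage_closed (fun x _ => @continuous_enorm_sub c x) (@closed_ge R r).
Qed.

Lemma compact_enorm_le c r : compact [set x | enorm (x - c) <= r].
Proof.
apply: bounded_closed_compact; last exact: closed_enorm_le.
exists (r + `|c|); split; first exact: num_real.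
move=> M rM x /= xr; rewrite -[x](subrK c); apply: le_trans (ler_normD _ _) _.
apply: (@le_trans _ _ (r + `|c|)); last exact: ltW.
rewrite lerD2r [leLHS]/Num.norm /= mx_normrE.
apply/bigmax_leP; split=> /=; first exact: le_trans (enorm_ge0 _) xr.
move=> [i j] _ /=; rewrite ord1; exact: le_trans (abs_coord_le_enorm _ j) xr.
Qed.

Lemma C1c_mul_bump (W : set 'rV[R]_d) c r (v : 'rV[R]_d -> R) : 0 < r -> C1 v ->
  (forall x, enorm (x - c) <= 2 * r -> closure [set x | v x != 0] x -> W x) ->
  C1c W (fun x => ball_bump c r x * v x).
Proof.
move=> r0 C1v H.
have s1 : closure [set x | ball_bump c r x * v x != 0] `<=` [set x | enorm (x - c) <= 2 * r].
  rewrite closureE => x; apply; split; first exact: closed_enorm_le.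
  move=> y /=; rewrite mulf_eq0 negb_or => /andP[h _]; rewrite leNgt; apply/negP => /ltW.
  by move=> /(bump_out r0)[bh _]; rewrite bh eqxx in h.
have s2 : closure [set x | ball_bump c r x * v x != 0] `<=` closure [set x | v x != 0].
  by apply: closure_subset => y /=; rewrite mulf_eq0 negb_or => /andP[].
split; first by apply: C1M => //; exact: C1_bump.
  apply: (subclosed_compact _ _ s1); first exact: closed_closure.
  exact: compact_enorm_le.
by move=> x hx; apply: H; [exact: s1|exact: s2].
Qed.

Lemma C1c_bump (W : set 'rV[R]_d) c r : 0 < r ->
  (forall x, enorm (x - c) <= 2 * r -> W x) -> C1c W (ball_bump c r).
Proof.
move=> r0 H; have := C1c_mul_bump r0 (C1_cst (d := d) (1 : R)) (fun x hx _ => H x hx).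
by rewrite (_ : (fun x => ball_bump c r x * 1) = ball_bump c r)//; apply/funext => x; rewrite mulr1.
Qed.

Lemma enormxx c : enorm (c - c) = 0. Proof. by rewrite subrr enorm0. Qed.

(** A bump of radius [r / 3] has its support well inside the ball. Finiteness on the unit ball is
    what lets a gain in the constant give a strict inequality. *)
Lemma lambda_lty (W : set 'rV[R]_d) p c r : 0 < p -> measurable W -> 0 < r ->
  eball c r `<=` W -> (lambda p W < +oo)%E.
Proof.
move=> p0 mW r0 cW.
have r3 : 0 < r / 3 by rewrite divr_gt0.
have cb : C1c W (ball_bump c (r / 3)).
  apply: C1c_bump => // x hx; apply: cW; rewrite /eball/=; apply: le_lt_trans hx _; lra.
have b0 : exists x, ball_bump c (r / 3) x != 0.
  have cc : enorm (c - c) <= r / 3 by rewrite enormxx ltW.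
  by exists c; have [-> _] := bump_in r3 cc; rewrite oner_eq0.
have [ab _ [_ _ e]] := rayleighE p0 mW cb b0.
apply: (@le_lt_trans _ _ (rayleigh p W (ball_bump c (r / 3)))); last by rewrite e ltry.
by apply: ereal_inf_lbound; exists (ball_bump c (r / 3)).
Qed.

End bump.

(** * Exponents above the dimension *)
Section above_dimension.
Context {R : realType} {d : nat}.
Local Notation mu := (lebesgue_rV R d).
Implicit Types (W : set 'rV[R]_d) (c x : 'rV[R]_d) (r : R).

Lemma enorm_le_coord x (a : R) : (forall i, `|x ord0 i| <= a) -> enorm x <= d%:R * a.
Proof.
move=> h; apply: le_trans (enorm_le_sum x) _.
rewrite mulr_natl -[X in _ *+ X](card_ord d) -sumr_const.
by apply: ler_sum => i _; exact: h.
Qed.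

Lemma eball_coord_subset c r (a : R) : d%:R * a < r ->
  [set x : 'rV[R]_d | forall i, x ord0 i \in `[(c ord0 i - a), (c ord0 i + a)] ] `<=`
  eball c r.
Proof.
move=> ar x hx; rewrite /eball/=; apply: le_lt_trans ar.
apply: enorm_le_coord => i; have := hx i; rewrite in_itv/= !mxE => /andP[h1 h2].
rewrite ler_norml; apply/andP; split; lra.
Qed.

Lemma eball_sub_cube (l : R) (k : 'rV[int]_d) :
  eball (\row_i (l * (k ord0 i)%:~R)) (l / 2) `<=` cube l k.
Proof.
move=> x; rewrite /eball/= => hx i.
have : `|x ord0 i - l * (k ord0 i)%:~R| < l / 2.
  apply: le_lt_trans hx.
  by have := abs_coord_le_enorm (x - \row_i (l * (k ord0 i)%:~R)) i; rewrite !mxE.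
rewrite ltr_norml in_itv/= mulrBr mulrDr => /andP[h1 h2].
by apply/andP; split; lra.
Qed.

Lemma A_all_subset_eball W : A_all W -> exists c r, 0 < r /\ eball c r `<=` W.
Proof.
move=> [oW mW0 _].
have [c Wc] : W !=set0.
  by apply/set0P; apply/negP => /eqP W0; move: mW0; rewrite W0 measure0 ltxx.
have /nbhs_ballP[e /= e0 eW] : nbhs c W by exact: open_nbhs_nbhs.
exists c, e; split=> // x hx; apply: eW; split=> // i j; rewrite ord1 /ball/=.
apply: le_lt_trans hx; rewrite distrC.
by have := abs_coord_le_enorm (x - c) j; rewrite !mxE.
Qed.

(** A ball of radius [r] contains a cube of side [r / d], so (r / d)^d is at most the measure of
    [W]. If the side exceeds 1 it is at most its own d-th power, which gives a linear bound without
    d-th roots. *)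
Lemma inradius_A_all W : (0 < d)%N -> A_all W ->
  exists2 rho : R, 0 < rho & inradius W = rho%:E.
Proof.
move=> d0 AW; have [oW _ Woo] := AW; have mW := open_rV_measurable oW.
have [c0 [r0 [r00 cW0]]] := A_all_subset_eball AW.
have d0R : 0 < d%:R :> R by rewrite ltr0n.
have Wfin : mu W \is a fin_num by rewrite ge0_fin_numE.
have Wge0 : 0 <= fine (mu W) by rewrite fine_ge0.
have bound r : 0 < r -> (exists c, eball c r `<=` W) ->
    r <= d%:R * (1 + fine (mu W)).
  move=> rr0 [c cW].
  pose a := r / (2 * d%:R).
  have ar : d%:R * a < r.
    have -> : d%:R * a = r / 2 by rewrite /a; field; rewrite gt_eqF.
    lra.
  have ra : r = d%:R * (2 * a) by rewrite /a; field; rewrite gt_eqF.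
  have a0 : 0 < a by rewrite divr_gt0// mulr_gt0.
  have [a1|a1] := leP (2 * a) 1.
    by rewrite ra ler_pM2l// (le_trans a1)// lerDl.
  have := @lebesgue_rV_itv R d (fun i => c ord0 i - a) (fun i => c ord0 i + a) true false.
  have {}/[swap]/[apply] E : forall i, c ord0 i - a <= c ord0 i + a by move=> i; lra.
  have h : ((\prod_(i < d) (c ord0 i + a - (c ord0 i - a)))%:E <= mu W)%E.
    rewrite -E; apply: le_measure => //; rewrite ?inE//.
      exact: (@measurable_box R d (fun i => [set` `[(c ord0 i - a), (c ord0 i + a)] ])).
    by apply: subset_trans cW; exact: eball_coord_subset.
  rewrite ra ler_pM2l//.
  apply: (@le_trans _ _ (fine (mu W))); last by rewrite lerDr.
  rewrite -lee_fin fineK//; apply: le_trans h; rewrite lee_fin.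
  rewrite (eq_bigr (fun=> 2 * a)) => [|i _]; last by lra.
  rewrite prodr_const card_ord; case: (d) d0 => // n _.
  by rewrite exprS ler_peMr ?exprn_ege1 ?ltW// mulr_gt0.
have h1 : (inradius W <= (d%:R * (1 + fine (mu W)))%:E)%E.
  by apply: ge_ereal_sup => _ [r [rr0 hr] <-]; rewrite lee_fin; exact: bound.
have h2 : (r0%:E <= inradius W)%E.
  by apply: ereal_sup_ubound; exists r0 => //; split=> //; exists c0.
move: h1 h2; case: (inradius W) => [rho| |]//.
by rewrite !lee_fin => _ h2; exists rho => //; exact: lt_le_trans h2.
Qed.

Lemma lambda_root_ge_inradius W (q : R) (m : nat) (rho : R) :
  (0 < d)%N -> 1 < q -> (0 < m)%N -> d%:R / q - 1 + m.+1%:R^-1 <= 0 ->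
  open W -> 0 < rho -> inradius W = rho%:E ->
  (((4 * d%:R * m.+1%:R)^-1 / rho)%:E <= (lambda q W) `^ q^-1)%E.
Proof.
move=> d0 q1 m0 dm oW rho0 hrho.
have mW := open_rV_measurable oW.
(* The ball inscribed in a cube of side [4 * rho] has radius [2 * rho], too large to fit in [W]. *)
have l0 : 0 < 4 * rho by rewrite mulr_gt0.
have H (k : 'rV[int]_d) : exists y, [/\ cube (4 * rho) k y, ~ W y &
     (0 : R) = 0 \/ forall x : 'rV[R]_d,
       (forall i, `|x ord0 i - y ord0 i| < 1 * (4 * rho)) -> ~ W x].
  apply: contrapT => h.
  have cW : eball (\row_i (4 * rho * (k ord0 i)%:~R)) (4 * rho / 2) `<=` W.
    move=> x hx; apply: contrapT => nWx; apply: h; exists x; split=> //.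
      exact: eball_sub_cube.
    by left.
  have : ((4 * rho / 2)%:E <= inradius W)%E.
    apply: ereal_sup_ubound; exists (4 * rho / 2) => //; split.
      by rewrite divr_gt0.
    by eexists; exact: cW.
  by rewrite hrho lee_fin; lra.
have := lambda_root_ge d0 q1 mW l0 m0 (lexx 0) ltr01 dm H.
apply: le_trans; rewrite lee_fin powRr0 div1r.
rewrite le_eqVlt; apply/orP; left; apply/eqP; field.
by rewrite !gt_eqF// ltr0n.
Qed.

(** A ball of radius above 1 contains the two points obtained by moving its center by a unit vector
    either way; their coordinates differ by 2, yet both would lie strictly between -1 and 1. *)
Lemma inradius_unit_ball : (0 < d)%N -> (inradius (eball (0 : 'rV[R]_d) 1) <= 1)%E.
Proof.
case: d => // n _.
apply: ge_ereal_sup => _ [r [r0 [c cB]] <-]; rewrite lee_fin leNgt; apply/negP => r1.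
pose i : 'I_n.+1 := ord0.
pose e : 'rV[R]_n.+1 := delta_mx ord0 i.
have ei : enorm e = 1.
  rewrite /enorm (bigD1 i)//= big1 ?addr0 => [|j ji].
    by rewrite mxE !eqxx expr1n sqrtr1.
  by rewrite mxE (negbTE ji) andbF expr0n.
have h (s : R) : `|s| < r -> `|c ord0 i + s| < 1.
  move=> sr; have : eball 0 1 (c + s *: e).
    by apply: cB; rewrite /eball/= addrC addKr enormZ ei mulr1.
  rewrite /eball/= subr0; apply: le_lt_trans.
  have := abs_coord_le_enorm (c + s *: e) i.
  by rewrite !mxE !eqxx mulr1.
have h1 := h 1; have h2 := h (- 1).
rewrite normrN !normr1 in h1 h2.
move: (h1 r1) (h2 r1); rewrite !ltr_norml => /andP[a1 a2] /andP[b1 b2]; lra.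
Qed.

Lemma A_all_unit_ball : A_all (eball (0 : 'rV[R]_d) 1).
Proof.
have oB := @open_eball R d 0 1.
split=> //.
- apply: open_measure_gt0 => //; exists 0.
  by rewrite /eball/= subr0 enorm0.
- apply: bounded_measure_lty; first exact: open_rV_measurable.
  exists 1 => x; rewrite /eball/= subr0 => /ltW hx i.
  exact: le_trans (abs_coord_le_enorm x i) hx.
Qed.

(** Here the exponent has to exceed the dimension: the gap 1 - d/q is positive and 1/(m + 1) fits
    below it. *)
Lemma exists_exponent (q : R) : d%:R < q -> exists m, (0 < m)%N /\ d%:R / q - 1 + m.+1%:R^-1 <= 0.
Proof.
move=> dq; have q0 : 0 < q by rewrite (le_lt_trans _ dq).
have e0 : 0 < 1 - d%:R / q by rewrite subr_gt0 ltr_pdivrMr// mul1r.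
have [m mP] : exists m : nat, (1 - d%:R / q)^-1 < m%:R.
  by exists (Num.truncn (1 - d%:R / q)^-1).+1; exact: truncnS_gt.
exists m.+1; split=> //.
have m0 : 0 < m%:R :> R by rewrite (lt_trans _ mP)// invr_gt0.
have : m.+2%:R^-1 <= 1 - d%:R / q.
  rewrite -[leRHS]invrK lef_pV2 ?posrE ?invr_gt0 ?ltr0n//.
  by rewrite (le_trans (ltW mP))// ler_nat -addn2 leq_addr.
set z := m.+2%:R^-1; set w := d%:R / q; lra.
Qed.

Lemma M_pq_lt_above_dimension (q : R) : (2 <= d)%N -> d%:R < q ->
  exists C : R,
    [/\ 0 < C,
        forall W : set 'rV[R]_d, W !=set0 -> bounded_set W -> open W ->
          (C%:E * (inradius W)^-1 <= lambda_root q%:E W)%E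
      & forall p : \bar R, (q%:E < p <= +oo)%E ->
          (M_pq d p q%:E < lambda_root p (eball (0%R : 'rV[R]_d) 1%R) / C%:E)%E].
Proof.
move=> d2 dq; have d0 : (0 < d)%N by exact: ltn_trans d2.
have d0R : 0 < d%:R :> R by rewrite ltr0n.
have q2 : 1 < q by apply: le_lt_trans dq; rewrite ler1n.
have lr (r : R) W : 1 < r -> lambda_root r%:E W = ((lambda r W) `^ r^-1)%E.
  by move=> r1; rewrite /lambda_root gt_eqF.
(* Used at [q] for the constant, and at a finite [p] to see that the value on the unit ball is
   positive. *)
have lower (r : R) : d%:R < r -> exists2 C : R, 0 < C &
    forall W, A_all W -> forall rho : R, 0 < rho -> inradius W = rho%:E ->
      ((C / rho)%:E <= (lambda r W) `^ r^-1)%E.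
  move=> dr; have [m [m0 mP]] := exists_exponent dr.
  have r1 : 1 < r by apply: le_lt_trans dr; rewrite ler1n.
  exists ((4 * d%:R * m.+1%:R)^-1); first by rewrite invr_gt0 !mulr_gt0 ?ltr0n.
  move=> W [oW _ _] rho rho0 hrho.
  exact: lambda_root_ge_inradius.
have [K K0 Klow] := lower q dq.
have C0 : 0 < K / 4 by rewrite divr_gt0.
(* The factor 4 pays for choosing a ball of radius only rho / 2 < r and for
   the strict inequality. *)
exists (K / 4); split=> //.
- move=> W W0 bW oW.
  have AW : A_all W.
    split=> //; first exact: open_measure_gt0.
    apply: bounded_measure_lty; first exact: open_rV_measurable.
    exact: bounded_set_coord.
  have [rho rho0 hrho] := inradius_A_all d0 AW.
  rewrite lr// hrho inver gt_eqF// -EFinM; apply: le_trans (Klow _ AW _ rho0 hrho).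
  by rewrite lee_fin ler_pM2r ?invr_gt0//; lra.
have [rho1 rho10 hrho1] := inradius_A_all d0 A_all_unit_ball.
have inv_low W : A_all W -> exists rho : R, [/\ 0 < rho, inradius W = rho%:E &
    ((lambda_root q%:E W)^-1 <= (rho / K)%:E)%E].
  move=> AW; have [rho rho0 hrho] := inradius_A_all d0 AW.
  exists rho; split=> //; rewrite lr//; have := Klow _ AW _ rho0 hrho.
  have k0 : 0 < K / rho by rewrite divr_gt0.
  case: (_ `^ _)%E => [b| |]//; last by rewrite invey lee_fin divr_ge0// ltW.
  rewrite lee_fin => hb; have b0 : 0 < b by exact: lt_le_trans hb.
  by rewrite inver gt_eqF// lee_fin -[rho / K]invrK invf_div lef_pV2.
move=> [p| |]//; rewrite ?ltxx// => /andP[qp _].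
- have {}qp : q < p by rewrite -lte_fin.
  have dp : d%:R < p by exact: lt_trans qp.
  have p1 : 1 < p by exact: lt_trans qp.
  have p0 : 0 < p by exact: lt_trans p1.
  have [K' K'0 K'low] := lower p dp.
  have hB := K'low _ A_all_unit_ball _ rho10 hrho1.
  have Boo : (lambda p (eball (0 : 'rV[R]_d) 1) < +oo)%E.
    apply: (@lambda_lty _ _ _ _ 0 1) => //.
    by apply: open_rV_measurable; exact: open_eball.
  rewrite (lr p)//.
  have : ((lambda p (eball (0 : 'rV[R]_d) 1)) `^ p^-1 < +oo)%E.
    exact: poweR_lty.
  move: hB; set B := ((_ `^ _)%E); have : B = B by []; rewrite {1}/B.
  case: B => [a| |]// Ba hB _.
  have a0 : 0 < a by rewrite lee_fin in hB; apply: lt_le_trans hB; rewrite divr_gt0.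
  rewrite inver gt_eqF// -EFinM.
  apply: (@le_lt_trans _ _ (2 * a / K)%:E).
    apply: ge_ereal_sup => _ [W AW <-].
    have [rho [rho0 hrho hinv]] := inv_low W AW.
    have [r [r0 [[c cW] hr]]] : exists r, 0 < r /\ (exists c, eball c r `<=` W) /\ rho / 2 < r.
      have : ((rho / 2)%:E < inradius W)%E by rewrite hrho lte_fin; lra.
      move=> /ereal_sup_gt[_ [r [r0 hc] <-]]; rewrite lte_fin => h.
      by exists r.
    have mW : measurable W by case: AW => oW _ _; exact: open_rV_measurable.
    have up := lambda_root_le_eball p1 mW r0 cW.
    rewrite Ba -EFinM in up.
    rewrite /F_pq (lr p)//.
    apply: (@le_trans _ _ ((r^-1 * a)%:E * (rho / K)%:E)%E).
      apply: lee_pmul => //; first exact: poweR_ge0.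
      by rewrite inve_ge0 lr// poweR_ge0.
    rewrite -EFinM lee_fin.
    have -> : r^-1 * a * (rho / K) = (a / K) * (rho / r) by ring.
    have -> : 2 * a / K = (a / K) * 2 by ring.
    rewrite ler_pM2l ?divr_gt0// ler_pdivrMr//; lra.
  rewrite lte_fin invf_div mulrA [a * 4]mulrC ltr_pM2r ?invr_gt0//; lra.
(* For infinite [p] the inradius cancels exactly and every ratio is at most [K^-1], while the
   right-hand side is at least 4 / K. *)
- have B1 := inradius_unit_ball d0.
  rewrite hrho1 lee_fin in B1.
  rewrite /lambda_root hrho1 !inver !gt_eqF// -EFinM.
  apply: (@le_lt_trans _ _ (K^-1)%:E).
    apply: ge_ereal_sup => _ [W AW <-].
    have [rho [rho0 hrho hinv]] := inv_low W AW.
    rewrite /F_pq /= hrho inver gt_eqF//.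
    apply: (@le_trans _ _ ((rho^-1)%:E * (rho / K)%:E)%E).
      apply: lee_wpmul2l => //; by rewrite lee_fin invr_ge0 ltW.
    by rewrite -EFinM lee_fin mulrA mulVf ?mul1r// gt_eqF.
  have : 1 <= rho1^-1 by rewrite -[leLHS]invr1 lef_pV2 ?posrE.
  have Ki : 0 < K^-1 by rewrite invr_gt0.
  rewrite lte_fin invf_div => h; nra.
Qed.

End above_dimension.

(** * Perforated cubes *)
Section perforated.
Context {R : realType} {d : nat}.
Local Notation mu := (lebesgue_rV R d).
Implicit Types (x : 'rV[R]_d).

Definition node M (c : 'rV['I_M]_d) : 'rV[R]_d := \row_i (c ord0 i)%:R.

(** Strict inequalities remove closed balls, so the set is open. Indices run from 0 to 6N inclusive,
    so lattice points on the faces of the cube have holes as well. *)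
Definition perforated (N : nat) (delta : R) : set 'rV[R]_d :=
  [set x : 'rV[R]_d | (forall i, 0 < x ord0 i < (6 * N)%:R) /\
    forall c : 'rV['I_(6 * N).+1]_d, delta < enorm (x - node c)].

Lemma open_perforated N delta : open (perforated N delta).
Proof.
rewrite openE => x [x1 x2]; rewrite /interior.
have h1 : nbhs x [set y : 'rV[R]_d | forall i, 0 < y ord0 i < (6 * N)%:R].
  apply: (@filter_forall _ _ (fun i (y : 'rV[R]_d) => 0 < y ord0 i < (6 * N)%:R) (nbhs x)) => i; have /andP[a b] := x1 i.
  have c : (fun y : 'rV[R]_d => y ord0 i) @ x --> x ord0 i by exact: coord_continuous.
  near=> y; apply/andP; split; near: y.
    exact: (cvgr_gt _ c).
  exact: (cvgr_lt _ c).
have h2 : nbhs x [set y : 'rV[R]_d | forall c : 'rV['I_(6 * N).+1]_d, delta < enorm (y - node c)].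
  apply: (@filter_forall _ _ (fun c (y : 'rV[R]_d) => delta < enorm (y - node c)) (nbhs x)) => c.
  have o : open (~` [set x : 'rV[R]_d | enorm (x - node c) <= delta]).
    by apply: closed_openC; exact: closed_enorm_le.
  have : nbhs x (~` [set x : 'rV[R]_d | enorm (x - node c) <= delta]).
    by apply: open_nbhs_nbhs; split=> //=; apply/negP; rewrite -ltNge; exact: x2.
  by apply: filterS => y /= /negP; rewrite -ltNge.
by apply: filterS (filterI h1 h2) => y [].
Unshelve. all: by end_near. Qed.

Lemma A_all_perforated N delta : (0 < d)%N -> (0 < N)%N -> delta < 2^-1 ->
  A_all (perforated N delta).
Proof.
move=> d0 N0 hdelta; have oW := @open_perforated N delta; split=> //.
(* The point with all coordinates 1/2 is at distance at least 1/2 from every node, whence the bound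
   on [delta]. *)
- apply: open_measure_gt0 => //; exists (const_mx 2^-1); split=> [i|c].
    rewrite mxE invr_gt0 ltr0n/=.
    apply: (@lt_le_trans _ _ 1); first by rewrite invf_lt1// ltr1n.
    by rewrite ler1n muln_gt0.
  apply: lt_le_trans hdelta _.
  have := abs_coord_le_enorm ((const_mx 2^-1 : 'rV[R]_d) - node c) (Ordinal d0).
  apply: le_trans; rewrite !mxE; move: (c ord0 _) => [[|j] /= _].
    by rewrite subr0 ger0_norm// invr_ge0.
  rewrite distrC; apply: le_trans (ler_norm _).
  have : 1 <= j.+1%:R :> R by rewrite ler1n.
  lra.
- apply: bounded_measure_lty; first exact: open_rV_measurable.
  exists (6 * N)%:R => x [hx _] i; have /andP[/ltW a /ltW b] := hx i.
  by rewrite ger0_norm.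
Qed.

Definition lattice (k : 'rV[int]_d) : 'rV[R]_d := \row_i (k ord0 i)%:~R.

(* Integer points outside [0, 6N]^d need no hole of their own: a point of W
   at distance less than 1 from k forces k into the index range. *)
Lemma perforated_hole N delta k x : 0 < delta <= 1 -> (0 < d)%N ->
  (forall i, `|x ord0 i - lattice k ord0 i| < delta / d%:R) -> ~ perforated N delta x.
Proof.
move=> /andP[delta0 delta1] d0 hx [x1 x2].
have d0R : 0 < d%:R :> R by rewrite ltr0n.
have dd : delta / d%:R <= 1.
  by rewrite ler_pdivrMr// mul1r (le_trans delta1)// ler1n.
have hk i : 0 <= k ord0 i <= (6 * N)%N.
  have /andP[a b] := x1 i; have := hx i; rewrite mxE ltr_norml => /andP[e f].
  have k1 : (-1 : int)%:~R < (k ord0 i)%:~R :> R by rewrite mulrN1z; lra.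
  have k2 : (k ord0 i)%:~R < ((6 * N).+1%:Z)%:~R :> R.
    by rewrite -pmulrn -natr1; lra.
  move: k1 k2; rewrite !ltr_int => k1 k2.
  by apply/andP; split; move: k1 k2; case: (k ord0 i) => [j|[|j]].
pose c : 'rV['I_(6 * N).+1]_d := \row_i inord `|k ord0 i|%N.
have ck : node c = lattice k.
  apply/rowP => i; rewrite !mxE inordK.
    by have /andP[k0 _] := hk i; rewrite -[in RHS](gez0_abs k0).
  have /andP[k0 k1] := hk i.
  by rewrite ltnS; move: k1; rewrite -{1}(gez0_abs k0) lez_nat.
have := x2 c; rewrite ck ltNge => /negP; apply.
have -> : delta = d%:R * (delta / d%:R) by field; rewrite gt_eqF.
by apply: enorm_le_coord => i; rewrite !mxE; have := hx i; rewrite !mxE => /ltW.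
Qed.

Lemma lattice_notin_perforated N delta k : 0 < delta <= 1 -> (0 < d)%N ->
  ~ perforated N delta (lattice k).
Proof.
move=> delta01 d0; apply: (perforated_hole (k := k)) => // i.
rewrite subrr normr0 divr_gt0 ?ltr0n//; by case/andP: delta01.
Qed.

(** Unit tiles are used, each with a hole at its center; [eta] is [delta / d] because a ball of
    radius [delta] contains the cube of that half-side. *)
Lemma lambda_root_perforated_ge N delta (p beta : R) (m : nat) :
  (0 < d)%N -> 1 < p -> (0 < m)%N -> 0 <= beta -> 0 < delta <= 1 ->
  d%:R / p - 1 + m.+1%:R^-1 <= beta ->
  (((delta / d%:R) `^ beta / (m.+1%:R * d%:R))%:E <=
   (lambda p (perforated N delta)) `^ (p^-1))%E.
Proof.
move=> d0 p1 m0 b0 delta01 hb; have d0R : 0 < d%:R :> R by rewrite ltr0n.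
have mW := open_rV_measurable (@open_perforated N delta).
have eta0 : 0 < delta / d%:R by rewrite divr_gt0//; case/andP: delta01.
have := lambda_root_ge d0 p1 mW ltr01 m0 b0 eta0 hb; rewrite [d%:R * 1]mulr1; apply=> k.
exists (lattice k); split; [|exact: lattice_notin_perforated|].
- move=> i; rewrite in_itv/= !mxE !mul1r; apply/andP; split; lra.
- by right=> x hx; apply: (perforated_hole (k := k)) => // i; have := hx i; rewrite mulr1.
Qed.

(** Rounding down the center of a ball reaches, within distance [d], a lattice point, and none of
    these belongs to the set. *)
Lemma inradius_perforated_le N delta : (0 < d)%N -> 0 < delta <= 1 ->
  (inradius (perforated N delta) <= d%:R%:E)%E.
Proof.
move=> d0 delta01; apply: ge_ereal_sup => _ [r [r0 [c cW]] <-].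
rewrite lee_fin leNgt; apply/negP => dr.
pose k : 'rV[int]_d := \row_i Num.floor (c ord0 i).
apply: (@lattice_notin_perforated N delta k delta01 d0).
apply: cW; rewrite /eball/=; apply: le_lt_trans dr.
rewrite -[leRHS]mulr1; apply: enorm_le_coord => i; rewrite !mxE.
have /andP[f1 f2] := floor_itv (c ord0 i); rewrite intrD in f2.
rewrite ler_norml; apply/andP; split; lra.
Qed.

(** For infinite [p] the inradius bound gives [beta = 0]. For q = d one has p > d, and again
    [beta = 0] works. Otherwise [beta] is taken just above max(0, d/p - 1). *)
Lemma lambda_root_perforated_lower (p : \bar R) (q : R) : (0 < d)%N -> 1 <= q -> (q%:E < p <= +oo)%E ->
  q <= d%:R -> exists (beta K : R), [/\ 0 <= beta, 0 < K,
    (q < d%:R -> beta < d%:R / q - 1), (q = d%:R -> beta = 0) &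
    forall N delta, (0 < N)%N -> 0 < delta < 2^-1 ->
     ((K * (delta / d%:R) `^ beta)%:E <= lambda_root p (perforated N delta))%E].
Proof.
move=> d0 q1 /andP[qp _] qd.
have d0R : 0 < d%:R :> R by rewrite ltr0n.
have q0 : 0 < q by exact: lt_le_trans q1.
have dle1 (delta : R) : 0 < delta < 2^-1 -> 0 < delta <= 1.
  by move=> /andP[-> h] /=; lra.
case: p qp => [p| |]//; last first.
  move=> _; exists 0, (d%:R^-1); split=> //; rewrite ?invr_gt0//.
    by rewrite subr_gt0 ltr_pdivlMr// mul1r.
  move=> N delta N0 hd; have [delta0 delta12] := andP hd.
  rewrite powRr0 mulr1 /lambda_root.
  have [rho rho0 hrho] := inradius_A_all d0 (A_all_perforated d0 N0 delta12).
  have := inradius_perforated_le N d0 (dle1 _ hd).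
  by rewrite hrho inver gt_eqF// !lee_fin lef_pV2.
rewrite lte_fin => qp; have p1 : 1 < p by exact: le_lt_trans qp.
have p0 : 0 < p by exact: lt_trans p1.
have lr W : lambda_root p%:E W = ((lambda p W) `^ p^-1)%E :> \bar R.
  by rewrite /lambda_root gt_eqF.
have main beta m : 0 <= beta -> (0 < m)%N -> d%:R / p - 1 + m.+1%:R^-1 <= beta ->
    forall N delta, (0 < N)%N -> 0 < delta < 2^-1 ->
     (((m.+1%:R * d%:R)^-1 * (delta / d%:R) `^ beta)%:E <=
      lambda_root p%:E (perforated N delta))%E.
  move=> b0 m0 hb N delta N0 hd; rewrite lr mulrC.
  by apply: lambda_root_perforated_ge => //; exact: dle1.
have Kgt0 m : 0 < (m.+1%:R * d%:R)^-1 :> R by rewrite invr_gt0 mulr_gt0.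
have [qd'|/eqP qd'] := eqVneq q d%:R.
  have dp : d%:R < p by rewrite -qd'.
  have [m [m0 mP]] := exists_exponent dp.
  exists 0, ((m.+1%:R * d%:R)^-1); split=> //.
    by rewrite qd' ltxx.
  exact: main.
have {qd'}qd : q < d%:R by rewrite lt_neqAle qd andbT; apply/eqP.
(* The room left below d/q - 1; it is positive because q < d and q < p, and the loss 1/(m + 1) is
   made smaller than it. *)
pose g := d%:R / q - 1 - Num.max 0 (d%:R / p - 1).
have g0 : 0 < g.
  rewrite /g subr_gt0 gt_max subr_gt0 ltr_pdivlMr// mul1r qd/=.
  by rewrite ltrD2r ltr_pM2l// ltf_pV2.
pose m := (Num.truncn (g^-1)).+1.
have mg : m.+1%:R^-1 < g.
  rewrite -[ltRHS]invrK ltf_pV2 ?posrE ?invr_gt0 ?ltr0n//.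
  by apply: lt_trans (truncnS_gt _) _; rewrite ltr_nat.
have bP : d%:R / p - 1 + m.+1%:R^-1 <= Num.max 0 (d%:R / p - 1) + m.+1%:R^-1.
  by rewrite lerD2r le_max lexx orbT.
exists (Num.max 0 (d%:R / p - 1) + m.+1%:R^-1), ((m.+1%:R * d%:R)^-1); split=> //.
- by rewrite addr_ge0 ?invr_ge0// le_max lexx.
- by move=> _; rewrite -ltrBrDl.
- by move=> e; rewrite e ltxx in qd.
- by apply: main => //; rewrite addr_ge0 ?invr_ge0// le_max lexx.
Qed.

End perforated.

(** * Covering estimates *)
Section finite_measure.
Context dd (X : measurableType dd) {R : realType}.
Variable mu : {measure set X -> \bar R}.

Lemma measurable_exists_seq (T : eqType) (H : T -> set X) (s : seq T) :
  (forall c, measurable (H c)) -> measurable [set x | exists2 c, c \in s & H c x].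
Proof.
move=> mH; elim: s => [|a s IH].
  by rewrite (_ : [set x | _] = set0)//; apply/seteqP; split=> x // [].
rewrite (_ : [set x | _] = H a `|` [set x | exists2 c, c \in s & H c x]).
  exact: measurableU.
apply/seteqP; split=> x /=.
  by move=> [c]; rewrite inE => /orP[/eqP ->|cs] hc; [left|right; exists c].
move=> [ha|[c cs hc]]; first by exists a => //; rewrite mem_head.
by exists c => //; rewrite inE cs orbT.
Qed.

Lemma measure_exists_le (T : finType) (H : T -> set X) :
  (forall c, measurable (H c)) ->
  (mu [set x | exists c, H c x] <= \sum_(c : T) mu (H c))%E.
Proof.
move=> mH.
have : (mu [set x | exists2 c, c \in index_enum T & H c x] <=
    \sum_(c <- index_enum T) mu (H c))%E.
  elim: (index_enum T) => [|a s IH].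
    rewrite big_nil (_ : [set x | _] = set0) ?measure0//.
    by apply/seteqP; split=> x // [].
  rewrite big_cons; have ms := measurable_exists_seq s mH.
  rewrite (_ : [set x | _] = H a `|` [set x | exists2 c, c \in s & H c x]).
    apply: le_trans (leeD2l _ IH); exact: measureU2.
  apply/seteqP; split=> x /=.
    by move=> [c]; rewrite inE => /orP[/eqP ->|cs] hc; [left|right; exists c].
  move=> [ha|[c cs hc]]; first by exists a => //; rewrite mem_head.
  by exists c => //; rewrite inE cs orbT.
rewrite (_ : [set x | exists2 c, _ & _] = [set x | exists c, H c x])//.
by apply/seteqP; split=> x /= [c]; [move=> _|move=> hc]; exists c => //; rewrite mem_index_enum.
Qed.

Lemma measurable_exists (T : finType) (H : T -> set X) :
  (forall c, measurable (H c)) -> measurable [set x | exists c, H c x].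
Proof.
move=> mH; have := measurable_exists_seq (index_enum T) mH.
rewrite (_ : [set x | exists2 c, _ & _] = [set x | exists c, H c x])//.
by apply/seteqP; split=> x /= [c]; [move=> _|move=> hc]; exists c => //; rewrite mem_index_enum.
Qed.

(** Designed for the gradient of the test function: [S0] carries the outer cut-off, the sets [S t]
    the bumps around the nodes. *)
Lemma integral_le_sum_indic (T : finType) (f : X -> R) (S0 : set X) (S : T -> set X)
    (w0 m0 : R) (w m : T -> R) :
  measurable_fun setT f -> (forall x, 0 <= f x) ->
  measurable S0 -> (forall t, measurable (S t)) -> 0 <= w0 -> (forall t, 0 <= w t) ->
  (mu S0 <= m0%:E)%E -> (forall t, mu (S t) <= (m t)%:E)%E ->
  (forall x, f x <= w0 * \1_S0 x + \sum_(t : T) w t * \1_(S t) x) ->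
  (\int[mu]_x (f x)%:E <= (w0 * m0 + \sum_(t : T) w t * m t)%:E)%E.
Proof.
move=> mf f0 mS0 mS w00 w0' hm0 hm fle.
have mi (A : set X) (a : R) : measurable A -> measurable_fun setT (fun x => (a * \1_A x)%:E).
  by move=> mA; apply/measurable_EFinP; apply: measurable_funM => //; exact: measurable_indic.
have gi (A : set X) (a : R) (x : X) : 0 <= a -> (0 <= (a * \1_A x)%:E :> \bar R)%E.
  by move=> a0; rewrite lee_fin mulr_ge0.
have ii (A : set X) (a : R) : measurable A -> 0 <= a -> (\int[mu]_x (a * \1_A x)%:E = a%:E * mu A)%E.
  move=> mA a0; under eq_integral do rewrite EFinM.
  rewrite ge0_integralZl//.
  - by rewrite integral_indic// setIT.
  - by apply/measurable_EFinP; exact: measurable_indic.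
apply: (@le_trans _ _ (\int[mu]_x ((w0 * \1_S0 x)%:E + \sum_(t : T) (w t * \1_(S t) x)%:E))%E).
  apply: ge0_le_integral => //.
  - by move=> x _; rewrite lee_fin.
  - exact/measurable_EFinP.
  - apply: emeasurable_funD; first exact: mi.
    by apply: emeasurable_sum => t; exact: mi.
  - by move=> x _; rewrite sumEFin -EFinD lee_fin.
rewrite ge0_integralD//; last 4 first.
- by move=> x _; exact: gi.
- exact: mi.
- by move=> x _; apply: sume_ge0 => t _; exact: gi.
- by apply: emeasurable_sum => t; exact: mi.
rewrite ge0_integral_sum//; last 2 first.
- by move=> t; exact: mi.
- by move=> t x _; exact: gi.
rewrite EFinD -sumEFin ii//; apply: leeD.
  by rewrite EFinM lee_wpmul2l ?lee_fin.
apply: lee_sum => t _; rewrite ii// EFinM lee_wpmul2l// lee_fin//.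
Qed.

End finite_measure.

(** * The cube with its holes and its measure *)

Section holes.
Context {R : realType} {d : nat}.
Local Notation mu := (lebesgue_rV R d).
Implicit Types (x c : 'rV[R]_d).

Definition cbox c (a : R) : set 'rV[R]_d :=
  [set x | forall i, x ord0 i \in `[c ord0 i - a, c ord0 i + a] ].

Lemma cboxP c a x : cbox c a x <-> forall i, `|x ord0 i - c ord0 i| <= a.
Proof.
have e i : (x ord0 i \in `[c ord0 i - a, c ord0 i + a]) = (`|x ord0 i - c ord0 i| <= a).
  by rewrite in_itv/= ler_distl.
by split=> h i; have := h i; rewrite e.
Qed.

Lemma measurable_cbox c a : measurable (cbox c a).
Proof. exact: (@measurable_box R d (fun i => [set` `[c ord0 i - a, c ord0 i + a] ])). Qed.

Lemma measure_cbox c a : 0 <= a -> mu (cbox c a) = ((2 * a) ^+ d)%:E.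
Proof.
move=> a0.
have := @lebesgue_rV_itv R d (fun i => c ord0 i - a) (fun i => c ord0 i + a) true false.
rewrite -/(cbox c a) => -> => [|i]; last by lra.
congr EFin; rewrite (eq_bigr (fun=> 2 * a)) => [|i _]; last by lra.
by rewrite prodr_const card_ord.
Qed.

Lemma card_nodes M : #|{: 'rV['I_M]_d}| = (M ^ d)%N.
Proof. by rewrite card_mx card_ord mul1n. Qed.

(** Boxes stand in for balls: they cover the balls of radius [a] and have explicit volume and
    faces. *)
Definition holes M (a : R) : set 'rV[R]_d :=
  [set x | exists c : 'rV['I_M]_d, cbox (node c) a x].

Definition box_center N : 'rV[R]_d := const_mx (3 * N)%:R.

(** A set on which the test function equals 1, and also the competitor for the Cheeger constant. The
    half-side N/d places the box in the Euclidean ball of radius N around the center. *)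
Definition swiss N (r : R) : set 'rV[R]_d :=
  cbox (box_center N) (N%:R / d%:R) `\` holes (6 * N).+1 (2 * r).

Lemma measurable_holes M a : measurable (holes M a).
Proof. by apply: measurable_exists => c; exact: measurable_cbox. Qed.

Lemma measurable_swiss N r : measurable (swiss N r).
Proof. by apply: measurableD; [exact: measurable_cbox|exact: measurable_holes]. Qed.

(** Origin of the 28: the holes have total volume at most (4 r (6N + 1))^d, and 4 r * 7 N <= N/d as
    soon as r <= 1/(28 d). The box has volume (2N/d)^d, at least twice (N/d)^d. *)
Lemma measure_swiss_ge N r : (0 < d)%N -> (0 < N)%N -> 0 < r -> r <= (28 * d%:R)^-1 ->
  (((N%:R / d%:R) ^+ d)%:E <= mu (swiss N r))%E.
Proof.
move=> d0 N0 r0 rd.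
have d0R : 0 < d%:R :> R by rewrite ltr0n.
have N0R : 0 < N%:R :> R by rewrite ltr0n.
have Nd : 0 <= N%:R / d%:R :> R by rewrite divr_ge0// ltW.
have hH : (mu (holes (6 * N).+1 (2 * r)) <= ((N%:R / d%:R) ^+ d)%:E)%E.
  have h0 : (mu (holes (6 * N).+1 (2 * r)) <=
      \sum_(c : 'rV['I_(6 * N).+1]_d) mu (cbox (node c) (2 * r)))%E.
    by apply: measure_exists_le => c; exact: measurable_cbox.
  apply: le_trans h0 _.
  rewrite (eq_bigr (fun=> ((2 * (2 * r)) ^+ d)%:E)) => [|c _]; last first.
    by rewrite measure_cbox// mulr_ge0// ltW.
  rewrite sumEFin lee_fin sumr_const card_nodes -[leLHS]mulr_natr natrX -exprMn.
  rewrite lerXn2r ?nnegrE ?mulr_ge0 ?(ltW r0)//.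
  apply: (@le_trans _ _ (2 * (2 * (28 * d%:R)^-1) * (7 * N%:R))).
    rewrite ler_pM ?mulr_ge0 ?(ltW r0)//; first by lra.
    rewrite -natr1 natrM; have : 1 <= N%:R :> R by rewrite ler1n.
    lra.
  rewrite le_eqVlt; apply/orP; left; apply/eqP; field; by rewrite gt_eqF.
have mK := measurable_cbox (box_center N) (N%:R / d%:R).
have mH := @measurable_holes (6 * N).+1 (2 * r).
have hK : (mu (cbox (box_center N) (N%:R / d%:R)) <=
    mu (swiss N r) + mu (holes (6 * N).+1 (2 * r)))%E.
  apply: (@le_trans _ _ (mu (swiss N r `|` holes (6 * N).+1 (2 * r)))).
    apply: le_measure; rewrite ?inE//.
      by apply: measurableU => //; exact: measurable_swiss.
    move=> x Kx; have [Hx|nHx] := pselect (holes (6 * N).+1 (2 * r) x); first by right.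
    by left.
  by apply: measureU2 => //; exact: measurable_swiss.
rewrite measure_cbox// in hK.
have h2 : (N%:R / d%:R) ^+ d + (N%:R / d%:R) ^+ d <= (2 * (N%:R / d%:R)) ^+ d :> R.
  have key (y t : R) : 0 <= y -> 2 <= t -> y + y <= t * y by move=> y0 t2; nra.
  rewrite [leRHS]exprMn; apply: key; first by rewrite exprn_ge0.
  by case: (d) d0 => // k _; rewrite exprS ler_peMr// exprn_ege1// ler1n.
have := le_trans hK (leeD2l _ hH).
move: (measure_ge0 mu (swiss N r)); case: (mu (swiss N r)) => [a| |]//; last by move=> _ _; rewrite leey.
rewrite -EFinD !lee_fin => _ h3; lra.
Qed.

Lemma node_close M (c c' : 'rV['I_M]_d) x :
  enorm (x - node c) < 2^-1 -> enorm (x - node c') < 2^-1 -> c = c'.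
Proof.
move=> h h'; apply/rowP => i; apply/val_inj.
have := le_lt_trans (abs_coord_le_enorm _ i) h.
have := le_lt_trans (abs_coord_le_enorm _ i) h'.
rewrite !mxE !ltr_norml => /andP[a b] /andP[e f].
have le (m n : nat) : (m%:R < n%:R + 1 :> R) -> (m <= n)%N.
  by rewrite natr1 ltr_nat ltnS.
by apply/eqP; rewrite eqn_leq; apply/andP; split; apply: le; lra.
Qed.

Lemma sum_at_most_one (T : finType) (a : T -> R) :
  (forall s t, a s != 0 -> a t != 0 -> s = t) ->
  (forall t, a t = 0) \/ exists t, \sum_s a s = a t /\ forall s, s != t -> a s = 0.
Proof.
move=> h; have [[t at0]|n] := pselect (exists t, a t != 0); last first.
  by left=> t; apply/eqP; apply/negP => /negP at0; apply: n; exists t.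
right; exists t.
have z s : s != t -> a s = 0.
  by move=> st; apply/eqP; apply: contraNT st => as0; rewrite (h s t).
by split=> //; rewrite (bigD1 t)//= big1 ?addr0.
Qed.

End holes.

(** * Averaged cut-offs and the upper bound for lambda *)
Section finite_sums.
Context {R : realType} {d : nat}.

Lemma sum_enum_val (T : finType) (F : T -> R) :
  \sum_(k : T) F k = \sum_(j < #|T|) F (enum_val j).
Proof. by rewrite -big_enum_val; apply: eq_bigl. Qed.

Lemma C1_fin_sum (T : finType) (u : T -> 'rV[R]_d -> R) : (forall k, C1 (u k)) ->
  C1 (fun x => \sum_(k : T) u k x).
Proof.
move=> cu; have -> : (fun x => \sum_(k : T) u k x) =
    (fun x => \sum_(j < #|T|) u (enum_val j) x).
  by apply/funext => x; rewrite sum_enum_val.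
by apply: C1_sum => j.
Qed.

Lemma partial_fin_sum (T : finType) (u : T -> 'rV[R]_d -> R) i x : (forall k, C1 (u k)) ->
  partial i (fun x => \sum_(k : T) u k x) x = \sum_(k : T) partial i (u k) x.
Proof.
move=> cu; have -> : (fun x => \sum_(k : T) u k x) =
    (fun x => \sum_(j < #|T|) u (enum_val j) x).
  by apply/funext => y; rewrite sum_enum_val.
by rewrite partial_sum// [RHS]sum_enum_val.
Qed.

Lemma powR_sum_at_most_one (T : finType) (a : T -> R) (q : R) : 0 < q ->
  (forall s t, a s != 0 -> a t != 0 -> s = t) ->
  (\sum_t a t) `^ q = \sum_t a t `^ q.
Proof.
move=> q0 h; have q0' : q != 0 by rewrite gt_eqF.
have [z|[t [-> z]]] := sum_at_most_one h.
  by rewrite big1// powR0// big1// => t _; rewrite z powR0.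
rewrite (bigD1 t)//= big1 ?addr0// => s st.
by rewrite z// powR0.
Qed.

Lemma powR_add_le (a b q : R) : 0 <= a -> 0 <= b -> 0 < q ->
  (a + b) `^ q <= 2 `^ q * (a `^ q + b `^ q).
Proof.
move=> a0 b0 q0; wlog ab : a b a0 b0 / a <= b.
  move=> h; have [ab|/ltW ba] := leP a b; first exact: h.
  by rewrite addrC [X in _ * X]addrC; exact: h.
apply: (@le_trans _ _ ((2 * b) `^ q)).
  by rewrite ge0_ler_powR ?nnegrE ?(ltW q0) ?addr_ge0 ?mulr_ge0//; lra.
by rewrite powRM// ler_wpM2l ?powR_ge0// lerDr powR_ge0.
Qed.

End finite_sums.

(** * The test function on a perforated cube *)

Section test_function.
Context {R : realType} {d : nat}.
Local Notation mu := (lebesgue_rV R d).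
Variables (N n : nat) (r : R).
Hypothesis d0 : (0 < d)%N.
Hypothesis N0 : (0 < N)%N.
Hypothesis r0 : 0 < r.
Hypothesis rd : r <= (28 * d%:R)^-1.

Let node_t := 'rV['I_(6 * N).+1]_d.
Let T : finType := ('I_n.+1 * node_t)%type.
Let rk (k : 'I_n.+1) : R := r / 2 ^+ k.
Let B (t : T) : 'rV[R]_d -> R := ball_bump (node t.2) (rk t.1).
Let a : R := n.+1%:R^-1.
(** The average over the n + 1 radii r / 2^k of cut-offs that vanish near the nodes: a discrete form
    of the logarithmic profile, the extremal one for the d-capacity of a small ball. *)
Let psi (x : 'rV[R]_d) : R := 1 - a * \sum_(t : T) B t x.

Let r28 : r <= 28^-1.
Proof.
apply: le_trans rd _; rewrite lef_pV2 ?posrE ?mulr_gt0 ?ltr0n//.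
by rewrite ler_peMr// ler1n.
Qed.

Let rk_gt0 k : 0 < rk k.
Proof. by rewrite divr_gt0// exprn_gt0. Qed.

Let rk_le k : rk k <= r.
Proof. by rewrite ler_pdivrMr ?exprn_gt0// ler_peMr ?(ltW r0)// exprn_ege1// ler1n. Qed.

Let rk_half k : 2 * rk k < 2^-1.
Proof. have := rk_le k; have := r28; lra. Qed.

Let rk_lt (k k' : 'I_n.+1) : (k < k')%N -> 2 * rk k' <= rk k.
Proof.
move=> kk'; rewrite /rk -(subnK kk') addnS exprS exprD.
have e0 (m : nat) : 0 < 2 ^+ m :> R by rewrite exprn_gt0.
rewrite invfM mulrCA [2 * _]mulrA divff// mul1r ler_wpM2l ?(ltW r0)//.
by rewrite lef_pV2 ?posrE ?mulr_gt0// ler_peMl ?(ltW (e0 _))// exprn_ege1// ler1n.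
Qed.

Let B_itv t x : 0 <= B t x <= 1.
Proof. exact: bump_itv. Qed.

Let B_neq0 t x : B t x != 0 -> enorm (x - node t.2) < 2 * rk t.1.
Proof.
rewrite ltNge; apply: contra => h.
by apply/eqP; have [] := bump_out (rk_gt0 t.1) h.
Qed.

(** At a fixed scale the supports around distinct nodes are disjoint, their radii being less than
    1/2. *)
Let sum_B_layer x k : \sum_(c : node_t) B (k, c) x <= 1.
Proof.
have h s t : B (k, s) x != 0 -> B (k, t) x != 0 -> s = t.
  move=> /B_neq0 hs /B_neq0 ht; apply: (node_close (x := x)).
    exact: lt_trans hs (rk_half k).
  exact: lt_trans ht (rk_half k).
have [z|[c [-> _]]] := sum_at_most_one h; first by rewrite big1.
by have /andP[] := B_itv (k, c) x.
Qed.

Let sum_B x : 0 <= \sum_(t : T) B t x <= n.+1%:R.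
Proof.
apply/andP; split; first by apply: sumr_ge0 => t _; have /andP[] := B_itv t x.
have -> : \sum_(t : T) B t x = \sum_k \sum_(c : node_t) B (k, c) x.
  by rewrite pair_bigA/=; apply: eq_bigr => -[].
apply: (@le_trans _ _ (\sum_(k < n.+1) 1)); first by apply: ler_sum => k _; exact: sum_B_layer.
by rewrite sumr_const card_ord.
Qed.

Let psi_itv x : 0 <= psi x <= 1.
Proof.
have /andP[h1 h2] := sum_B x.
have a0 : 0 < a by rewrite invr_gt0 ltr0n.
rewrite /psi subr_ge0 lerBlDr lerDl mulr_ge0// ?(ltW a0)// andbT.
by rewrite /a mulrC ler_pdivrMr ?mul1r.
Qed.

(** Within the smallest radius the bumps of all n + 1 scales at [c] equal 1, and their average
    exhausts the constant 1. *)
Let psi_near (c : node_t) x : enorm (x - node c) <= r / 2 ^+ n -> psi x = 0.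
Proof.
move=> h; have /andP[_ h2] := sum_B x.
have h1 : n.+1%:R <= \sum_(t : T) B t x.
  have -> : \sum_(t : T) B t x = \sum_k \sum_(c : node_t) B (k, c) x.
    by rewrite pair_bigA/=; apply: eq_bigr => -[].
  apply: (@le_trans _ _ (\sum_(k < n.+1) 1)); first by rewrite sumr_const card_ord.
  apply: ler_sum => k _; rewrite (bigD1 c)//=.
  have [-> _] : B (k, c) x = 1 /\ True.
    split=> //; have [] := @bump_in R d (node c) (rk k) x (rk_gt0 k) _ => //.
    apply: le_trans h _; rewrite ler_wpM2l ?(ltW r0)// lef_pV2 ?posrE ?exprn_gt0//.
    by rewrite ler_weXn2l ?ler1n// -ltnS.
  by rewrite lerDl; apply: sumr_ge0 => c' _; have /andP[] := B_itv (k, c') x.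
have -> : psi x = 1 - a * n.+1%:R.
  by rewrite /psi; congr (1 - a * _); apply/eqP; rewrite eq_le h2.
by rewrite /a mulVf ?subrr// pnatr_eq0.
Qed.

Let psi_far x : (forall c : node_t, 2 * r <= enorm (x - node c)) -> psi x = 1.
Proof.
move=> h; rewrite /psi big1 ?mulr0 ?subr0// => t _.
apply/eqP; apply/negP => /negP /B_neq0; rewrite ltNge => /negP; apply.
by apply: le_trans (h t.2); rewrite ler_pM2l// rk_le.
Qed.

Let is_derive_onem (t : R) : is_derive t (1 : R) (fun s => 1 - a * s) (- a).
Proof.
apply: (@is_derive_quadratic _ _ _ _ 1) => // h _.
have -> : 1 - a * (t + h) - (1 - a * t) - - a * h = 0 by ring.
by rewrite normr0 mul1r sqr_ge0.
Qed.

Let C1_psi : C1 psi.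
Proof.
apply: (C1_comp (f := fun s => 1 - a * s) (f' := fun=> - a)
  (u := fun x => \sum_(t : T) B t x)).
- by apply: C1_fin_sum => t; exact: C1_bump.
- exact: is_derive_onem.
- by move=> t; exact: cvg_cst.
Qed.

(* The gradients of the bumps live on these annuli, which are pairwise disjoint, so
   the q-th power of the averaged gradient is a sum with the gain (n + 1)^(-q). *)
Let A (t : T) x := (rk t.1 < enorm (x - node t.2)) && (enorm (x - node t.2) < 2 * rk t.1).

Let A_unique s t x : A s x -> A t x -> s = t.
Proof.
move: s t => [k c] [k' c'] /andP[/= s1 s2] /andP[/= t1 t2].
have cc : c = c'.
  by apply: (node_close (x := x)); [exact: lt_trans s2 (rk_half k)|exact: lt_trans t2 (rk_half k')].
subst c'; congr (_, _); apply/val_inj/eqP => /=.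
case: ltngtP => // kk; have := rk_lt kk; lra.
Qed.

(** A bump is constant inside its own radius, which reduces the ball in [norm_partial_bump_le] to
    the annulus [A t]. *)
Let norm_partial_psi i x :
  `|partial i psi x| <= a * \sum_(t : T) 16 / rk t.1 * (A t x)%:R.
Proof.
have cB t : C1 (B t) by exact: C1_bump.
have cS : C1 (fun x => \sum_(t : T) B t x) by exact: C1_fin_sum.
have [_ /(_ i)] := partial_comp x cS is_derive_onem.
rewrite -[_ \o _]/psi => ->; rewrite partial_fin_sum//.
have a0 : 0 <= a by rewrite invr_ge0.
rewrite normrM normrN (ger0_norm a0) ler_wpM2l//.
apply: (le_trans (ler_norm_sum _ _ _)); apply: ler_sum => t _.
have := norm_partial_bump_le (node t.2) x i (rk_gt0 t.1).
rewrite /A; case: (leP (enorm (x - node t.2)) (rk t.1)) => //= h _.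
by have [_ ->] := bump_in (rk_gt0 t.1) h; rewrite normr0 mulr0.
Qed.

Let v : 'rV[R]_d -> R := ball_bump (box_center N) N%:R.
Let u (x : 'rV[R]_d) : R := v x * psi x.
Let N0R : 0 < N%:R :> R. Proof. by rewrite ltr0n. Qed.

(** The outer cut-off confines coordinates to [N, 5N], inside a cube of side 6N. Since [psi]
    vanishes up to radius r / 2^n, the closed support stays at that distance from the nodes; halving
    the radius once more gives holes it does not touch. *)
Let C1c_u : C1c (@perforated R d N (r / 2 ^+ n.+1)) u.
Proof.
apply: C1c_mul_bump => // x xN xpsi; split.
  move=> i; have := le_trans (abs_coord_le_enorm _ i) xN.
  have N1 : 0 < N%:R :> R := N0R; rewrite !mxE !natrM ler_norml => /andP[h1 h2]; apply/andP; split; lra.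
move=> c.
have s0 : closed [set x : 'rV[R]_d | r / 2 ^+ n <= enorm (x - node c)].
  exact: closed_enorm_ge.
have : [set x : 'rV[R]_d | r / 2 ^+ n <= enorm (x - node c)] x.
  move: xpsi; rewrite closureE; apply; split=> // y /= hy.
  by rewrite leNgt; apply/negP => /ltW /psi_near py; rewrite py eqxx in hy.
apply: lt_le_trans; rewrite ltr_pM2l// ltf_pV2 ?posrE ?exprn_gt0//.
by rewrite exprS ltr_pMl ?exprn_gt0// ltr1n.
Qed.

Let u_one x : swiss N r x -> u x = 1.
Proof.
move=> [/cboxP Kx nH]; rewrite /u psi_far ?mulr1; last first.
  move=> c; rewrite leNgt; apply/negP => h; apply: nH; exists c; apply/cboxP => i.
  by apply: le_trans (ltW h); have := abs_coord_le_enorm (x - node c) i; rewrite !mxE.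
have [] // := @bump_in R d (box_center N) N%:R x N0R.
have -> : N%:R = d%:R * (N%:R / d%:R) :> R by field; rewrite pnatr_eq0 -lt0n.
by apply: enorm_le_coord => i; have := Kx i; rewrite !mxE.
Qed.

Let norm_partial_u i x : `|partial i u x| <=
  16 / N%:R * (enorm (x - box_center N) < 2 * N%:R)%R%:R +
  a * \sum_(t : T) 16 / rk t.1 * (A t x)%:R.
Proof.
have cv : C1 v by exact: C1_bump.
rewrite /u partialM//; apply: le_trans (ler_normD _ _) _.
rewrite addrC (normrM (psi x)) (normrM (v x)).
have /andP[p0 p1] := psi_itv x; have /andP[v0 v1] : 0 <= v x <= 1 by exact: bump_itv.
rewrite (ger0_norm p0) (ger0_norm v0).
apply: lerD.
  apply: le_trans (norm_partial_bump_le (box_center N) x i N0R).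
  by rewrite ler_piMl.
by apply: le_trans (norm_partial_psi i x); rewrite ler_piMl.
Qed.

Let powR_bool (b : bool) (z q : R) : 0 <= z -> 0 < q -> (z * b%:R) `^ q = z `^ q * b%:R.
Proof. by move=> z0 q0; case: b; rewrite ?mulr1// !mulr0 powR0// gt_eqF. Qed.

(** The factor 2 separates the two gradients through [powR_add_le], [d] passes from partial
    derivatives to the norm, and 16 / radius bounds the partial derivatives of a bump. *)
Let w0 (q : R) := (2 * d%:R) `^ q * (16 / N%:R) `^ q.
Let w (q : R) (t : T) := (2 * d%:R) `^ q * a `^ q * (16 / rk t.1) `^ q.

Let grad_u_le q x : 0 < q -> enorm (grad u x) `^ q <=
  w0 q * \1_(cbox (box_center N) (2 * N%:R)) x +
  \sum_(t : T) w q t * \1_(cbox (node t.2) (2 * rk t.1)) x.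
Proof.
move=> q0.
pose al : R := 16 / N%:R * (enorm (x - box_center N) < 2 * N%:R)%R%:R.
pose be : R := a * \sum_(t : T) 16 / rk t.1 * (A t x)%:R.
have a0 : 0 <= a by rewrite invr_ge0.
have al0 : 0 <= al by rewrite mulr_ge0// divr_ge0.
have rr0 t : 0 <= 16 / rk t.1 by rewrite divr_ge0// ltW.
have be0 : 0 <= be by rewrite mulr_ge0// sumr_ge0// => t _; rewrite mulr_ge0.
have h1 : enorm (grad u x) <= d%:R * (al + be).
  by apply: enorm_le_coord => i; rewrite mxE; exact: norm_partial_u.
have h2 : enorm (grad u x) `^ q <= (2 * d%:R) `^ q * (al `^ q + be `^ q).
  apply: (@le_trans _ _ ((d%:R * (al + be)) `^ q)).
    by rewrite ge0_ler_powR ?nnegrE ?enorm_ge0 ?mulr_ge0 ?addr_ge0 ?(ltW q0).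
  rewrite powRM ?addr_ge0// [2 * _]mulrC powRM// -mulrA ler_wpM2l ?powR_ge0//.
  exact: powR_add_le.
apply: le_trans h2 _; rewrite mulrDr; apply: lerD.
  rewrite /w0 /al powR_bool ?divr_ge0// mulrA ler_wpM2l ?mulr_ge0 ?powR_ge0//.
  rewrite indicE ler_nat; case: ltP => //= h; rewrite mem_set//; apply/cboxP => i.
  by apply: le_trans (ltW h); have := abs_coord_le_enorm (x - box_center N) i; rewrite !mxE.
have S0 : 0 <= \sum_(t : T) 16 / rk t.1 * (A t x)%:R.
  by rewrite sumr_ge0// => t _; rewrite mulr_ge0.
rewrite /be (powRM _ a0 S0) powR_sum_at_most_one//; last first.
  move=> s t; rewrite !mulf_eq0 !negb_or => /andP[_ hs] /andP[_ ht].
  by apply: (@A_unique s t x); [move: hs|move: ht]; case: (A _ _); rewrite ?eqxx.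
rewrite mulrA mulr_sumr; apply: ler_sum => t _.
rewrite powR_bool// mulrA /w ler_wpM2l ?mulr_ge0 ?powR_ge0//.
rewrite indicE ler_nat; case E : (A t x) => //=; rewrite mem_set//; apply/cboxP => i.
have /andP[_ h] := E.
by apply: le_trans (ltW h); have := abs_coord_le_enorm (x - node t.2) i; rewrite !mxE.
Qed.

(** The d-th powers are volumes of boxes. A bump of radius rho contributes a multiple of rho^(d -
    q), at most r^(d - q) because q <= d. There are (n + 1)(6N + 1)^d bumps, each with the factor (n
    + 1)^(-q) of the average, and 4 (6N + 1) <= 28 N. *)
Let weight_sum q : 1 <= q -> q <= d%:R ->
  w0 q * (4 * N%:R) ^+ d + \sum_(t : T) w q t * (4 * rk t.1) ^+ d <=
  (32 * d%:R) `^ q * (28 * N%:R) ^+ d *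
   (N%:R `^ (- q) + n.+1%:R `^ (1 - q) * r `^ (d%:R - q)).
Proof.
move=> q1 qd; have q0 : 0 < q by exact: lt_le_trans q1.
have e16 (z : R) : 0 < z -> (16 / z) `^ q = 16 `^ q * z `^ (- q).
  by move=> z0; rewrite powRM ?invr_ge0 ?(ltW z0)// -powR_inv1 ?(ltW z0)// -powRrM mulN1r.
have e32 : (32 * d%:R) `^ q = (2 * d%:R) `^ q * 16 `^ q.
  rewrite -powRM ?mulr_ge0//; congr (_ `^ q); ring.
rewrite mulrDr; apply: lerD.
  rewrite /w0 e16// e32 [leRHS]mulrAC mulrA ler_wpM2l ?mulr_ge0 ?powR_ge0//.
  by rewrite lerXn2r ?nnegrE ?mulr_ge0// ler_wpM2r// ler_nat.
have bound t : w q t * (4 * rk t.1) ^+ d <=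
   (32 * d%:R) `^ q * a `^ q * (4 ^+ d * r `^ (d%:R - q)).
  rewrite /w e16// e32 exprMn.
  have -> : (2 * d%:R) `^ q * a `^ q * (16 `^ q * rk t.1 `^ (- q)) * (4 ^+ d * rk t.1 ^+ d) =
     (2 * d%:R) `^ q * 16 `^ q * a `^ q * (4 ^+ d * (rk t.1 ^+ d * rk t.1 `^ (- q))) by ring.
  rewrite ler_wpM2l ?mulr_ge0 ?powR_ge0// ler_wpM2l ?exprn_ge0//.
  rewrite -powR_mulrn ?(ltW (rk_gt0 _))// -powRD; last by rewrite (gt_eqF (rk_gt0 _)) implybT.
  by rewrite ge0_ler_powR ?nnegrE ?subr_ge0 ?(ltW (rk_gt0 _)) ?(ltW r0).
apply: (le_trans (ler_sum _ (fun t _ => bound t))).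
rewrite sumr_const card_prod card_ord card_nodes -[leLHS]mulr_natr natrM natrX.
have an : a `^ q * n.+1%:R = n.+1%:R `^ (1 - q).
  rewrite /a -powR_inv1// -powRrM mulN1r [RHS]powRD; last by rewrite pnatr_eq0 implybT.
  by rewrite powRr1// mulrC.
have -> : (32 * d%:R) `^ q * a `^ q * (4 ^+ d * r `^ (d%:R - q)) *
    (n.+1%:R * (6 * N).+1%:R ^+ d) =
  (32 * d%:R) `^ q * (a `^ q * n.+1%:R) * r `^ (d%:R - q) *
    (4 ^+ d * (6 * N).+1%:R ^+ d) by ring.
rewrite an -exprMn.
have -> : (32 * d%:R) `^ q * (28 * N%:R) ^+ d * (n.+1%:R `^ (1 - q) * r `^ (d%:R - q)) =
  (32 * d%:R) `^ q * n.+1%:R `^ (1 - q) * r `^ (d%:R - q) * (28 * N%:R) ^+ d by ring.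
rewrite ler_wpM2l ?mulr_ge0 ?powR_ge0// lerXn2r ?nnegrE ?mulr_ge0//.
rewrite -[(6 * N).+1%:R]natr1 natrM; have : 1 <= N%:R :> R by rewrite ler1n.
lra.
Qed.

(** The estimates of both integrals carry a factor N^d, which cancels and leaves (28 d)^d; [N] then
    survives only in the cost of the outer cut-off. *)
Lemma lambda_perforated_le (q : R) : 1 <= q -> q <= d%:R ->
  (lambda q (@perforated R d N (r / 2 ^+ n.+1)) <=
   ((32 * d%:R) `^ q * (28 * d%:R) ^+ d *
     (N%:R `^ (- q) + n.+1%:R `^ (1 - q) * r `^ (d%:R - q)))%:E)%E.
Proof.
move=> q1 qd; have q0 : 0 < q by exact: lt_le_trans q1.
have mW := open_rV_measurable (@open_perforated R d N (r / 2 ^+ n.+1)).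
have d0R : 0 < d%:R :> R by rewrite ltr0n.
have Nd : 0 < (N%:R / d%:R) ^+ d :> R by rewrite exprn_gt0// divr_gt0.
have C1u : C1 u by have [] := C1c_u.
have hI : (((N%:R / d%:R) ^+ d)%:E <= \int[mu]_x (`|u x| `^ q)%:E)%E.
  apply: le_trans (measure_swiss_ge d0 N0 r0 rd) _.
  have mS := @measurable_swiss R d N r.
  rewrite -[mu (swiss N r)]mul1e -(integral_cst mu mS).
  have mu' : measurable_fun setT (fun x => (`|u x| `^ q)%:E).
    by apply/measurable_EFinP; apply: measurable_powR_norm; exact: C1_continuous.
  apply: (@le_trans _ _ (\int[mu]_(x in swiss N r) (`|u x| `^ q)%:E)%E).
    apply: ge0_le_integral => //.
    - exact: measurable_funTS.
    - by move=> x /u_one ->; rewrite normr1 powR1.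
  by apply: ge0_subset_integral => // x _; rewrite lee_fin powR_ge0.
have u0 : exists x, u x != 0.
  apply: contrapT => h.
  have : (\int[mu]_x (`|u x| `^ q)%:E = 0)%E.
    apply: integral0_eq => x _; rewrite (_ : u x = 0) ?normr0 ?powR0 ?gt_eqF//.
    by apply/eqP; apply/negP => /negP ux; apply: h; exists x.
  by move=> e; rewrite e lee_fin leNgt Nd in hI.
have [[J I] /= /andP[J0 I0] [gJ gI e]] := rayleighE q0 mW C1c_u u0.
rewrite gI lee_fin in hI.
have hJ : J <= (32 * d%:R) `^ q * (28 * N%:R) ^+ d *
   (N%:R `^ (- q) + n.+1%:R `^ (1 - q) * r `^ (d%:R - q)).
  apply: le_trans (weight_sum q1 qd); rewrite -lee_fin -gJ.
  apply: (integral_le_sum_indic (S0 := cbox (box_center N) (2 * N%:R))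
     (S := fun t : T => cbox (node t.2) (2 * rk t.1))).
  - exact: measurable_powR_grad.
  - by move=> x; exact: powR_ge0.
  - exact: measurable_cbox.
  - by move=> t; exact: measurable_cbox.
  - by rewrite mulr_ge0 ?powR_ge0.
  - by move=> t; rewrite !mulr_ge0 ?powR_ge0.
  - have -> : 4 * N%:R = 2 * (2 * N%:R) :> R by ring.
    by rewrite -(measure_cbox (box_center N)) ?mulr_ge0.
  - move=> t; have -> : 4 * rk t.1 = 2 * (2 * rk t.1) by ring.
    rewrite -(measure_cbox (node t.2)); first exact: lexx.
    by have := rk_gt0 t.1; lra.
  - by move=> x; exact: grad_u_le.
apply: (@le_trans _ _ (rayleigh q (@perforated R d N (r / 2 ^+ n.+1)) u)).
  by apply: ereal_inf_lbound; exists u.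
rewrite e lee_fin ler_pdivrMr//; apply: le_trans hJ _.
set X := N%:R `^ (- q) + _.
have X0 : 0 <= X by rewrite addr_ge0 ?mulr_ge0 ?powR_ge0.
have -> : (28 * N%:R) ^+ d = (28 * d%:R) ^+ d * (N%:R / d%:R) ^+ d :> R.
  by rewrite -exprMn; congr (_ ^+ d); field; rewrite gt_eqF.
have -> : (32 * d%:R) `^ q * ((28 * d%:R) ^+ d * (N%:R / d%:R) ^+ d) * X =
  (32 * d%:R) `^ q * (28 * d%:R) ^+ d * X * (N%:R / d%:R) ^+ d by ring.
by rewrite ler_wpM2l ?mulr_ge0 ?powR_ge0 ?exprn_ge0.
Qed.

End test_function.

(** * Perimeter of a perforated cube *)
Section perimeter_bound.
Context {R : realType} {d : nat}.
Local Notation mu := (lebesgue_rV R d).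
Implicit Types (f : 'rV[R]_d -> R) (E : set 'rV[R]_d) (x : 'rV[R]_d).

Let e (i : 'I_d) : 'rV[R]_d := delta_mx ord0 i.

Definition translate i (h : R) E : set 'rV[R]_d := [set x | E (x - h *: e i)].

Lemma measurable_translate i h E : measurable E -> measurable (translate i h E).
Proof.
move=> mE; have m : measurable_fun setT (fun x : 'rV[R]_d => x - h *: e i).
  apply: measurable_fun_coordP => j; under eq_fun do rewrite !mxE.
  by apply: measurable_funB => //; exact: measurable_coord.
by rewrite -[translate i h E]setTI; exact: m.
Qed.

Lemma integral_translate i h E (F : 'rV[R]_d -> R) : measurable E ->
  measurable_fun setT F -> (forall x, 0 <= F x) ->
  (\int[mu]_(x in E) (F (x + h *: e i))%:E = \int[mu]_(x in translate i h E) (F x)%:E)%E.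
Proof.
move=> mE mF F0; have mT := measurable_translate i h mE.
rewrite integral_mkcond [RHS]integral_mkcond.
pose H := (EFin \o F) \_ (translate i h E).
have mH : measurable_fun setT H.
  by apply/(measurable_restrictT _ mT); apply: measurable_funTS; exact/measurable_EFinP.
have H0 x : (0 <= H x)%E by rewrite /H patchE; case: ifP => //= _; rewrite lee_fin.
have := integral_affine (h *: e i) ltr01 mH H0.
rewrite expr1n invr1 mul1e => <-; apply: eq_integral => x _.
rewrite /H !patchE scale1r [h *: e i + x]addrC.
have -> : (x + h *: e i \in translate i h E) = (x \in E).
  by apply/idP/idP; rewrite !inE /translate/= addrK.
by [].
Qed.

Lemma increment_mvt f i x h : C1 f ->
  exists s, f (x + h *: e i) - f x = h * partial i f (x + s *: e i).
Proof.
move=> C1f; pose z := x + h *: e i; pose F := f \o ray 1 x z.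
have dF (s : R) : s \in `]0, 1[ -> is_derive s (1 : R) F (derive1 F s).
  move=> _; have [h1 _] := derive_along_ray 0 x z s C1f.
  by rewrite derive1E; exact: derivableP.
have cF : {within `[0, 1], continuous F}.
  apply: continuous_subspaceT => s; apply: continuous_comp.
    exact: continuous_ray.
  exact: C1_continuous.
have [c _] := MVT ltr01 dF cF.
rewrite subr0 mulr1 /F /= /ray !expr1 scale1r scale0r addr0 [x + (z - x)]addrC subrK => ->.
have [_] := derive_along_ray 0 x z c C1f.
rewrite /F => ->; rewrite expr0 !mul1r.
have zx : z - x = h *: e i by rewrite /z addrAC subrr add0r.
exists (c * h); rewrite zx linearZ /= /ray expr1 zx scalerA /partial deriveE//.
by case: C1f => + _; exact.
Qed.

Lemma C1c_partial_bounded f i : C1c setT f -> exists2 B : R, 0 <= B & forall x, `|partial i f x| <= B.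
Proof.
move=> [C1f cS _].
have : compact ((fun x => `|partial i f x|) @` closure [set x | f x != 0]).
  apply: continuous_compact => //; apply: continuous_subspaceT => x.
  by apply: continuous_comp; [case: C1f => _; exact|exact: norm_continuous].
move=> /compact_bounded[M [Mr hM]].
exists (`|M| + 1) => [|x]; first by rewrite addr_ge0.
have [Sx|nSx] := pselect (closure [set x | f x != 0] x).
  have h : M < `|M| + 1 by rewrite (le_lt_trans (ler_norm M))// ltrDl.
  have := hM _ h `|partial i f x|; rewrite /= normr_id; apply.
  by exists x.
have := congr1 (fun g : 'rV[R]_d => g ord0 i) (grad_eq0 nSx).
by rewrite !mxE => ->; rewrite normr0 addr_ge0.
Qed.

Lemma bounded_integrable (F : 'rV[R]_d -> R) E (B : R) : measurable E -> (mu E < +oo)%E ->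
  measurable_fun setT F -> (forall x, `|F x| <= B) -> mu.-integrable E (EFin \o F).
Proof.
move=> mE Eoo mF FB; apply: measurable_bounded_integrable => //.
  exact: measurable_funTS.
exists B; split; first exact: num_real.
by move=> M BM x _ /=; apply: le_trans (FB x) (ltW BM).
Qed.

(* Applying translation invariance to f + 1 >= 0 leaves only the mass of f + 1 <= 2
   on the part of the translate outside E. *)
Lemma integral_increment_le f i h E (L : R) : C1 f -> (forall x, `|f x| <= 1) ->
  measurable E -> (mu E < +oo)%E ->
  (mu (translate i h E `\` E) <= (L * h)%:E)%E ->
  (\int[mu]_(x in E) (f (x + h *: e i) - f x)%:E <= (2 * L * h)%:E)%E.
Proof.
move=> C1f f1 mE Eoo hL.
have mf := continuous_measurable_rV (C1_continuous C1f).
pose F x := f x + 1.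
have mF : measurable_fun setT F by exact: measurable_funD.
have F0 x : 0 <= F x.
  by have := f1 x; rewrite ler_norml /F => /andP[h1 _]; lra.
have F2 x : F x <= 2.
  by have := f1 x; rewrite ler_norml /F => /andP[_ h1]; lra.
have mFh : measurable_fun setT (fun x => F (x + h *: e i)).
  apply: (measurableT_comp mF); apply: measurable_fun_coordP => j.
  under eq_fun do rewrite !mxE.
  by apply: measurable_funD => //; exact: measurable_coord.
have iF : mu.-integrable E (EFin \o F).
  by apply: (bounded_integrable (B := 2)) => // x; rewrite ger0_norm.
have iFh : mu.-integrable E (EFin \o (fun x => F (x + h *: e i))).
  by apply: (bounded_integrable (B := 2)) => // x; rewrite ger0_norm.
have mT := measurable_translate i h mE.
have -> : (\int[mu]_(x in E) (f (x + h *: e i) - f x)%:E =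
    \int[mu]_(x in E) (F (x + h *: e i))%:E - \int[mu]_(x in E) (F x)%:E)%E.
  rewrite -integralB_EFin//; apply: eq_integral => x _.
  by rewrite -EFinB /F; congr EFin; ring.
have fin : (\int[mu]_(x in E) (F x)%:E)%E \is a fin_num by exact: integrable_fin_num.
rewrite leeBlDr// integral_translate//.
have mD := measurableD mT mE.
apply: (@le_trans _ _ (\int[mu]_(x in E `|` (translate i h E `\` E)) (F x)%:E)%E).
  apply: ge0_subset_integral => //; first exact: measurableU.
  - by apply: measurable_funTS; exact/measurable_EFinP.
  - by move=> x _; rewrite lee_fin.
  - by move=> x Tx; have [Ex|nEx] := pselect (E x); [left|right].
rewrite ge0_integral_setU//; last 3 first.
- by apply: measurable_funTS; exact/measurable_EFinP.
- by move=> x _; rewrite lee_fin.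
- by apply/disj_setPS => x [Ex []].
rewrite addeC; apply: leeD2r.
apply: (@le_trans _ _ (\int[mu]_(x in translate i h E `\` E) (cst 2%:E x))%E).
  apply: ge0_le_integral => //.
  - by move=> x _; rewrite lee_fin.
  - by apply: measurable_funTS; exact/measurable_EFinP.
  - by move=> x _; rewrite lee_fin.
rewrite integral_cst//; apply: (@le_trans _ _ (2%:E * (L * h)%:E)%E).
  by apply: lee_wpmul2l.
by rewrite -EFinM mulrA.
Qed.

(** The difference quotients with steps 1/(n + 1) are uniformly bounded by the mean value theorem,
    so dominated convergence on [E] carries [integral_increment_le] to the limit. *)
Lemma integral_partial_le f i E (L : R) : C1c setT f -> (forall x, `|f x| <= 1) ->
  measurable E -> (mu E < +oo)%E ->
  (forall h, 0 < h <= 1 -> (mu (translate i h E `\` E) <= (L * h)%:E)%E) ->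
  mu.-integrable E (EFin \o partial i f) /\
  (\int[mu]_(x in E) (partial i f x)%:E <= (2 * L)%:E)%E.
Proof.
move=> cf f1 mE Eoo hL; have [C1f _ _] := cf.
have [B B0 hB] := C1c_partial_bounded i cf.
pose hn n : R := n.+1%:R^-1.
have hn0 n : 0 < hn n by rewrite invr_gt0 ltr0n.
have hn1 n : hn n <= 1 by rewrite invf_le1 ?ltr0n// ler1n.
pose g n x := (hn n)^-1 * (f (x + hn n *: e i) - f x).
have mf := continuous_measurable_rV (C1_continuous C1f).
have mp : measurable_fun setT (partial i f).
  by apply: continuous_measurable_rV; case: C1f => _; exact.
have mg n : measurable_fun setT (g n).
  apply: measurable_funM => //; apply: measurable_funB => //.
  apply: (measurableT_comp mf); apply: measurable_fun_coordP => j.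
  under eq_fun do rewrite !mxE.
  by apply: measurable_funD => //; exact: measurable_coord.
have gB n x : `|g n x| <= B.
  have [s es] := increment_mvt i x (hn n) C1f.
  by rewrite /g es mulrA mulVf ?gt_eqF// mul1r.
have gcvg x : (fun n => (g n x)%:E) @ \oo --> (partial i f x)%:E.
  apply/fine_cvgP; split; first by near=> n.
  have : derivable f x (e i) by apply: diff_derivable; case: C1f.
  move=> df; have dcv : h^-1 *: (f (h *: e i + x) - f x) @[h --> 0^'] --> partial i f x.
    exact: df.
  apply/cvgrPdist_le => eps eps0.
  move/cvgrPdist_le : dcv => /(_ eps eps0)[r /= r00 hr].
  have := @cvg_harmonic R; move/cvgrPdist_lt => /(_ r r00)[n0 _ hn0'].
  exists n0 => // n n0n /=.
  have := hr (hn n); rewrite /= /ball_/= => /(_ (hn0' _ n0n)).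
  by rewrite gt_eqF// => /(_ isT); rewrite /g addrC [hn n *: e i + x]addrC addrC.
have mgE n : measurable_fun E (fun x => (g n x)%:E).
  by apply/measurable_EFinP; exact: measurable_funTS.
have mpE : measurable_fun E (fun x => (partial i f x)%:E).
  by apply/measurable_EFinP; exact: measurable_funTS.
have iB : mu.-integrable E (cst B%:E).
  by apply: (bounded_integrable (F := fun=> B) (B := B)) => // x; rewrite ger0_norm.
have ae1 : {ae mu, forall x, E x -> (fun n => (g n x)%:E) @ \oo --> (partial i f x)%:E}.
  by apply: aeW => x _.
have ae2 : {ae mu, forall x n, E x -> (`|(g n x)%:E| <= cst B%:E x)%E}.
  by apply: aeW => x n _; rewrite lee_fin.
have [ip _ lim] := dominated_convergence mE mgE mpE ae1 iB ae2.
split; first exact: ip.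
apply: (cvge_to_le lim); near=> n.
have iD : mu.-integrable E (EFin \o (fun x => f (x + hn n *: e i) - f x)).
  apply: (bounded_integrable (B := 2)) => //.
    have -> : (fun x => f (x + hn n *: e i) - f x) = (fun x => hn n * g n x).
      by apply/funext => x; rewrite /g mulrA divff ?mul1r// gt_eqF.
    exact: measurable_funM.
  move=> x; apply: le_trans (ler_normB _ _) _; have := f1 x; have := f1 (x + hn n *: e i).
  lra.
pose k := (hn n)^-1.
have kh : k * hn n = 1 by rewrite mulVf// gt_eqF.
rewrite /= (_ : (\int[mu]_(x in E) (g n x)%:E)%E =
    (k%:E * \int[mu]_(x in E) (f (x + hn n *: e i) - f x)%:E)%E); last first.
  by rewrite -(integralZl mE iD); apply: eq_integral => x _.
apply: (@le_trans _ _ (k%:E * (2 * L * hn n)%:E)%E).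
  apply: lee_wpmul2l; first by rewrite lee_fin invr_ge0 ltW.
  by apply: integral_increment_le => //; apply: hL; rewrite hn0 hn1.
by rewrite -EFinM lee_fin mulrCA kh mulr1.
Unshelve. all: by end_near. Qed.

(** The divergence is treated coordinate by coordinate, each component of the field being bounded by
    1. Only translates of [E] enter, so its boundary never has to be described. *)
Lemma perimeter_le E (L : R) : measurable E -> (mu E < +oo)%E ->
  (forall i h, 0 < h <= 1 -> (mu (translate i h E `\` E) <= (L * h)%:E)%E) ->
  (perimeter E <= (2 * d%:R * L)%:E)%E.
Proof.
move=> mE Eoo hL; apply: ge_ereal_sup => _ [phi [cphi phi1] <-].
have h i := integral_partial_le (cphi i) (fun x => le_trans (abs_coord_le_enorm (phi x) i) (phi1 x))
  mE Eoo (hL i).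
rewrite /divergence; under eq_integral do rewrite -sumEFin.
rewrite integral_sum//; last by move=> i; have [] := h i.
apply: (@le_trans _ _ (\sum_(i < d) (2 * L)%:E)%E).
  by apply: lee_sum => i _; have [] := h i.
by rewrite sumEFin lee_fin sumr_const card_ord -[leLHS]mulr_natr mulrAC.
Qed.

End perimeter_bound.

(** * Cheeger constant of a perforated cube *)

Section cheeger_bound.
Context {R : realType} {d : nat}.
Local Notation mu := (lebesgue_rV R d).

Lemma measure_slab (c : 'rV[R]_d) (i : 'I_d) (a h t : R) : 0 <= a -> 0 <= h ->
  (mu [set x : 'rV[R]_d | (forall j, j != i -> (`|x ord0 j - c ord0 j| <= a)%R) /\
      (t <= x ord0 i <= t + h)%R] <= ((2 * a) ^+ d.-1 * h)%:E)%E.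
Proof.
move=> a0 h0.
pose lo j := if j == i then t else c ord0 j - a.
pose hi j := if j == i then t + h else c ord0 j + a.
have := @lebesgue_rV_itv R d lo hi true false.
have {}/[swap]/[apply] E : forall j, lo j <= hi j.
  by move=> j; rewrite /lo /hi; case: ifP => _; lra.
have -> : ((2 * a) ^+ d.-1 * h)%:E = (\prod_(j < d) (hi j - lo j))%:E :> \bar R.
  congr EFin; rewrite (bigD1 i)//= /hi /lo eqxx addrAC subrr add0r mulrC; congr (_ * _).
  rewrite (eq_bigr (fun=> 2 * a)) => [|j /negbTE ->]; last by lra.
  by rewrite prodr_const; congr (_ ^+ _); rewrite cardC1 card_ord.
rewrite -E le_eqVlt; apply/orP; left; apply/eqP; congr (mu _).
apply/seteqP; split=> x /=.
  move=> [hx hi'] j; rewrite in_itv/= /lo /hi; case: eqVneq => [->//|ji].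
  by have := hx j ji; rewrite ler_distl.
move=> hx; split=> [j /negbTE ji|].
  by have := hx j; rewrite in_itv/= /lo /hi ji ler_distl.
by have := hx i; rewrite in_itv/= /lo /hi eqxx.
Qed.


(** A point moved by [h] in direction [i] leaves the set either through the upper face of the box or
    by entering a hole through its lower face; in both cases it lands in a slab of thickness [h]. *)
Lemma swiss_translate_subset N r (i : 'I_d) (h : R) : 0 < h -> 0 < r ->
  translate i h (swiss N r) `\` swiss N r `<=`
  [set x : 'rV[R]_d | (forall j, j != i ->
      `|x ord0 j - (box_center N : 'rV[R]_d) ord0 j| <= N%:R / d%:R) /\
    (3 * N)%:R + N%:R / d%:R <= x ord0 i <= (3 * N)%:R + N%:R / d%:R + h] `|`
  [set x : 'rV[R]_d | exists c : 'rV['I_(6 * N).+1]_d,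
    (forall j, j != i -> `|x ord0 j - node c ord0 j| <= 2 * r) /\
    node c ord0 i - 2 * r <= x ord0 i <= node c ord0 i - 2 * r + h].
Proof.
move=> h0 r0 x [[/cboxP Kx nHx] nsx].
have sh j : (x - h *: delta_mx ord0 i) ord0 j = x ord0 j - h * (j == i)%:R.
  by rewrite !mxE eqxx.
have shj j : j != i -> (x - h *: delta_mx ord0 i) ord0 j = x ord0 j.
  by move=> /negbTE ji; rewrite sh ji mulr0 subr0.
have shi : (x - h *: delta_mx ord0 i) ord0 i = x ord0 i - h by rewrite sh eqxx mulr1.
have [Kx'|nKx] := pselect (cbox (box_center N) (N%:R / d%:R) x).
  have [c /cboxP Hc] : holes (6 * N).+1 (2 * r) x by apply: contrapT => nH; apply: nsx.
  right; exists c; split=> [j _|]; first exact: Hc.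
  have := Hc i; rewrite ler_distl => /andP[-> h2] /=; rewrite leNgt; apply/negP => lt.
  apply: nHx; exists c; apply/cboxP => j; have [->|ji] := eqVneq j i.
    rewrite shi ler_distl; apply/andP; split; lra.
  by rewrite shj.
left; split=> [j ji|]; first by have := Kx j; rewrite shj.
have := Kx i; rewrite shi ler_distl mxE => /andP[h1 h2].
apply/andP; split; last by lra.
rewrite leNgt; apply/negP => lt; apply: nKx; apply/cboxP => j.
have [->|ji] := eqVneq j i; last by have := Kx j; rewrite shj.
rewrite mxE ler_distl; apply/andP; split; lra.
Qed.

(** The competitor is [swiss N r]: its perimeter is of order N^(d-1) + N^d r^(d-1) and its measure
    of order N^d. *)
Lemma cheeger_perforated_le N n r : (0 < d)%N -> (0 < N)%N -> 0 < r ->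
  r <= (28 * d%:R)^-1 ->
  (cheeger (@perforated R d N (r / 2 ^+ n.+1)) <=
    (2 * d%:R * (28 * d%:R) ^+ d * (N%:R^-1 + r ^+ d.-1))%:E)%E.
Proof.
move=> d0 N0 r0 rd.
have d0R : 0 < d%:R :> R by rewrite ltr0n.
have d1R : 1 <= d%:R :> R by rewrite ler1n.
have N0R : 0 < N%:R :> R by rewrite ltr0n.
have Nd : 0 < N%:R / d%:R :> R by rewrite divr_gt0.
have mE := @measurable_swiss R d N r.
have mK := measurable_cbox (box_center N : 'rV[R]_d) (N%:R / d%:R).
have Eoo : (mu (swiss N r) < +oo)%E.
  apply: (@le_lt_trans _ _ (mu (cbox (box_center N) (N%:R / d%:R)))).
    by apply: le_measure; rewrite ?inE// => x [].
  by rewrite measure_cbox ?(ltW Nd)// ltry.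
(* The area of one face of the box plus that of one face of each hole. *)
pose L : R := (2 * (N%:R / d%:R)) ^+ d.-1 + (6 * N).+1%:R ^+ d * (2 * (2 * r)) ^+ d.-1.
have hL i h : 0 < h <= 1 -> (mu (translate i h (swiss N r) `\` swiss N r) <= (L * h)%:E)%E.
  move=> /andP[h0 _].
  pose S (c : 'rV[R]_d) (a t : R) := [set x : 'rV[R]_d | (forall j, j != i -> `|x ord0 j - c ord0 j| <= a) /\
    t <= x ord0 i <= t + h].
  have mS c a t : measurable (S c a t).
    rewrite (_ : S c a t = [set x : 'rV[R]_d | forall j, x ord0 j \in
      (if j == i then `[t, t + h] else `[c ord0 j - a, c ord0 j + a])]).
      by apply: (@measurable_box R d (fun j => [set` if j == i then `[t, t + h] else `[c ord0 j - a, c ord0 j + a] ])).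
    apply/seteqP; split=> x /=.
      move=> [hx hi'] j; case: eqVneq => [->|ji]; rewrite in_itv//=.
      by have := hx j ji; rewrite ler_distl.
    move=> hx; split=> [j /negbTE ji|].
      by have := hx j; rewrite ji in_itv/= ler_distl.
    by have := hx i; rewrite eqxx in_itv.
  pose A0 := S (box_center N) (N%:R / d%:R) ((3 * N)%:R + N%:R / d%:R).
  pose A1 (c : 'rV['I_(6 * N).+1]_d) := S (node c) (2 * r) (node c ord0 i - 2 * r).
  have mA1 : measurable [set x | exists c, A1 c x] by apply: measurable_exists => c; exact: mS.
  apply: (@le_trans _ _ (mu (A0 `|` [set x | exists c, A1 c x]))).
    apply: le_measure; rewrite ?inE.
    - by apply: measurableD => //; exact: measurable_translate.
    - by apply: measurableU => //; exact: mS.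
    - exact: swiss_translate_subset.
  apply: (@le_trans _ _ (mu A0 + mu [set x | exists c, A1 c x])%E).
    by apply: measureU2 => //; exact: mS.
  rewrite /L mulrDl EFinD; apply: leeD.
    by apply: measure_slab; rewrite ?(ltW Nd) ?(ltW h0).
  apply: (@le_trans _ _ (\sum_(c : 'rV['I_(6 * N).+1]_d) mu (A1 c))%E).
    by apply: measure_exists_le => c; exact: mS.
  apply: (@le_trans _ _ (\sum_(c : 'rV['I_(6 * N).+1]_d) ((2 * (2 * r)) ^+ d.-1 * h)%:E)%E).
    by apply: lee_sum => c _; apply: measure_slab; rewrite ?mulr_ge0 ?(ltW r0) ?(ltW h0).
  rewrite sumEFin lee_fin sumr_const card_nodes -[leLHS]mulr_natr natrX.
  by rewrite le_eqVlt; apply/orP; left; apply/eqP; ring.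
have P := perimeter_le mE Eoo hL.
have M := measure_swiss_ge d0 N0 r0 rd.
have Nd0 : 0 < (N%:R / d%:R) ^+ d :> R by rewrite exprn_gt0.
have cl1 : closure (swiss N r) `<=` [set x : 'rV[R]_d | enorm (x - box_center N) <= N%:R].
  rewrite closureE => x; apply; split; first exact: closed_enorm_le.
  move=> y [/cboxP Ky _] /=.
  have -> : N%:R = d%:R * (N%:R / d%:R) :> R by field; rewrite gt_eqF.
  by apply: enorm_le_coord => i; have := Ky i; rewrite !mxE.
have cl2 (c : 'rV['I_(6 * N).+1]_d) :
    closure (swiss N r) `<=` [set x : 'rV[R]_d | 2 * r <= enorm (x - node c)].
  rewrite closureE => x; apply; split; first exact: closed_enorm_ge.
  move=> y [_ nH] /=; rewrite leNgt; apply/negP => lt; apply: nH; exists c.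
  apply/cboxP => i; apply: le_trans (ltW lt).
  by have := abs_coord_le_enorm (y - node c) i; rewrite !mxE.
apply: (@le_trans _ _ (perimeter (swiss N r) / mu (swiss N r))%E).
  apply: ereal_inf_lbound; exists (swiss N r) => //; split=> //.
  - apply: (subclosed_compact _ _ cl1); first exact: closed_closure.
    exact: compact_enorm_le.
  - move=> x hx; split=> [i|c].
      have := le_trans (abs_coord_le_enorm _ i) (cl1 _ hx).
      by rewrite !mxE !natrM ler_norml => /andP[h1 h2]; apply/andP; split; lra.
    apply: lt_le_trans (cl2 c _ hx).
    have e2 : 1 <= 2 ^+ n.+1 :> R by rewrite exprn_ege1// ler1n.
    rewrite ltr_pdivrMr ?exprn_gt0//; nra.
  - by apply: lt_le_trans M; rewrite lte_fin.
move: M Eoo; case: (mu (swiss N r)) => [m| |]//; rewrite lee_fin => hm _.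
have m0 : 0 < m by exact: lt_le_trans hm.
rewrite inver gt_eqF//.
have L0 : 0 <= L by rewrite addr_ge0 ?mulr_ge0 ?exprn_ge0 ?mulr_ge0 ?(ltW r0) ?(ltW Nd).
apply: (@le_trans _ _ ((2 * d%:R * L)%:E * (m^-1)%:E)%E).
  by apply: lee_wpmul2r => //; rewrite lee_fin invr_ge0 ltW.
rewrite -EFinM lee_fin ler_pdivrMr//.
apply: (@le_trans _ _ (2 * d%:R * (28 * d%:R) ^+ d * (N%:R^-1 + r ^+ d.-1) * (N%:R / d%:R) ^+ d)); last first.
  by rewrite ler_wpM2l// !mulr_ge0 ?exprn_ge0 ?addr_ge0 ?invr_ge0 ?exprn_ge0 ?mulr_ge0 ?(ltW r0).
rewrite -!mulrA ler_wpM2l// ler_wpM2l ?(ltW d0R)//.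
have -> : (28 * d%:R) ^+ d * ((N%:R^-1 + r ^+ d.-1) * (N%:R / d%:R) ^+ d) =
    (28 * N%:R) ^+ d * (N%:R^-1 + r ^+ d.-1).
  rewrite mulrCA mulrC -exprMn; congr (_ ^+ d * _); field; by rewrite gt_eqF.
rewrite mulrDr; apply: lerD.
  have e28 : (28 * N%:R) ^+ d = 28 * (28 * N%:R) ^+ d.-1 * N%:R :> R.
    by rewrite -[in LHS](prednK d0) exprS; ring.
  rewrite e28 mulfK ?gt_eqF//.
  apply: (@le_trans _ _ ((28 * N%:R) ^+ d.-1)).
    rewrite lerXn2r ?nnegrE ?mulr_ge0 ?(ltW Nd)//.
    have : N%:R / d%:R <= N%:R :> R by rewrite ler_pdivrMr// ler_peMr.
    move: (N%:R / d%:R) => z; lra.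
  by rewrite ler_peMl ?ler1n// exprn_ge0// mulr_ge0.
have -> : 2 * (2 * r) = 4 * r by ring.
rewrite exprMn mulrA ler_wpM2r ?exprn_ge0 ?(ltW r0)//.
apply: (@le_trans _ _ ((7 * N%:R) ^+ d * 4 ^+ d)).
  apply: ler_pM; rewrite ?exprn_ge0//.
    rewrite lerXn2r ?nnegrE ?mulr_ge0//.
    rewrite -[(6 * N).+1%:R]natr1 natrM; have : 1 <= N%:R :> R by rewrite ler1n.
    lra.
  by rewrite ler_weXn2l ?ler1n// leq_pred.
by rewrite -exprMn lerXn2r ?nnegrE ?mulr_ge0//; lra.
Qed.

End cheeger_bound.

(** * Blow-up of the supremum *)
Section blow_up.
Context {R : realType} {d : nat}.
Local Notation mu := (lebesgue_rV R d).

(** The zero field competes in the supremum. *)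
Lemma perimeter_ge0 (E : set 'rV[R]_d) : (0 <= perimeter E)%E.
Proof.
apply: ereal_sup_ubound; exists (fun=> 0).
  split=> [i|x]; last by rewrite enorm0.
  have -> : (fun x : 'rV[R]_d => (0 : 'rV[R]_d) ord0 i) = (fun=> 0).
    by apply/funext => x; rewrite mxE.
  have s0 : [set x : 'rV[R]_d | (0 : R) != 0] = set0.
    by apply/seteqP; split=> x //=; rewrite eqxx.
  by split; [exact: C1_cst|rewrite s0 closure0; exact: compact0|].
apply: integral0_eq => x _; rewrite /divergence big1// => i _.
have -> : (fun y : 'rV[R]_d => (0 : 'rV[R]_d) ord0 i) = cst 0.
  by apply/funext => y; rewrite mxE.
by rewrite /partial derive_cst.
Qed.

Lemma lambda_root_ge0 (q : R) (W : set 'rV[R]_d) : (0 <= lambda_root q%:E W)%E.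
Proof.
rewrite /lambda_root; case: ifP => _; last exact: poweR_ge0.
apply: le_ereal_inf_tmp => _ [E _ <-].
by rewrite mule_ge0 ?perimeter_ge0// inve_ge0.
Qed.

(** At q = 1 the power of n + 1 is 1, so the Cheeger estimate takes the same form as the one from
    test functions. *)
Lemma lambda_root_perforated_le (q : R) : (0 < d)%N -> 1 <= q -> q <= d%:R ->
  exists2 C : R, 0 < C & forall N n r, (0 < N)%N -> 0 < r -> r <= (28 * d%:R)^-1 ->
    (lambda_root q%:E (@perforated R d N (r / 2 ^+ n.+1)) <=
     ((C * (N%:R `^ (- q) + n.+1%:R `^ (1 - q) * r `^ (d%:R - q))) `^ q^-1)%:E)%E.
Proof.
move=> d0 q1 qd; have q0 : 0 < q by exact: lt_le_trans q1.
have d0R : 0 < d%:R :> R by rewrite ltr0n.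
have [qq|qn] := eqVneq q 1.
  exists (2 * d%:R * (28 * d%:R) ^+ d); first by rewrite !mulr_gt0 ?exprn_gt0 ?mulr_gt0.
  move=> N n r N0 r0 rd; rewrite /lambda_root qq eqxx subrr powRr0 mul1r invr1.
  apply: le_trans (cheeger_perforated_le n d0 N0 r0 rd) _.
  have -> : d%:R - 1 = d.-1%:R :> R by rewrite -{1}(prednK d0) -natr1 addrK.
  rewrite powR_inv1// powR_mulrn ?(ltW r0)// powRr1//.
  by rewrite !mulr_ge0 ?addr_ge0 ?exprn_ge0 ?mulr_ge0 ?(ltW r0).
exists ((32 * d%:R) `^ q * (28 * d%:R) ^+ d).
  by rewrite mulr_gt0 ?exprn_gt0 ?powR_gt0 ?mulr_gt0.
move=> N n r N0 r0 rd; rewrite /lambda_root (negbTE qn) -poweR_EFin.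
have h := lambda_perforated_le n d0 N0 r0 rd q1 qd.
have := gt0_ler_poweR (r := q^-1) _ _ _ h; rewrite invr_ge0 (ltW q0) => /(_ isT); apply.
  rewrite in_itv/= leey andbT; apply: le_ereal_inf_tmp => _ [u _ <-].
  rewrite /rayleigh mule_ge0//.
    by apply: integral_ge0 => x _; rewrite lee_fin powR_ge0.
  by rewrite inve_ge0; apply: integral_ge0 => x _; rewrite lee_fin powR_ge0.
rewrite in_itv/= leey andbT lee_fin !mulr_ge0 ?powR_ge0 ?exprn_ge0//.
by rewrite addr_ge0 ?mulr_ge0 ?powR_ge0.
Qed.

(** The left side bounds lambda_q from above and the right side is the q-th power of [eps] times the
    size of the lower bound for exponent p, so the ratio can be made as large as desired. *)
Lemma scale_choice (q beta C eps : R) : (2 <= d)%N -> 1 <= q -> q <= d%:R -> 0 <= beta ->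
  (q < d%:R -> beta < d%:R / q - 1) -> (q = d%:R -> beta = 0) -> 0 < C -> 0 < eps ->
  exists N n (r : R), [/\ (0 < N)%N, 0 < r, r <= (28 * d%:R)^-1 &
    C * (N%:R `^ (- q) + n.+1%:R `^ (1 - q) * r `^ (d%:R - q)) <=
    (eps * (r / 2 ^+ n.+1 / d%:R) `^ beta) `^ q].
Proof.
move=> d2 q1 qd b0 bq bd C0 eps0; have q0 : 0 < q by exact: lt_le_trans q1.
have d0R : 0 < d%:R :> R by rewrite ltr0n (ltn_trans _ d2).
have r00 : 0 < (28 * d%:R)^-1 :> R by rewrite invr_gt0 mulr_gt0.
have epsq : 0 < eps `^ q by rewrite powR_gt0.
have [qd'|qd'] := eqVneq q d%:R.
  (* With [beta = 0] the target is the constant eps^q. Taking N = n + 1 makes both terms at most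
     1/(n + 1), the second one because q = d >= 2. *)
  rewrite (bd qd'); pose n := Num.truncn (2 * C / eps `^ q).
  have hn : 2 * C / eps `^ q < n.+1%:R by exact: truncnS_gt.
  have n1 : 1 <= n.+1%:R :> R by rewrite ler1n.
  exists n.+1, n, ((28 * d%:R)^-1); split=> //.
  rewrite powRr0 mulr1 -qd' subrr powRr0 mulr1.
  have le1 : n.+1%:R `^ (- q) <= n.+1%:R^-1 :> R.
    by rewrite -[leRHS]powR_inv1// ler_powR// lerN2.
  have le2 : n.+1%:R `^ (1 - q) <= n.+1%:R^-1 :> R.
    rewrite -[leRHS]powR_inv1// ler_powR//.
    have : 2 <= q by rewrite qd' ler_nat.
    lra.
  apply: (@le_trans _ _ (C * (n.+1%:R^-1 + n.+1%:R^-1))).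
    by rewrite ler_pM2l// lerD.
  have -> : C * (n.+1%:R^-1 + n.+1%:R^-1) = 2 * C / n.+1%:R by ring.
  rewrite ler_pdivrMr ?ltr0n//.
  by rewrite [leRHS]mulrC -ler_pdivrMr// ltW.
have {}qd' : q < d%:R by rewrite lt_neqAle qd'.
(* A single scale is enough here: the two sides are powers of [r] with exponents d - q and beta q,
   and [g] is their positive difference. *)
pose g := d%:R - q - beta * q.
have g0 : 0 < g.
  have := bq qd'; rewrite -(ltr_pM2r q0) mulrBl mul1r divfK ?gt_eqF// /g; lra.
pose D := 2 * d%:R : R.
have D0 : 0 < D by rewrite mulr_gt0.
(* The threshold for r^g: the factor 2 accounts for the two terms once they are comparable, and [D]
   for the hole of radius r / 2 divided by [d]. *)
pose kap := eps `^ q * D `^ (- (beta * q)) / (2 * C).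
have kap0 : 0 < kap by rewrite divr_gt0 ?mulr_gt0 ?powR_gt0.
pose r := Num.min (28 * d%:R)^-1 (kap `^ g^-1).
have r0 : 0 < r by rewrite lt_min r00 powR_gt0.
have rg : r `^ g <= kap.
  apply: (@le_trans _ _ ((kap `^ g^-1) `^ g)).
    by rewrite ge0_ler_powR ?nnegrE ?powR_ge0 ?(ltW g0) ?(ltW r0)// ge_min lexx orbT.
  by rewrite -powRrM mulVf ?gt_eqF// powRr1// ltW.
(* Chosen so that N >= X brings N^(-q) below r^(d - q). *)
pose X := r `^ (- ((d%:R - q) / q)).
pose N := (Num.truncn X).+1.
have X0 : 0 < X by rewrite powR_gt0.
have XN : X <= N%:R by rewrite ltW// truncnS_gt.
exists N, 0%N, r; split=> //; first by rewrite ge_min lexx.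
have hN : N%:R `^ (- q) <= r `^ (d%:R - q).
  have -> : r `^ (d%:R - q) = X `^ (- q).
    rewrite /X -powRrM; congr (_ `^ _); field; by rewrite gt_eqF.
  rewrite !powRN lef_pV2 ?posrE ?powR_gt0// ?ltr0n//.
  by rewrite ge0_ler_powR ?nnegrE ?(ltW q0) ?(ltW X0).
rewrite powR1 mul1r expr1.
apply: (@le_trans _ _ (2 * C * r `^ (d%:R - q))).
  by have := ler_wpM2l (ltW C0) hN; lra.
have -> : r / 2 / d%:R = r * D^-1 by rewrite /D; field; rewrite gt_eqF.
have Dinv : D^-1 `^ (beta * q) = D `^ (- (beta * q)).
  by rewrite -[in LHS]powR_inv1 ?(ltW D0)// -powRrM mulN1r.
rewrite powRM ?powR_ge0 ?(ltW eps0)// -powRrM powRM ?invr_ge0 ?(ltW D0) ?(ltW r0)// Dinv.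
have -> : r `^ (d%:R - q) = r `^ g * r `^ (beta * q).
  rewrite -powRD; first by rewrite /g subrK.
  by rewrite (gt_eqF r0) implybT.
have -> : eps `^ q * (r `^ (beta * q) * D `^ (- (beta * q))) =
    eps `^ q * D `^ (- (beta * q)) * r `^ (beta * q) by ring.
rewrite mulrA ler_wpM2r ?powR_ge0// mulrC -ler_pdivlMr ?mulr_gt0//.
Qed.

Lemma M_pq_pinfty (q : R) (p : \bar R) : (2 <= d)%N -> 1 <= q -> (q%:E < p <= +oo)%E ->
  q <= d%:R -> M_pq d p q%:E = +oo%E.
Proof.
move=> d2 q1 qp qd; have d0 : (0 < d)%N by exact: ltn_trans d2.
have q0 : 0 < q by exact: lt_le_trans q1.
have d0R : 0 < d%:R :> R by rewrite ltr0n.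
have [beta [K [b0 K0 bq bd low]]] := lambda_root_perforated_lower d0 q1 qp qd.
have [C C0 up] := lambda_root_perforated_le d0 q1 qd.
apply/eqyP => A A0.
(* The bounds for p and q will be K t and (K / A) t with the same t = (delta / d)^beta, so their
   ratio is exactly the prescribed [A]. *)
have eps0 : 0 < K / A by rewrite divr_gt0.
have [N [n [r [N0 r0 rd hr]]]] := scale_choice d2 q1 qd b0 bq bd C0 eps0.
set delta := r / 2 ^+ n.+1 in hr.
have delta0 : 0 < delta by rewrite divr_gt0// exprn_gt0.
have delta12 : delta < 2^-1.
  have r28 : r <= 28^-1.
    apply: le_trans rd _; rewrite lef_pV2 ?posrE ?mulr_gt0//.
    by rewrite ler_peMr// ler1n.
  have : delta <= r.
    by rewrite ler_pdivrMr ?exprn_gt0// ler_peMr ?(ltW r0)// exprn_ege1// ler1n.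
  lra.
have AW := @A_all_perforated R d N delta d0 N0 delta12.
apply: le_ereal_sup_tmp; exists (F_pq p q%:E (@perforated R d N delta)).
  by exists (perforated N delta).
rewrite /F_pq.
pose t := (delta / d%:R) `^ beta.
have t0 : 0 < t by rewrite powR_gt0// divr_gt0.
have hlow := low N delta N0; rewrite delta0 delta12 in hlow; have {}hlow := hlow isT.
have hup : (lambda_root q%:E (@perforated R d N delta) <= (K / A * t)%:E)%E.
  apply: le_trans (up N n r N0 r0 rd) _; rewrite lee_fin.
  apply: (@le_trans _ _ (((K / A * t) `^ q) `^ q^-1)).
    rewrite ge0_ler_powR ?nnegrE ?invr_ge0 ?(ltW q0) ?powR_ge0//.
    by rewrite mulr_ge0 ?(ltW C0)// addr_ge0 ?mulr_ge0 ?powR_ge0.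
  by rewrite -powRrM divff ?gt_eqF// powRr1// mulr_ge0 ?(ltW t0) ?(ltW eps0).
(* If the Cheeger constant were 0 its inverse would be +oo, which is harmless here. *)
have hinv : (((K / A * t)^-1)%:E <= (lambda_root q%:E (@perforated R d N delta))^-1)%E.
  move: hup (lambda_root_ge0 q (@perforated R d N delta)).
  case: (lambda_root _ _) => [b| |]//; rewrite !lee_fin => hb b00.
  rewrite inver; case: eqVneq => [_|bn]; first by rewrite leey.
  have bgt0 : 0 < b by rewrite lt_neqAle eq_sym bn.
  by rewrite lee_fin lef_pV2 ?posrE// mulr_gt0.
apply: (@le_trans _ _ ((K * t)%:E * ((K / A * t)^-1)%:E)%E).
  rewrite -EFinM lee_fin le_eqVlt; apply/orP; left; apply/eqP; field.
  by rewrite !gt_eqF.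
apply: lee_pmul => //; rewrite lee_fin ?invr_ge0 mulr_ge0// ?(ltW t0) ?(ltW K0) ?(ltW eps0)//.
Qed.

End blow_up.

Theorem theorem2p9 (R : realType) (d : nat) (hd : (2 <= d)%N) :
  (forall q : R, d%:R < q ->
     exists C : R,
       [/\ 0 < C,
           forall W : set 'rV[R]_d, W !=set0 -> bounded_set W -> open W ->
             (C%:E * (inradius W)^-1 <= lambda_root q%:E W)%E
         & forall p : \bar R, (q%:E < p <= +oo)%E ->
             (M_pq d p q%:E < lambda_root p (eball (0%R : 'rV[R]_d) 1%R) / C%:E)%E])
  /\
  (forall (q : R) (p : \bar R), 1 <= q -> (q%:E < p <= +oo)%E -> q <= d%:R ->
     M_pq d p q%:E = +oo%E).
Proof. by split=> [q|q p q1 qp qd]; [exact: M_pq_lt_above_dimension|exact: M_pq_pinfty]. Qed.
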